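(* Let $\kappa$ be an infinite cardinal such that there is a basis of families on $\kappa$. Then for every $1\le\alpha<\omega_1$ there is a reflexive Banach space $\mathfrak X_\alpha$ of density $\kappa$ with a long unconditional basis such that (a) every bounded sequence in $\mathfrak X_\alpha$ without norm-convergent subsequences has a subsequence which is an $\ell_1^\alpha$-spreading model, and (b) no sequence in $\mathfrak X_\alpha$ is an $\ell_1^{\iota(\omega^\alpha)+\alpha\cdot\omega}$-spreading model. Consequently, (c) $\mathfrak X_\alpha$ does not have subsymmetric sequences; (d) if $\iota(\omega^\alpha)+\alpha\cdot\omega\le\beta<\omega_1$, then $\mathfrak X_\alpha$ and $\mathfrak X_\beta$ are totally incomparable, i.e. no infinite dimensional subspace of $\mathfrak X_\alpha$ is isomorphic to a subspace of $\mathfrak X_\beta$.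
   Context: FAMILIES. A family on a set $I$ is a set of finite subsets of $I$, identified with a subset of $\{0,1\}^I$. It is compact if it is closed in $\{0,1\}^I$, and hereditary if it is closed under subsets. $\mathcal F\restriction A=\{s\in\mathcal F: s\subseteq A\}$. For a nonempty compact family $\mathcal F$ (a scattered compact space), $\mathrm{rk}(\mathcal F)$ is the largest ordinal $\alpha$ such that the Cantor–Bendixson derivative $\mathcal F^{(\alpha)}$ is nonempty, where $X^{(0)}=X$, $X^{(\alpha)}=\bigcap_{\beta<\alpha}(X^{(\beta)})'$ and $Y'$ is the set of accumulation points of $Y$ belonging to $Y$. A countable ordinal $\lambda\ge\omega$ is exp-indecomposable if $\beta^\gamma<\lambda$ (ordinal exponentiation) for all $\beta,\gamma<\lambda$. For $\alpha<\omega_1$, $\iota(\alpha)$ is the least exp-indecomposable ordinal $>\alpha$. All ordinal operations in the claim are ordinal arithmetic. For an infinite set $I$: the small rank of a compact family $\mathcal F$ on $I$ is $\mathrm{srk}(\mathcal F)=\min\{\mathrm{rk}(\mathcal F\restriction C): C\subseteq I\text{ infinite}\}$. A compact hereditary family $\mathcal F$ on $I$ is $\alpha$-homogeneous if either $\alpha=0$ and $\mathcal F=\{\emptyset\}$, or $1\le\alpha<\omega_1$, $[I]^{\le 1}\subseteq\mathcal F$ and $\alpha=\mathrm{srk}(\mathcal F)\le\mathrm{rk}(\mathcal F)<\iota(\alpha)$; it is homogeneous if this holds for some $\alpha<\omega_1$. $[I]^{\le n}$ is the family of subsets of $I$ of cardinality $\le n$, and $\mathcal F\sqcup\mathcal G=\{s\cup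 t:s\in\mathcal F,t\in\mathcal G\}$. UNIFORM FAMILIES. For a family $\mathcal F$ on $\omega$ let $\mathcal F_{\{n\}}=\{s: n<\min s\text{ (or }s=\emptyset),\ \{n\}\cup s\in\mathcal F\}$, and let $M/n=\{m\in M:m>n\}$. A family $\mathcal F$ on an infinite $M\subseteq\omega$ with $\emptyset\in\mathcal F$ is $\alpha$-uniform on $M$ ($\alpha<\omega_1$) if: $\mathcal F=\{\emptyset\}$ when $\alpha=0$; every $\mathcal F_{\{n\}}$, $n\in M$, is $\beta$-uniform on $M/n$ when $\alpha=\beta+1$; and every $\mathcal F_{\{n\}}$, $n\in M$, is $\alpha_n$-uniform on $M/n$ with $(\alpha_n)_{n\in M}$ an increasing sequence of ordinals below $\alpha$ with supremum $\alpha$ when $\alpha$ is limit. $\mathcal F$ is spreading if $\{m_0<\dots<m_k\}\in\mathcal F$ and $n_0<\dots<n_k$ with $m_i\le n_i$ for all $i$ imply $\{n_0,\dots,n_k\}\in\mathcal F$. $\mathfrak S$ is the collection of all hereditary, spreading, uniform families on $\omega$. BASES. Let $\mathcal F$ be a homogeneous family on $I$ and $\mathcal H$ a homogeneous family on $\omega$. A family $\mathcal G$ on $I$ is a multiplication of $\mathcal F$ by $\mathcal H$ if (M.1) $\mathcal G$ is homogeneous and $\iota(\mathrm{srk}(\mathcal G))=\iota(\mathrm{srk}(\mathcal F)\cdot\mathrm{srk}(\mathcal H))$; and (M.2) every sequence $(s_n)_{n<\omega}$ in $\mathcal F$ has an infinite subsequence $(t_n)_n$ with $\bigcup_{n\in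 x}t_n\in\mathcal G$ for every $x\in\mathcal H$. A basis of families on $I$ is a pair $(\mathfrak B,\times)$ such that: (B.1) $\mathfrak B$ consists of homogeneous families on $I$, contains all $[I]^{\le n}$, and for every $\omega\le\alpha<\omega_1$ contains some $\mathcal F$ with $\mathrm{srk}(\mathcal F)=\alpha$; (B.2) $\mathfrak B$ is closed under $\cup$ and $\sqcup$, and if $\mathcal F\subseteq\mathcal G\in\mathfrak B$, $\mathcal F$ is homogeneous and $\iota(\mathrm{srk}(\mathcal F))=\iota(\mathrm{srk}(\mathcal G))$, then $\mathcal F\in\mathfrak B$; (B.3) $\times:\mathfrak B\times\mathfrak S\to\mathfrak B$ and $\mathcal F\times\mathcal H$ is a multiplication of $\mathcal F$ by $\mathcal H$ for all $\mathcal F\in\mathfrak B$, $\mathcal H\in\mathfrak S$. SPREADING MODELS. Fix a Schreier sequence $(\mathcal S_\alpha)_{\alpha<\omega_1}$ of families on $\omega$: $\mathcal S_0=[\omega]^{\le1}$; $\mathcal S_{\alpha+1}=\mathcal S_\alpha\otimes\mathcal S$, where $\mathcal S=\{s\subseteq\omega:\#s\le\min s\}\cup\{\emptyset\}$ and $\mathcal F\otimes\mathcal G=\{\bigcup_{i<n}s_i: s_i\in\mathcal F\setminus\{\emptyset\},\ \max s_i<\min s_{i+1},\ \{\min s_i\}_{i<n}\in\mathcal G\}$; and for $\alpha$ limit $\mathcal S_\alpha=\bigcup_{n<\omega}(\mathcal S_{\alpha_n}\restriction(\omega\setminus n))$ for a fixed sequence $(\alpha_n)_n$ of ordinals below $\alpha$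 with $\sup_n\alpha_n=\alpha$. A bounded sequence $(x_n)_{n<\omega}$ in a normed space is an $\ell_1^\alpha$-spreading model if there is $C>0$ with $\|\sum_{n\in s}a_nx_n\|\ge C\sum_{n\in s}|a_n|$ for all $s\in\mathcal S_\alpha$ and all scalars $(a_n)_{n\in s}$. A non-constant sequence $(x_n)_n$ is subsymmetric if there is $C\ge1$ with $\|\sum_{i=1}^na_ix_{l_i}\|\le C\|\sum_{i=1}^na_ix_{k_i}\|$ for all $n$, all scalars $a_i$, and all $l_1<\dots<l_n$, $k_1<\dots<k_n$. A long unconditional basis is an unconditional basis indexed by an (in general uncountable) ordinal. *)

(* Defs.v *)
From HB Require Import structures.
From mathcomp Require Import all_boot all_order all_algebra finmap.
From mathcomp Require Import all_classical all_reals all_analysis.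
From mathcomp Require Import wochoice summability.

Set Implicit Arguments.
Unset Strict Implicit.
Unset Printing Implicit Defensive.

Import Order.TTheory GRing.Theory Num.Theory.
Import numFieldNormedType.Exports.

Local Open Scope classical_set_scope.
Local Open Scope card_scope.

(* The type omega1 consists of the elements of a well-ordered copy of the
   continuum that have only countably many predecessors; this is an initial
   segment, of order type omega_1.  An element stands for the order type of
   the set of its predecessors. *)

Definition continuum_wo : rel (set nat) := sval (well_ordering_principle (set nat)).

Lemma continuum_woP : well_order continuum_wo.
Proof. exact: svalP. Qed.

Lemma continuum_wo_refl : reflexive continuum_wo.
Proof.
move=> x; have [|z [[zx lb] _]] := continuum_woP (A := pred1 x).
  by exists x; rewrite inE.
have zx' : continuum_wo z x by apply: lb; rewrite inE.
by move: zx zx'; rewrite inE => ->.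
Qed.

Lemma continuum_wo_total : total continuum_wo.
Proof.
move=> x y; have [|z [[zA lb] _]] := continuum_woP (A := pred2 x y).
  by exists x; rewrite !inE eqxx.
have zx : continuum_wo z x by apply: lb; rewrite !inE eqxx.
have zy : continuum_wo z y by apply: lb; rewrite !inE eqxx orbT.
by move: zA; rewrite !inE => /orP[] /eqP ez; rewrite ez in zx zy; rewrite ?zx ?zy ?orbT.
Qed.

Lemma continuum_wo_anti : antisymmetric continuum_wo.
Proof.
move=> x y /andP[xy yx].
have [|z [_ uz]] := continuum_woP (A := pred2 x y).
  by exists x; rewrite !inE eqxx.
have zx : z = x.
  apply: uz; split=> [|w]; rewrite !inE ?eqxx// => /orP[] /eqP -> //.
  exact: continuum_wo_refl.
have zy : z = y.
  apply: uz; split=> [|w]; rewrite !inE ?eqxx ?orbT// => /orP[] /eqP -> //.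
  exact: continuum_wo_refl.
by rewrite -zx -zy.
Qed.

Lemma continuum_wo_trans : transitive continuum_wo.
Proof.
move=> y x z xy yz.
have [|w [[wA lb] _]] := continuum_woP (A := pred3 x y z).
  by exists x; rewrite !inE eqxx.
have wx : continuum_wo w x by apply: lb; rewrite !inE eqxx.
have wy : continuum_wo w y by apply: lb; rewrite !inE eqxx orbT.
have wz : continuum_wo w z by apply: lb; rewrite !inE eqxx !orbT.
move: wA; rewrite !inE => /or3P[] /eqP ew; rewrite ew in wx wy wz => //.
- by have -> : x = y by apply: continuum_wo_anti; rewrite xy wx.
- by have <- : y = z by apply: continuum_wo_anti; rewrite yz wy.
Qed.

Record omega1 := Omega1 {
  omega1_val : set nat ;
  _ : `[< countable [set y | continuum_wo y omega1_val] >] }.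

HB.instance Definition _ := [isSub for omega1_val].
HB.instance Definition _ := [Choice of omega1 by <:].

Definition omega1_le (a b : omega1) : bool :=
  continuum_wo (omega1_val a) (omega1_val b).
Definition omega1_lt (a b : omega1) : bool := (b != a) && omega1_le a b.

Lemma omega1_le_anti : antisymmetric omega1_le.
Proof. by move=> a b /continuum_wo_anti/val_inj. Qed.

Lemma omega1_le_trans : transitive omega1_le.
Proof. by move=> b a c; apply: continuum_wo_trans. Qed.

Lemma omega1_le_total : total omega1_le.
Proof. by move=> a b; apply: continuum_wo_total. Qed.

Fact omega1_display : Order.disp_t. Proof. exact: Order.Disp tt tt. Qed.

HB.instance Definition _ := Order.isOrder.Build omega1_display omega1
  (fun _ _ => erefl) (fun _ _ => erefl) (fun _ _ => erefl)
  omega1_le_anti omega1_le_trans omega1_le_total.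

Lemma omega1_least (A : set omega1) : A !=set0 -> exists2 a, A a & lbound A a.
Proof.
move=> [a Aa].
have [|z [[zA lb] _]] :=
    continuum_woP (A := [pred x | `[< exists2 b, A b & omega1_val b = x >]]).
  by exists (omega1_val a); rewrite inE; exists a.
move: zA; rewrite inE => -[b Ab bz]; exists b => // c Ac.
change (continuum_wo (omega1_val b) (omega1_val c)).
by rewrite bz; apply: lb; rewrite inE; exists c.
Qed.

Lemma omega1_wf : well_founded (fun a b : omega1 => (a < b)%O).
Proof.
move=> a; apply: contrapT => na.
have [|b nb lb] := @omega1_least [set a | ~ Acc (fun a b : omega1 => (a < b)%O) a].
  by exists a.
apply: nb; constructor => c cb; apply: contrapT => nc.
by have := lb _ nc; rewrite leNgt cb.
Qed.

Lemma omega1_countable_below (a : omega1) : countable [set b : omega1 | (b <= a)%O].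
Proof.
case: a => x cx; have /asboolP := cx.
apply: sub_countable.
rewrite -(card_le_eql (@inj_card_eq _ _ _ omega1_val _)); last first.
  by move=> b c _ _; exact: val_inj.
by apply: subset_card_le => _ [b ba <-].
Qed.

Lemma omega1_uncountable : ~ countable [set: omega1].
Proof.
move=> c1.
have c2 : countable [set y | countable [set z | continuum_wo z y]].
  apply: sub_countable c1; apply: card_le_trans (card_image_le omega1_val _).
  apply: subset_card_le => y cy /=.
  have cy' : `[< countable [set z | continuum_wo z y] >] by apply/asboolP.
  by exists (Omega1 cy').
have [y ny] : exists y : set nat, ~ countable [set z | continuum_wo z y].
  apply/existsNP => cT.
  have /pfcard_geP[e|[f]] : [set: nat] #>= [set: set nat].
    by apply: sub_countable c2; apply: subset_card_le => y _; exact: cT.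
  - by have : [set: set nat] set0 by []; rewrite e.
  - have [n _ fn] := @surj _ _ _ _ f [set n | ~ f n n] I.
    have : f n n <-> ~ f n n by rewrite {1}fn.
    by tauto.
have [|z [[zA lb] _]] :=
    continuum_woP (A := [pred y | `[< ~ countable [set z | continuum_wo z y] >]]).
  by exists y; rewrite inE.
move: zA; rewrite inE; apply.
have: countable (\bigcup_(b in [set true; false]) if b then [set z]
                 else [set y | countable [set z | continuum_wo z y]]).
  by apply: bigcup_countable => // -[].
apply: sub_countable; apply: subset_card_le => w wz /=.
have [->|wz'] := eqVneq w z; [by exists true => //; left|exists false; first by right].
apply: contrapT => nw; move/eqP: wz'; apply; apply: continuum_wo_anti.
by rewrite wz; apply: lb; rewrite inE.
Qed.

Lemma omega1_bounded (A : set omega1) : countable A ->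
  exists b, forall a, A a -> (a < b)%O.
Proof.
move=> cA; apply: contrapT => /forallNP nb; apply: omega1_uncountable.
have: countable (\bigcup_(a in A) [set b | (b <= a)%O]).
  by apply: bigcup_countable => // a _; exact: omega1_countable_below.
apply: sub_countable; apply: subset_card_le => b _ /=.
have /existsNP[a /not_implyP[Aa ba]] := nb b.
by exists a => //=; rewrite leNgt; apply/negP.
Qed.

(* Transfinite recursion: the value at b is a function of the set of values at
   the predecessors of b. *)
Definition omega1_rec (T : Type) (G : set T -> T) : omega1 -> T :=
  Fix omega1_wf (fun _ => T)
    (fun b rec => G [set v | exists c (cb : (c < b)%O), v = rec c cb]).

Lemma omega1_recE (T : Type) (G : set T -> T) (b : omega1) :
  omega1_rec G b = G [set omega1_rec G c | c in [set c | (c < b)%O]].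
Proof.
rewrite /omega1_rec Fix_eq; last first.
  move=> x f g fg; congr (G _); apply/seteqP.
  by split=> v [c [cx ->]]; exists c, cx; rewrite fg.
congr (G _); apply/seteqP; split=> v.
- by move=> [c [cb ->]]; exists c.
- by move=> [c cb <-]; exists c, cb.
Qed.

Lemma omega1_inhabited : exists a : omega1, True.
Proof. by have [a _] := @omega1_bounded set0 (countable0 _); exists a. Qed.

(* The least element of A; an arbitrary value if A is empty. *)
Definition omin (A : set omega1) : omega1 :=
  xget (projT1 (cid omega1_inhabited)) [set a | A a /\ lbound A a].

Lemma ominP (A : set omega1) : A !=set0 -> A (omin A) /\ lbound A (omin A).
Proof.
move=> /omega1_least[a Aa lba].
exact: (@xgetI _ _ [set a | A a /\ lbound A a] a).
Qed.

Definition osup (A : set omega1) : omega1 := omin (ubound A).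

Definition ozero : omega1 := omin setT.
Definition osucc (a : omega1) : omega1 := omin [set b | (a < b)%O].
Definition oone : omega1 := osucc ozero.
Definition onat (n : nat) : omega1 := iter n osucc ozero.
Definition oomega : omega1 := osup (range onat).

Definition is_limit (a : omega1) : Prop :=
  a <> ozero /\ forall b, a <> osucc b.

(* a + b = max (a, sup_(c < b) (a + c) + 1) *)
Definition oadd (a : omega1) : omega1 -> omega1 :=
  omega1_rec (fun V => osup ([set a] `|` osucc @` V)).

(* a * b = sup_(c < b) (a * c + a) *)
Definition omul (a : omega1) : omega1 -> omega1 :=
  omega1_rec (fun V => osup [set oadd v a | v in V]).

(* a ^ b = max (1, sup_(c < b) a ^ c * a) for a <> 0; 0 ^ 0 = 1 and 0 ^ b = 0
   for b <> 0 *)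
Definition oexp (a b : omega1) : omega1 :=
  if (a == ozero) && (b != ozero) then ozero
  else omega1_rec (fun V => osup ([set oone] `|` [set omul v a | v in V])) b.

Definition exp_indecomposable (l : omega1) : Prop :=
  (oomega <= l)%O /\
  forall b c, (b < l)%O -> (c < l)%O -> (oexp b c < l)%O.

Definition oiota (a : omega1) : omega1 :=
  omin [set l | exp_indecomposable l /\ (a < l)%O].

Section Families.
Context {I : choiceType}.
Implicit Types (F G : set {fset I}) (C : set I).

Definition cube : topologicalType := prod_topology (fun _ : I => bool).

Definition in_cube F : set cube :=
  [set ((fun i => i \in s) : cube) | s in F].

(* Closedness in the whole cube: a limit of members is again a finite set of
   the family. *)
Definition compact_family F : Prop := closed (in_cube F).

Definition hereditary F : Prop :=
  forall s t : {fset I}, F s -> (t `<=` s)%fset -> F t.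

Definition restrict F C : set {fset I} :=
  [set s | F s /\ [set` s] `<=` C].

Definition card_at_most (n : nat) : set {fset I} :=
  [set s | (#|` s| <= n)%N].

Definition fam_sqcup F G : set {fset I} :=
  [set u | exists s t, [/\ F s, G t & u = (s `|` t)%fset]].

Definition derived_set {T : topologicalType} (Y : set T) : set T :=
  Y `&` limit_point Y.

(* The intersection with X only matters for the derivative of order zero. *)
Definition cantor_bendixson {T : topologicalType} (X : set T) :
    omega1 -> set T :=
  omega1_rec (fun V => X `&` \bigcap_(Y in V) derived_set Y).

(* rk F = r.  A compact family may have uncountable rank, in which case this
   holds for no r. *)
Definition is_rank F (r : omega1) : Prop :=
  cantor_bendixson (in_cube F) r !=set0 /\
  forall b, cantor_bendixson (in_cube F) b !=set0 -> (b <= r)%O.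

(* Restrictions to countable C have countable rank, so it is enough to take the
   minimum over the restrictions of countable rank. *)
Definition srk F : omega1 :=
  omin [set r | exists C, infinite_set C /\ is_rank (restrict F C) r].

Definition homogeneous_at (a : omega1) F : Prop :=
  [/\ compact_family F, hereditary F &
    (a = ozero /\ F = [set fset0]) \/
    [/\ (oone <= a)%O, card_at_most 1 `<=` F, a = srk F &
        exists r, [/\ is_rank F r, (a <= r)%O & (r < oiota a)%O]]].

Definition homogeneous F : Prop := exists a, homogeneous_at a F.

End Families.

Arguments cube : clear implicits.

Definition section_at (F : set {fset nat}) (n : nat) : set {fset nat} :=
  [set s | (forall m, m \in s -> (n < m)%N) /\ F (n |` s)%fset].

Definition tail_of (M : set nat) (n : nat) : set nat :=
  [set m | M m /\ (n < m)%N].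

Definition family_on (M : set nat) (F : set {fset nat}) : Prop :=
  [/\ infinite_set M, forall s, F s -> [set` s] `<=` M & F fset0].

Inductive uniform_on : omega1 -> set nat -> set {fset nat} -> Prop :=
| uniform_zero M F :
    family_on M F -> F = [set fset0] -> uniform_on ozero M F
| uniform_succ b M F :
    family_on M F ->
    (forall n, M n -> uniform_on b (tail_of M n) (section_at F n)) ->
    uniform_on (osucc b) M F
| uniform_limit a (an : nat -> omega1) M F :
    family_on M F -> is_limit a ->
    (forall m n, M m -> M n -> (m < n)%N -> (an m < an n)%O) ->
    (forall n, M n -> (an n < a)%O) ->
    supremums [set an n | n in M] a ->
    (forall n, M n -> uniform_on (an n) (tail_of M n) (section_at F n)) ->
    uniform_on a M F.

Definition spreading (F : set {fset nat}) : Prop :=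
  forall (k : nat) (m n : 'I_k -> nat),
    {homo m : i j / (i < j)%N} -> {homo n : i j / (i < j)%N} ->
    (forall i, (m i <= n i)%N) ->
    F [fset m i | i in 'I_k]%fset -> F [fset n i | i in 'I_k]%fset.

Definition frakS : set (set {fset nat}) :=
  [set F | [/\ hereditary F, spreading F & exists a, uniform_on a setT F]].

Definition is_multiplication {I : choiceType} (F : set {fset I})
    (H : set {fset nat}) (G : set {fset I}) : Prop :=
  (homogeneous G /\ oiota (srk G) = oiota (omul (srk F) (srk H))) /\
  (forall s : nat -> {fset I}, (forall n, F (s n)) ->
    exists2 phi : nat -> nat, increasing_seq phi &
      forall x, H x -> G (\bigcup_(n <- x) s (phi n))%fset).

Definition is_basis {I : choiceType} (B : set (set {fset I}))
    (times : set {fset I} -> set {fset nat} -> set {fset I}) : Prop :=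
  [/\ [/\ forall F, B F -> homogeneous F,
          forall n, B (card_at_most n) &
          forall a, (oomega <= a)%O -> exists2 F, B F & srk F = a],
      [/\ forall F G, B F -> B G -> B (F `|` G),
          forall F G, B F -> B G -> B (fam_sqcup F G) &
          forall F G, F `<=` G -> B G -> homogeneous F ->
            oiota (srk F) = oiota (srk G) -> B F] &
      forall F H, B F -> frakS H ->
        B (times F H) /\ is_multiplication F H (times F H)].

Definition fset_min (s : {fset nat}) : nat := head 0%N (sort leq s).

Definition schreier : set {fset nat} :=
  [set s | (#|` s| <= fset_min s)%N \/ s = fset0].

Definition fam_otimes (F G : set {fset nat}) : set {fset nat} :=
  [set t | exists (n : nat) (s : nat -> {fset nat}),
    [/\ forall i, (i < n)%N -> F (s i) /\ s i != fset0,
        forall i, (i.+1 < n)%N ->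
          forall a b, a \in s i -> b \in s i.+1 -> (a < b)%N,
        G [fset fset_min (s i) | i in iota 0 n]%fset &
        t = (\bigcup_(i <- iota 0 n) s i)%fset]].

Definition is_schreier_sequence (S : omega1 -> set {fset nat}) : Prop :=
  [/\ S ozero = card_at_most 1,
      forall a, S (osucc a) = fam_otimes (S a) schreier &
      forall a, is_limit a -> exists an : nat -> omega1,
        [/\ forall n, (an n < a)%O, supremums (range an) a &
            S a = \bigcup_n restrict (S (an n)) [set m | (n <= m)%N]]].

Section Banach.
Context {R : realType}.
Implicit Types X Y : completeNormedModType R.

Local Open Scope ring_scope.

Definition dual X : set (X -> R) :=
  [set f | scalar f /\ continuous (f : X -> R^o)].

Definition dual_norm X (f : X -> R) : R :=
  sup [set `|f x| | x in [set x : X | `|x| <= 1]].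

Definition reflexive_space X : Prop :=
  forall phi : (X -> R) -> R,
    (forall (a : R) (f g : X -> R), dual f -> dual g ->
      phi (fun x => a * f x + g x) = a * phi f + phi g) ->
    (exists C : R, forall f, dual f -> `|phi f| <= C * dual_norm f) ->
    exists x : X, forall f, dual f -> phi f = f x.

Definition has_density X (I : Type) : Prop :=
  (exists2 D : set X, dense D & D #= [set: I]) /\
  (forall D : set X, dense D -> [set: I] #<= D).

(* Every vector has a unique expansion, and this expansion converges
   unconditionally, i.e. along the net of finite subsets of the index set. *)
Definition unconditional_basis X (J : choiceType) (e : J -> X) : Prop :=
  forall x : X, exists! a : J -> R,
    partial_sum (fun j => a j *: e j) @ totally --> x.

(* The ordinal indexing the basis is the order type of le. *)
Definition has_long_unconditional_basis X : Prop :=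
  exists (J : choiceType) (le : rel J) (e : J -> X),
    well_order le /\ unconditional_basis e.

Definition l1_spreading_model (S : omega1 -> set {fset nat}) (a : omega1) X
    (x : nat -> X) : Prop :=
  bounded_fun x /\
  exists2 C : R, 0 < C & forall s : {fset nat}, S a s ->
    forall c : nat -> R,
      C * (\sum_(n <- s) `|c n|) <= `|\sum_(n <- s) c n *: x n|.

Definition subsymmetric X (x : nat -> X) : Prop :=
  (exists m n, x m != x n) /\
  exists2 C : R, 1 <= C & forall (n : nat) (c : 'I_n -> R) (l k : 'I_n -> nat),
    {homo l : i j / (i < j)%N} -> {homo k : i j / (i < j)%N} ->
    `|\sum_(i < n) c i *: x (l i)| <= C * `|\sum_(i < n) c i *: x (k i)|.

Definition closed_subspace X (U : set X) : Prop :=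
  [/\ closed U, U 0 & forall (a : R) u v, U u -> U v -> U (a *: u + v)].

Definition infinite_dimensional X (U : set X) : Prop :=
  ~ exists (n : nat) (v : 'I_n -> X), (forall i, U (v i)) /\
      forall u, U u -> exists c : 'I_n -> R, u = \sum_(i < n) c i *: v i.

Definition isomorphic_subspaces X Y (U : set X) (V : set Y) : Prop :=
  exists (T : X -> Y) (T' : Y -> X),
    [/\ [/\ forall u, U u -> V (T u), forall v, V v -> U (T' v),
            forall u, U u -> T' (T u) = u & forall v, V v -> T (T' v) = v],
        forall (a : R) u v, U u -> U v -> T (a *: u + v) = a *: T u + T v,
        {within U, continuous T} & {within V, continuous T'}].

Definition totally_incomparable X Y : Prop :=
  forall (U : set X) (V : set Y),
    closed_subspace U -> infinite_dimensional U -> closed_subspace V ->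
    ~ isomorphic_subspaces U V.

End Banach.

(* Main.v *)
Require Import Defs.
From HB Require Import structures.
From mathcomp Require Import all_boot all_order all_algebra finmap.
From mathcomp Require Import all_classical all_reals all_analysis.
From mathcomp Require Import zify lra.
From mathcomp Require Import wochoice summability.
Set Implicit Arguments.
Unset Strict Implicit.
Unset Printing Implicit Defensive.
Import Order.TTheory GRing.Theory Num.Theory.
Import numFieldNormedType.Exports.
Local Open Scope classical_set_scope.

(* Let L = iota(omega^alpha).  Iterating the multiplication of the basis gives
   families F_0, F_1, ... on kappa of rank below L such that every sequence in
   F_n has a subsequence whose unions over the sets of S_alpha lie in F_(n+1).
   The space consists of the functions x on kappa that are limits of their
   finite restrictions for the norm
     sup sum_n f(n) 2^-n sum_(i in t_n) |x_i|,
   where t_n ranges over F_n and f over the norming set of the Tsirelson space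
   of S_alpha.

   Disjoint blocks with norms bounded below have an l1^alpha subsequence: if
   infinitely many of them are seen by one F_n this comes from F_(n+1), and
   otherwise they form, up to small errors, blocks of the Tsirelson space.
   Bounded disjoint blocks have, on the other hand, averages over sets of S_L
   that are small on each F_n, by induction on the Cantor-Bendixson rank.
   Averaging such averages over a set of S_(alpha+1) multiplies their norm by
   about 3/4, since the half-sums that define the norming set split only few of
   them; finitely many rounds stay below L + alpha omega and make the norm
   arbitrarily small.  A gliding hump extends both facts to all sequences, and
   they also make the unit basis boundedly complete and shrinking, which gives
   reflexivity. *)

(** * Ordinal arithmetic *)

(** The bound [L] comes from the form of multiplication, which controls small ranks only up to
    [oiota]. Ordinals below an exp-indecomposable one are closed under products, so multiplying
    repeatedly by one family of rank at most [omega ^ alpha] stays below [L], and homogeneity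
    carries this over from small ranks to ranks.

    The obstacle is that no single [F_n] gives the lower estimate, since the unions leave [F_n] for
    [F_(n+1)]. All the families are needed at once. The weights [2^-n] are summable, so a bound on
    the first few families costs at most twice that bound, and the Tsirelson functional takes over
    where no single family sees the blocks. All functionals involved are positive, so enlarging a
    vector coordinatewise never decreases its norm.

    The factor 3/4 is 1/2, for the blocks met by one piece of a half-sum, plus 1/4, for the split
    ones, whose total coefficient is made at most 1/4. One round leads from [S_d] to
    [S_(d + alpha + 1)], and the extra successor is absorbed by a second [alpha]; this is the origin
    of [alpha omega]. *)

Section CountableOrdinals.
Local Open Scope order_scope.

Implicit Types a b c d x y : omega1.

Lemma countable_union (T : Type) (A B : set T) :
  countable A -> countable B -> countable (A `|` B).
Proof.
by move=> cA cB; rewrite -bigcup2E; apply: bigcup_countable => // -[|[]]//=.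
Qed.

Lemma omin_le (A : set omega1) a : A a -> omin A <= a.
Proof. by move=> Aa; have [_] := @ominP A (ex_intro _ a Aa); apply. Qed.

Lemma omin_in (A : set omega1) a : A a -> A (omin A).
Proof. by move=> Aa; have [] := @ominP A (ex_intro _ a Aa). Qed.

Lemma ozero_le a : ozero <= a. Proof. exact: omin_le. Qed.

Lemma lt_osucc a : a < osucc a.
Proof.
have [b ba] := @omega1_bounded [set a] (finite_set_countable (finite_set1 a)).
by apply: (@omin_in [set b | a < b] b); apply: ba.
Qed.

Lemma osucc_le a b : (osucc a <= b) = (a < b).
Proof.
apply/idP/idP; first exact: lt_le_trans (lt_osucc a).
exact: omin_le.
Qed.

Lemma lt_osuccE a b : (a < osucc b) = (a <= b).
Proof. by rewrite ltNge osucc_le -leNgt. Qed.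

Lemma le_osucc a b : (osucc a <= osucc b) = (a <= b).
Proof. by rewrite osucc_le lt_osuccE. Qed.

Lemma osup_ub (A : set omega1) : countable A -> ubound A (osup A).
Proof.
move=> cA; have [b ub] := omega1_bounded cA.
by apply: (@omin_in (ubound A) b) => a /ub/ltW.
Qed.

Lemma osup_le (A : set omega1) b : ubound A b -> osup A <= b.
Proof. exact: omin_le. Qed.

Lemma countable_below a : countable [set c | c < a].
Proof.
by apply: sub_countable (omega1_countable_below a); apply: subset_card_le => c /ltW.
Qed.

Lemma ordinal_case a :
  [\/ a = ozero, exists b, a = osucc b | is_limit a].
Proof.
have [->|a0] := eqVneq a ozero; first by constructor 1.
have [[b ->]|nb] := pselect (exists b, a = osucc b); first by constructor 2; exists b.
by constructor 3; split; [exact/eqP|move=> b ab; apply: nb; exists b].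
Qed.

Lemma limit_gt0 a : is_limit a -> ozero < a.
Proof. by move=> [a0 _]; rewrite lt_neqAle ozero_le eq_sym andbT; apply/eqP. Qed.

Lemma limit_succ a b : is_limit a -> b < a -> osucc b < a.
Proof.
move=> [_ la] ba; rewrite lt_neqAle osucc_le ba andbT.
by apply/eqP => e; apply: (la b).
Qed.

Lemma ordinal_ind (P : omega1 -> Prop) :
  P ozero -> (forall a, P a -> P (osucc a)) ->
  (forall a, is_limit a -> (forall b, b < a -> P b) -> P a) -> forall a, P a.
Proof.
move=> P0 PS Pl; apply: (well_founded_ind omega1_wf) => a IH.
case: (ordinal_case a) => [->//|[b ab]|la]; last by apply: Pl.
by rewrite ab; apply/PS/IH; rewrite ab; exact: lt_osucc.
Qed.

Lemma sup_limit a (A : set omega1) : is_limit a -> supremums A a ->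
  forall b, b < a -> exists2 c, A c & b < c.
Proof.
move=> la [_ lub] b ba; apply: contrapT => nc.
have /lub : ubound A b.
  by move=> c Ac; rewrite leNgt; apply/negP => bc; apply: nc; exists c.
by rewrite leNgt ba.
Qed.

Lemma limit_sup a b : is_limit a -> (forall c, c < a -> c <= b) -> a <= b.
Proof.
move=> la h; rewrite leNgt; apply/negP => ba.
by have := h _ (limit_succ la ba); rewrite osucc_le ltxx.
Qed.

Lemma oadd_le a b d : a <= d -> (forall c, c < b -> oadd a c < d) -> oadd a b <= d.
Proof.
move=> ad h; rewrite /oadd omega1_recE; apply: osup_le => _ [->//|[_ [c cb <-] <-]].
by rewrite osucc_le; exact: h.
Qed.

(** [osup] is a least upper bound only for sets that are bounded in [omega1]; countability provides
    the bound. *)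
Lemma oadd_countable a b : countable ([set a] `|` osucc @`
  [set omega1_rec (fun V => osup ([set a] `|` osucc @` V)) c | c in [set c | c < b]]).
Proof.
apply: countable_union; first exact/finite_set_countable/finite_set1.
by rewrite image_comp; apply: sub_countable (countable_below b); exact: card_image_le.
Qed.

Lemma le_oadd a b : a <= oadd a b.
Proof. by rewrite /oadd omega1_recE; apply: osup_ub; [exact: oadd_countable|left]. Qed.

Lemma lt_oadd2l a b c : c < b -> oadd a c < oadd a b.
Proof.
move=> cb; rewrite -osucc_le [in leRHS]/oadd omega1_recE.
by apply: osup_ub; [exact: oadd_countable|right; exists (oadd a c) => //; exists c].
Qed.

Lemma le_oadd2l a b c : c <= b -> oadd a c <= oadd a b.
Proof. by rewrite le_eqVlt => /predU1P[->//|/lt_oadd2l-/(_ a)/ltW]. Qed.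

Lemma oadd0 a : oadd a ozero = a.
Proof.
apply/le_anti; rewrite le_oadd andbT; apply: oadd_le => // c.
by rewrite ltNge ozero_le.
Qed.

Lemma oaddS a b : oadd a (osucc b) = osucc (oadd a b).
Proof.
apply/le_anti; rewrite [X in _ && X]osucc_le lt_oadd2l ?lt_osucc// andbT.
apply: oadd_le => [|c]; first by apply: le_trans (ltW (lt_osucc _)); exact: le_oadd.
by rewrite !lt_osuccE; exact: le_oadd2l.
Qed.

Lemma oadd_lt_limit a b d : is_limit b -> d < oadd a b ->
  exists2 c, c < b & d <= oadd a c.
Proof.
move=> lb db; apply: contrapT => nc.
suff : oadd a b <= d by rewrite leNgt db.
apply: oadd_le => [|c cb].
  by rewrite leNgt; apply/negP => da; apply: nc; exists ozero; rewrite ?limit_gt0// oadd0 ltW.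
by rewrite ltNge; apply/negP => dc; apply: nc; exists c.
Qed.

Lemma limit_oadd a b : is_limit b -> is_limit (oadd a b).
Proof.
move=> lb; split=> [e|d e].
  by have := lt_oadd2l a (limit_gt0 lb); rewrite e ltNge ozero_le.
have [c cb dc] : exists2 c, c < b & d <= oadd a c.
  by apply: oadd_lt_limit => //; rewrite e lt_osucc.
have : oadd a (osucc c) < oadd a b by rewrite lt_oadd2l// limit_succ.
by rewrite e oaddS lt_osuccE osucc_le ltNge dc.
Qed.

Lemma oaddA a b c : oadd a (oadd b c) = oadd (oadd a b) c.
Proof.
elim/ordinal_ind: c => [|c IH|c lc IH]; first by rewrite !oadd0.
  by rewrite !oaddS IH.
apply/le_anti/andP; split.
  apply: limit_sup => [|d /(oadd_lt_limit (limit_oadd b lc))[x]].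
    exact/limit_oadd/limit_oadd.
  move=> /(oadd_lt_limit lc)[y yc xy] dx; apply: (le_trans dx).
  apply: (le_trans (le_oadd2l a xy)).
  by rewrite IH//; apply/le_oadd2l/ltW.
apply: limit_sup => [|d /(oadd_lt_limit lc)[y yc dy]]; first exact: limit_oadd.
by apply: (le_trans dy); rewrite -IH//; apply/le_oadd2l/le_oadd2l/ltW.
Qed.

Lemma le_oadd2r a b c : a <= b -> oadd a c <= oadd b c.
Proof.
move=> ab; elim/ordinal_ind: c => [|c IH|c lc IH]; first by rewrite !oadd0.
  by rewrite !oaddS le_osucc.
apply: limit_sup => [|d /(oadd_lt_limit lc)[y yc dy]]; first exact: limit_oadd.
by apply: (le_trans dy); apply: (le_trans (IH _ yc)); apply/le_oadd2l/ltW.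
Qed.

Lemma le_oaddl a b : b <= oadd a b.
Proof.
apply: le_trans (le_oadd2r b (ozero_le a)).
elim/ordinal_ind: b => [|b IH|b lb IH]; first exact: ozero_le.
  by rewrite oaddS le_osucc.
apply: limit_sup => // d db.
by apply: (le_trans (IH _ db)); apply/le_oadd2l/ltW.
Qed.

Lemma add0o b : oadd ozero b = b.
Proof.
apply/le_anti; rewrite le_oaddl andbT.
elim/ordinal_ind: b => [|b IH|b lb IH]; first by rewrite oadd0.
  by rewrite oaddS le_osucc.
apply: limit_sup => [|d /(oadd_lt_limit lb)[y yc dy]]; first exact: limit_oadd.
by apply: (le_trans dy); apply: (le_trans (IH _ yc)); apply/ltW.
Qed.

Lemma omul_countable a b : countable [set oadd v a | v in
  [set omega1_rec (fun V => osup [set oadd v a | v in V]) c | c in [set c | c < b]]].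
Proof.
by rewrite image_comp; apply: sub_countable (countable_below b); exact: card_image_le.
Qed.

Lemma omul_le a b d : (forall c, c < b -> oadd (omul a c) a <= d) -> omul a b <= d.
Proof.
move=> h; rewrite /omul omega1_recE; apply: osup_le => _ [_ [c cb <-] <-].
exact: h.
Qed.

Lemma le_omul_step a b c : c < b -> oadd (omul a c) a <= omul a b.
Proof.
move=> cb; rewrite [in leRHS]/omul omega1_recE.
by apply: osup_ub; [exact: omul_countable|exists (omul a c) => //; exists c].
Qed.

Lemma le_omul2l a b c : c <= b -> omul a c <= omul a b.
Proof.
rewrite le_eqVlt => /predU1P[->//|/le_omul_step-/(_ a)]; apply: le_trans.
exact: le_oadd.
Qed.

Lemma omul0 a : omul a ozero = ozero.
Proof.
apply/le_anti; rewrite ozero_le andbT; apply: omul_le => c.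
by rewrite ltNge ozero_le.
Qed.

Lemma omulS a b : omul a (osucc b) = oadd (omul a b) a.
Proof.
apply/le_anti; rewrite le_omul_step ?lt_osucc// andbT.
by apply: omul_le => c; rewrite lt_osuccE => /(le_omul2l a) h; exact: le_oadd2r.
Qed.

Lemma omul_limit_le a b d : is_limit b -> (forall c, c < b -> omul a c <= d) ->
  omul a b <= d.
Proof.
move=> lb h; apply: omul_le => c cb; rewrite -omulS; apply: h; exact: limit_succ.
Qed.

Lemma le_omul2r a b c : a <= b -> omul a c <= omul b c.
Proof.
move=> ab; elim/ordinal_ind: c => [|c IH|c lc IH]; first by rewrite !omul0.
  by rewrite !omulS; apply: le_trans (le_oadd2r _ IH) (le_oadd2l _ ab).
apply: omul_limit_le => // d dc; apply: (le_trans (IH _ dc)).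
exact/le_omul2l/ltW.
Qed.

Lemma omul1 a : omul a oone = a.
Proof. by rewrite omulS omul0 add0o. Qed.

Lemma mul1o b : omul oone b = b.
Proof.
elim/ordinal_ind: b => [|b IH|b lb IH]; first by rewrite omul0.
  by rewrite omulS IH oaddS oadd0.
apply/le_anti/andP; split.
  by apply: omul_limit_le => // c cb; rewrite IH// ltW.
by apply: limit_sup => // c cb; rewrite -(IH _ cb); apply/le_omul2l/ltW.
Qed.

Lemma oone_le a : (oone <= a) = (a != ozero).
Proof. by rewrite osucc_le lt_neqAle ozero_le andbT eq_sym. Qed.

Lemma oexp_countable a b : countable ([set oone] `|` [set omul v a | v in
  [set omega1_rec (fun V => osup ([set oone] `|` [set omul v a | v in V])) c
   | c in [set c | c < b]]]).
Proof.
apply: countable_union; first exact/finite_set_countable/finite_set1.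
by rewrite image_comp; apply: sub_countable (countable_below b); exact: card_image_le.
Qed.

Lemma oexpE a b : oone <= a -> oexp a b =
  osup ([set oone] `|` [set omul v a | v in [set oexp a c | c in [set c | c < b]]]).
Proof.
rewrite oone_le => /negbTE a0; rewrite /oexp a0 /= omega1_recE.
by congr osup; congr (_ `|` _).
Qed.

Lemma oexpE_countable a b : oone <= a -> countable ([set oone] `|`
  [set omul v a | v in [set oexp a c | c in [set c | c < b]]]).
Proof.
by rewrite oone_le => /negbTE a0; have := oexp_countable a b; rewrite /oexp a0.
Qed.

Lemma oexp_ge1 a b : oone <= a -> oone <= oexp a b.
Proof.
by move=> a1; rewrite oexpE//; apply: osup_ub; [exact: oexpE_countable|left].
Qed.

Lemma le_oexp_step a b c : oone <= a -> c < b -> omul (oexp a c) a <= oexp a b.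
Proof.
move=> a1 cb; rewrite [in leRHS]oexpE//.
by apply: osup_ub; [exact: oexpE_countable|right; exists (oexp a c) => //; exists c].
Qed.

Lemma oexp_le a b d : oone <= a -> oone <= d ->
  (forall c, c < b -> omul (oexp a c) a <= d) -> oexp a b <= d.
Proof.
move=> a1 d1 h; rewrite oexpE//; apply: osup_le => _ [->//|[_ [c cb <-] <-]].
exact: h.
Qed.

Lemma le_oexp2l a b c : oone <= a -> c <= b -> oexp a c <= oexp a b.
Proof.
move=> a1; rewrite le_eqVlt => /predU1P[->//|/(le_oexp_step a1)]; apply: le_trans.
by rewrite -[in leLHS](omul1 (oexp a c)); exact: le_omul2l.
Qed.

Lemma oexp0 a : oone <= a -> oexp a ozero = oone.
Proof.
move=> a1; apply/le_anti; rewrite oexp_ge1// andbT; apply: oexp_le => // c.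
by rewrite ltNge ozero_le.
Qed.

Lemma oexpS a b : oone <= a -> oexp a (osucc b) = omul (oexp a b) a.
Proof.
move=> a1; apply/le_anti; rewrite le_oexp_step ?lt_osucc// andbT.
apply: oexp_le => // [|c]; first by apply: le_trans (le_omul2l _ a1); rewrite omul1 oexp_ge1.
by rewrite lt_osuccE => /(le_oexp2l a1) h; exact: le_omul2r.
Qed.

Lemma oexp1 a : oone <= a -> oexp a oone = a.
Proof. by move=> a1; rewrite oexpS// oexp0// mul1o. Qed.

Lemma countable_range (T : Type) (f : nat -> T) : countable (range f).
Proof. by apply: sub_countable (countableP [set: nat]); exact: card_image_le. Qed.

Lemma onat_lt n : onat n < oomega.
Proof.
rewrite -osucc_le; apply: osup_ub; first exact: countable_range.
by exists n.+1.
Qed.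

Lemma lt_oomega b : b < oomega -> exists n, b <= onat n.
Proof.
move=> bo; apply: contrapT => nb; move: bo; rewrite ltNge => /negP; apply.
apply: osup_le => _ [n _ <-]; rewrite leNgt; apply/negP => h.
by apply: nb; exists n; exact: ltW.
Qed.

Lemma oomega_limit : is_limit oomega.
Proof.
split=> [e|b e]; first by have := onat_lt 0; rewrite e ltxx.
have [n bn] : exists n, b <= onat n by apply: lt_oomega; rewrite e lt_osucc.
by have := onat_lt n.+1; rewrite e lt_osuccE /= osucc_le ltNge bn.
Qed.

Lemma oone_le_oomega : oone <= oomega. Proof. exact/ltW/(onat_lt 1). Qed.

Lemma omul_oomega_le a d : (forall n, omul a (onat n) <= d) -> omul a oomega <= d.
Proof.
move=> h; apply: omul_limit_le => [|c /lt_oomega[n cn]]; first exact: oomega_limit.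
by apply: (le_trans _ (h n)); exact: le_omul2l.
Qed.

Lemma omul_onat_lt a n : oone <= a -> omul a (onat n) < omul a oomega.
Proof.
move=> a1; apply: (@lt_le_trans _ _ (omul a (onat n.+1))); last exact/le_omul2l/ltW/onat_lt.
by rewrite /= omulS -{1}[omul a _]oadd0 lt_oadd2l// -osucc_le.
Qed.

Lemma omul_oomega_limit a : oone <= a -> is_limit (omul a oomega).
Proof.
move=> a1; split=> [e|b e].
  by have := omul_onat_lt 0 a1; rewrite e ltNge ozero_le.
have : omul a oomega <= b; last by rewrite e leNgt lt_osucc.
by apply: omul_oomega_le => n; rewrite -lt_osuccE -e omul_onat_lt.
Qed.

(** Without this [oiota] would be an arbitrary value. [next b] bounds all powers with both arguments
    at most [b]; two ordinals below the supremum of its iterates lie below a common stage, hence so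
    does their power below the next one. *)
Lemma exp_indecomposable_gt a : exists2 l, exp_indecomposable l & a < l.
Proof.
pose next b := xget b [set d | forall x y, x <= b -> y <= b -> oexp x y < d].
have nextP b x y : x <= b -> y <= b -> oexp x y < next b.
  apply: (@xgetPex _ b [set d | forall x y, x <= b -> y <= b -> oexp x y < d]) => //.
  have [|d hd] := @omega1_bounded (\bigcup_(x in [set x | x <= b])
      [set oexp x y | y in [set y | y <= b]]).
    apply: bigcup_countable => [|z zb]; first exact: omega1_countable_below.
    by apply: sub_countable (omega1_countable_below b); exact: card_image_le.
  by exists d => x1 y1 xb yb; apply: hd; exists x1 => //; exists y1.
pose s0 := osucc (Order.max a oomega).
pose s n := iter n (fun b => Order.max (osucc b) (next b)) s0.
have sS n : s n < s n.+1 by rewrite /s iterS lt_max lt_osucc.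
pose l := osup (range s).
have sl n : s n < l.
  by apply: lt_le_trans (sS n) _; apply: osup_ub; [exact: countable_range|exists n.+1].
have lt_l b : b < l -> exists n, b <= s n.
  move=> bl; apply: contrapT => nb; move: bl; rewrite ltNge => /negP; apply.
  apply: osup_le => _ [n _ <-]; rewrite leNgt; apply/negP => h.
  by apply: nb; exists n; exact: ltW.
have s_mono m n : (m <= n)%N -> s m <= s n.
  move=> /subnK <-; elim: (n - m)%N => // k IH; rewrite addSn.
  by apply: le_trans IH (ltW (sS _)).
have s0l : Order.max a oomega < l by apply: lt_trans (lt_osucc _) (sl 0%N).
exists l; last by apply: le_lt_trans s0l; rewrite le_max lexx.
split; first by apply: le_trans (ltW s0l); rewrite le_max lexx orbT.
move=> b c /lt_l[m bm] /lt_l[n cn].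
apply: lt_le_trans (ltW (sl (maxn m n).+1)).
rewrite /s iterS lt_max; apply/orP; right; apply: nextP.
- by apply: (le_trans bm); apply: s_mono; rewrite leq_maxl.
- by apply: (le_trans cn); apply: s_mono; rewrite leq_maxr.
Qed.

Lemma oiotaP a : exp_indecomposable (oiota a) /\ a < oiota a.
Proof.
have [l li al] := exp_indecomposable_gt a.
exact: (@omin_in [set l | exp_indecomposable l /\ a < l] l).
Qed.

Lemma oiota_le a l : exp_indecomposable l -> a < l -> oiota a <= l.
Proof. by move=> li al; exact: omin_le. Qed.

Section Indecomposable.
Variable l : omega1.
Hypothesis li : exp_indecomposable l.

Lemma indec_two : osucc oone < l.
Proof. by apply: lt_le_trans (proj1 li); exact: (onat_lt 2). Qed.

Lemma oexp2 a : oone <= a -> oexp a (osucc oone) = omul a a.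
Proof. by move=> a1; rewrite oexpS// oexp1. Qed.

(** If [l] were the successor of [b], then [b >= 2], and [b ^ 2 = b b >= b 2 >= b + 1] would
    contradict [b ^ 2 < l]. *)
Lemma indec_limit : is_limit l.
Proof.
have two := indec_two; case: li => ol li2; split=> [l0|b e].
  by move: two; rewrite l0 ltNge ozero_le.
have b2 : osucc oone <= b by rewrite -lt_osuccE -e.
have b1 : oone <= b by apply: le_trans b2; exact: ltW (lt_osucc _).
have : oexp b (osucc oone) < l by apply: li2 => //; rewrite e lt_osucc.
rewrite oexp2// e lt_osuccE => h.
have : osucc b <= b.
  apply: le_trans h; apply: le_trans (le_omul2l b b2).
  rewrite omulS omul1 -{1}[b]oadd0 -oaddS; exact: le_oadd2l.
by rewrite osucc_le ltxx.
Qed.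

(** The product is at most the square of a common bound; the successor in [m] makes this bound
    nonzero, as [oexp2] requires. *)
Lemma indec_omul b c : b < l -> c < l -> omul b c < l.
Proof.
move=> bl cl; pose m := osucc (Order.max b c).
have ml : m < l by apply: limit_succ; [exact: indec_limit|rewrite gt_max bl].
have m1 : oone <= m by rewrite le_osucc ozero_le.
have mm : omul m m < l by rewrite -oexp2//; apply: (proj2 li) => //; exact: indec_two.
apply: le_lt_trans mm; apply: le_trans (le_omul2l _ _) (le_omul2r _ _).
  by apply: le_trans (ltW (lt_osucc _)); rewrite le_max lexx orbT.
by apply: le_trans (ltW (lt_osucc _)); rewrite le_max lexx.
Qed.

End Indecomposable.

Lemma oexp_limit_lt a b d : oone <= a -> is_limit b -> d < oexp a b ->
  oone <= d -> exists2 c, c < b & d <= oexp a c.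
Proof.
move=> a1 lb db d1; apply: contrapT => nc.
suff : oexp a b <= d by rewrite leNgt db.
apply: oexp_le => // c cb; rewrite -oexpS// leNgt; apply/negP => h.
by apply: nc; exists (osucc c); [exact: limit_succ|exact: ltW].
Qed.

(** Both summands lie below some [omega ^ c] with [c < b], and [omega ^ c 2 < omega ^ (c + 1)]. This
    keeps the ranks of finite sums below [omega ^ a] at the limit stages of [schreier_uniform]. *)
Lemma oexp_oomega_oadd b x y : is_limit b -> x < oexp oomega b ->
  y < oexp oomega b -> oadd x y < oexp oomega b.
Proof.
have o1 := oone_le_oomega => lb xb yb.
pose d := Order.max oone (Order.max x y).
have [||c cb dc] := @oexp_limit_lt oomega b d o1 lb.
- rewrite /d !gt_max xb yb !andbT.
  rewrite -(oexp0 o1); apply: lt_le_trans (le_oexp_step o1 (limit_gt0 lb)).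
  by rewrite oexp0// mul1o; exact: (onat_lt 1).
- by rewrite /d le_max lexx.
have xc : x <= oexp oomega c by apply: le_trans dc; rewrite /d !le_max lexx orbT.
have yc : y <= oexp oomega c by apply: le_trans dc; rewrite /d !le_max lexx !orbT.
apply: (@lt_le_trans _ _ (oexp oomega (osucc c))); last first.
  by apply: le_oexp2l => //; rewrite osucc_le.
rewrite oexpS//; apply: (le_lt_trans (le_oadd2r _ xc)).
apply: (le_lt_trans (le_oadd2l _ yc)).
have -> : oadd (oexp oomega c) (oexp oomega c) = omul (oexp oomega c) (onat 2).
  by rewrite /= !omulS omul0 add0o.
by apply: omul_onat_lt; exact: oexp_ge1.
Qed.

Lemma oexp_lt2l a b c : oomega <= a -> c < b -> oexp a c < oexp a b.
Proof.
move=> oa cb; have a1 : oone <= a := le_trans oone_le_oomega oa.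
apply: lt_le_trans (le_oexp_step a1 cb).
apply: lt_le_trans (le_omul2l _ oa).
rewrite -[X in X < _]omul1; exact: (omul_onat_lt 1 (oexp_ge1 c a1)).
Qed.

Section Threshold.
Variables (L a : omega1).
Hypothesis a1 : oone <= a.
Let beta := oadd L (omul a oomega).

Lemma threshold_limit : is_limit beta.
Proof. exact/limit_oadd/omul_oomega_limit. Qed.

(** The cost of one use of [flat_step]: since [a >= 1], adding [a + 1] is at most adding [a]
    twice. *)
Lemma threshold_step d n : d <= oadd L (omul a (onat n)) ->
  osucc (oadd d a) <= oadd L (omul a (onat n.+2)).
Proof.
move=> dn; rewrite /= !omulS !oaddA -[osucc _]oadd0 -oaddS.
apply: (@le_trans _ _ (oadd (oadd d a) a)).
  by rewrite oaddS oadd0 osucc_le -{1}[oadd d a]oadd0 lt_oadd2l// -osucc_le.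
by apply: le_oadd2r; exact: le_oadd2r.
Qed.

Lemma threshold_lt d n : d <= oadd L (omul a (onat n)) -> d < beta.
Proof. by move=> dn; apply: (le_lt_trans dn); exact/lt_oadd2l/omul_onat_lt. Qed.

End Threshold.

End CountableOrdinals.

(** * Schreier families *)

Section SchreierFamilies.
Local Open Scope fset_scope.

Definition fbefore (s t : {fset nat}) : Prop :=
  forall i j, i \in s -> j \in t -> (i < j)%N.

Definition tail_ge (n : nat) (s : {fset nat}) : Prop :=
  forall i, i \in s -> (n <= i)%N.

Lemma fbefore0s t : fbefore fset0 t.
Proof. by move=> i j; rewrite in_fset0. Qed.

Lemma fbefores0 t : fbefore t fset0.
Proof. by move=> i j _; rewrite in_fset0. Qed.

Lemma fbeforeS (s t s' t' : {fset nat}) :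
  s' `<=` s -> t' `<=` t -> fbefore s t -> fbefore s' t'.
Proof. by move=> /fsubsetP ss /fsubsetP tt st i j /ss si /tt; apply: st. Qed.

Lemma fbeforeUr (s t u : {fset nat}) :
  fbefore u s -> fbefore u t -> fbefore u (s `|` t).
Proof. by move=> su tu i j iu /fsetUP[/(su _ _ iu)|/(tu _ _ iu)]. Qed.

Lemma fset_bounded (s : {fset nat}) : exists m, forall i, i \in s -> (i < m)%N.
Proof.
exists (\max_(i <- s) i).+1 => i si; rewrite ltnS.
by rewrite (big_rem i) //= leq_maxl.
Qed.

Lemma tail_geW m n s : (m <= n)%N -> tail_ge n s -> tail_ge m s.
Proof. by move=> mn ns i /ns; exact: leq_trans. Qed.

Lemma fset_min_in (s : {fset nat}) : s != fset0 -> fset_min s \in s.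
Proof.
move=> s0; rewrite /fset_min -(mem_sort leq).
case E : (sort leq s) => [|x t] /=; last exact: mem_head.
by move: s0; rewrite -cardfs_eq0 -(size_sort leq) E.
Qed.

Lemma fset_min_le (s : {fset nat}) i : i \in s -> (fset_min s <= i)%N.
Proof.
move=> si; have := sort_sorted leq_total s; rewrite /fset_min.
have : i \in sort leq s by rewrite mem_sort.
case: (sort leq s) => [//|x t] /=; rewrite inE => /predU1P[->//|it].
by move=> /(order_path_min leq_trans) /allP; apply.
Qed.

(** The part in [G] comes first, so that removing the minimum of a set acts on [G]; this is why the
    ranks add up to [oadd rF rG]. *)
Definition fsum (F G : set {fset nat}) : set {fset nat} :=
  [set u | exists s t, [/\ G s, F t, fbefore s t & u = s `|` t]].

Definition blocks (F : set {fset nat}) (n : nat) : set {fset nat} :=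
  iter n (fun A => fsum A F) [set fset0].

(** The form of [spreading] that suits inductions: one map acts on the whole set and restricts to
    each of its pieces. *)
Definition spreadable (F : set {fset nat}) : Prop :=
  forall (s : {fset nat}) (f : nat -> nat), F s ->
    {in s &, {homo f : i j / (i < j)%N}} -> (forall i, i \in s -> (i <= f i)%N) ->
    F [fset f x | x in s].

Lemma hereditary_fsum F G : hereditary F -> hereditary G -> hereditary (fsum F G).
Proof.
move=> hF hG _ v [s [t [Gs Ft st ->]]] vst; exists (v `&` s), (v `&` t); split.
- by apply: hG Gs _; exact: fsubsetIr.
- by apply: hF Ft _; exact: fsubsetIr.
- by apply: fbeforeS st; exact: fsubsetIr.
- by rewrite -fsetIUr; apply/esym/fsetIidPl.
Qed.

Lemma spreadable_fsum F G : spreadable F -> spreadable G -> spreadable (fsum F G).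
Proof.
move=> hF hG _ f [s [t [Gs Ft st ->]]] f1 f2.
exists [fset f x | x in s], [fset f x | x in t]; split.
- apply: hG => // [i j si sj|i si]; last by apply: f2; rewrite inE si.
  by apply: f1; rewrite inE ?si ?sj.
- apply: hF => // [i j si sj|i si]; last by apply: f2; rewrite inE si orbT.
  by apply: f1; rewrite inE ?si ?sj orbT.
- move=> _ _ /imfsetP[i /= si ->] /imfsetP[j /= tj ->].
  by apply: f1; [rewrite inE si|rewrite inE tj orbT|exact: st].
- by rewrite imfsetU.
Qed.

Lemma hereditary_blocks F n : hereditary F -> hereditary (blocks F n).
Proof.
move=> hF; elim: n => [|n IH]; last exact: hereditary_fsum.
by move=> s t /= -> ; rewrite fsubset0 => /eqP.
Qed.

Lemma spreadable_blocks F n : spreadable F -> spreadable (blocks F n).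
Proof.
move=> hF; elim: n => [|n IH]; last exact: spreadable_fsum.
by move=> s f /= -> _ _; rewrite imfset0.
Qed.

Lemma blocks1 (F : set {fset nat}) s : F s -> blocks F 1 s.
Proof. by move=> Fs; exists s, fset0; rewrite fsetU0; split=> //; exact: fbefores0. Qed.

Lemma blocks_cat F n t s : blocks F n t -> F s -> fbefore t s ->
  blocks F n.+1 (t `|` s).
Proof.
elim: n t => [|n IH] t /=; first by move=> -> Fs _; rewrite fset0U; exact: blocks1.
move=> [u [v [Fu Bv uv ->]]] Fs ts; exists u, (v `|` s); split => //.
- by apply: IH => //; apply: fbeforeS ts; [exact: fsubsetUr|].
- apply: fbeforeUr => //; apply: fbeforeS ts; [exact: fsubsetUl|by []].
- by rewrite fsetUA.
Qed.

Lemma blocksS F n t : F fset0 -> blocks F n t -> blocks F n.+1 t.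
Proof.
by move=> F0 Bt; exists fset0, t; rewrite fset0U; split=> //; exact: fbefore0s.
Qed.

Lemma blocks_le F m n t : F fset0 -> (m <= n)%N -> blocks F m t -> blocks F n t.
Proof.
by move=> F0 /subnK <-; elim: (n - m)%N => // k IH /IH; exact: blocksS.
Qed.

Lemma blocks_card1 n (s : {fset nat}) : (#|` s| <= n)%N -> blocks (card_at_most 1) n s.
Proof.
elim: n s => [|n IH] s; first by rewrite leqn0 cardfs_eq0 => /eqP ->.
have [->|s0] := eqVneq s fset0.
  move=> _; apply: (@blocks_le _ 0%N) => //.
move=> cs; have ms := fset_min_in s0; exists [fset fset_min s], (s `\ fset_min s); split.
- by rewrite /card_at_most /mkset cardfs1.
- by apply: IH; move: cs; rewrite (cardfsD1 (fset_min s)) ms ltnS.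
- move=> i j /fset1P -> /fsetD1P[jm js].
  by rewrite ltn_neqAle eq_sym jm fset_min_le.
- by rewrite fsetD1K.
Qed.

Lemma blocks_seq F n t : blocks F n t -> exists m (s : nat -> {fset nat}),
  [/\ (m <= n)%N, forall i, (i < m)%N -> F (s i) /\ s i != fset0,
      forall i, (i.+1 < m)%N -> fbefore (s i) (s i.+1) &
      t = \bigcup_(i <- iota 0 m) s i].
Proof.
elim: n t => [|n IH] t /=.
  by move=> ->; exists 0%N, (fun=> fset0); split => //; rewrite big_nil.
move=> [u [v [Fu /IH[m [s [mn sF sc sv]]] uv ->]]].
have [u0|u0] := eqVneq u fset0.
  by exists m, s; split => //; [exact: leqW|rewrite u0 fset0U].
exists m.+1, (fun i => if i is j.+1 then s j else u); split => //.
- by move=> [//|i]; rewrite ltnS; exact: sF.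
- move=> [|i]; rewrite ltnS => im; last exact: sc.
  apply: fbeforeS uv => //; rewrite sv; apply: bigfcup_sup => //.
  by rewrite mem_iota.
- rewrite -[iota 0 m.+1]/(0%N :: iota 1 m) big_cons sv; congr (_ `|` _).
 by rewrite (iotaDl 1 0 m : iota 1 m = _) big_map.
Qed.

Lemma seq_blocks F n t (s : nat -> {fset nat}) :
  (forall i, (i < n)%N -> F (s i)) ->
  (forall i j, (i < j < n)%N -> fbefore (s i) (s j)) ->
  t = \bigcup_(i <- iota 0 n) s i -> blocks F n t.
Proof.
elim: n t => [|n IH] t sF sc ->; first by rewrite big_nil.
have -> : iota 0 n.+1 = iota 0 n ++ [:: n] by rewrite -addn1 iotaD.
rewrite big_cat big_seq1; apply: blocks_cat.
- apply: IH => [i ni|i j /andP[ij jn]|//]; first exact/sF/leqW.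
  by apply: sc; rewrite ij ltnS ltnW.
- exact: sF.
- move=> a b /bigfcupP[i /andP[]]; rewrite mem_iota /= add0n => ni _ ai bn.
  by apply: (sc i n) => //; rewrite ni ltnSn.
Qed.

Lemma otimes_schreierP F t : F fset0 -> hereditary F ->
  fam_otimes F schreier t <-> exists2 n, blocks F n t & tail_ge n t.
Proof.
move=> F0 hF; split.
- move=> [n [s [sF sc sS ts]]].
  have sc' i j : (i < j < n)%N -> fbefore (s i) (s j).
    move=> /andP[]; elim: j => // j IH; rewrite ltnS leq_eqVlt => /predU1P[->|ij] jn.
      exact: sc.
    have [_ /fset_min_in h] := sF j (ltnW jn).
    move=> a b ai bj; apply: (@ltn_trans (fset_min (s j))).
      exact: (IH ij (ltnW jn)).
    exact: sc jn _ _ h bj.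
  exists n; first by apply: seq_blocks ts => // i /sF[].
  have mins : #|` [fset fset_min (s i) | i in iota 0 n]| = n.
    rewrite card_in_imfset /= ?undup_id ?iota_uniq ?size_iota// => i j.
    rewrite !mem_iota /= !add0n => im jm e.
    have [_ /fset_min_in hi] := sF i im; have [_ /fset_min_in hj] := sF j jm.
    case: (ltngtP i j) => // ij.
      have /(_ _ _ hi hj) : fbefore (s i) (s j) by apply: sc'; rewrite ij.
      by rewrite e ltnn.
    have /(_ _ _ hj hi) : fbefore (s j) (s i) by apply: sc'; rewrite ij.
    by rewrite e ltnn.
  move=> i; rewrite ts => /bigfcupP[k /andP[]]; rewrite mem_iota /= add0n => kn _ ik.
  case: sS => [|e]; last by move: mins; rewrite e cardfs0 => n0; rewrite -n0 in kn.
  rewrite mins => /leq_trans; apply; apply: (@leq_trans (fset_min (s k))).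
    by apply: fset_min_le; apply/imfsetP; exists k; rewrite //= mem_iota.
  exact: fset_min_le.
- move=> [n /blocks_seq[m [s [mn sF sc ts]]] tn]; exists m, s; split => //.
  have [e|ne] := eqVneq [fset fset_min (s i) | i in iota 0 m] fset0; first by right.
  left; apply: (@leq_trans m).
    apply: leq_trans (leq_imfset_card _ _ _) _ => /=.
    by rewrite undup_id ?iota_uniq// size_iota.
  apply: (leq_trans mn); apply: tn.
  have /imfsetP[k /= km ->] := fset_min_in ne.
  rewrite ts; apply/bigfcupP; exists k; first by rewrite km.
  by apply: fset_min_in; move: km; rewrite mem_iota => /andP[_ /sF[]].
Qed.

Section SchreierSequence.
Variable S : omega1 -> set {fset nat}.
Hypothesis HS : is_schreier_sequence S.
Implicit Types a b c d : omega1.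

Let S0 : S ozero = card_at_most 1. Proof. by case: HS. Qed.

Lemma schreier_basic a : hereditary (S a) /\ S a fset0.
Proof.
elim/ordinal_ind: a => [|a [hS S_0]|a la IH].
- rewrite S0; split=> [s t|]; last by rewrite /card_at_most /mkset cardfs0.
  by rewrite /card_at_most /= => s1 /fsubset_leq_card /leq_trans; apply.
- have [_ -> _] := HS; split.
    move=> s t /otimes_schreierP-/(_ S_0 hS)[n bs sn] ts.
    apply/otimes_schreierP => //; exists n; first exact: hereditary_blocks ts.
    by move=> i it; apply: sn; exact: (fsubsetP ts).
  by apply/otimes_schreierP => //; exists 0%N => // i; rewrite in_fset0.
- have [_ _ /(_ a la)[an [an_lt _ ->]]] := HS; split.
    move=> s t [n _ [Ss sn]] ts; exists n => //; split.
      by have [h _] := IH _ (an_lt n); exact: h Ss ts.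
    by move=> i /= it; apply: sn; exact: (fsubsetP ts).
  exists 0%N => //; split; first by have [] := IH _ (an_lt 0%N).
  by move=> i /=; rewrite in_fset0.
Qed.

Lemma schreier_her a : hereditary (S a). Proof. by case: (schreier_basic a). Qed.

Lemma schreier_fset0 a : S a fset0. Proof. by case: (schreier_basic a). Qed.

Lemma schreier_succP a t :
  S (osucc a) t <-> exists2 n, blocks (S a) n t & tail_ge n t.
Proof.
have [_ -> _] := HS.
exact: (otimes_schreierP t (schreier_fset0 a) (@schreier_her a)).
Qed.

Lemma schreier_limitP a : is_limit a -> exists an : nat -> omega1,
  [/\ forall n, (an n < a)%O, supremums (range an) a &
      forall t, S a t <-> exists2 n, S (an n) t & tail_ge n t].
Proof.
move=> la; have [_ _ /(_ a la)[an [h1 h2 ->]]] := HS; exists an; split => // t.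
by split => [[n _ [? ?]]|[n ? ?]]; exists n.
Qed.

Lemma schreier_spread a : spreadable (S a).
Proof.
elim/ordinal_ind: a => [|a IH|a la IH].
- move=> s f; rewrite S0 => s1 _ _; rewrite /card_at_most /mkset.
  by apply: leq_trans s1; exact: leq_imfset_card.
- move=> s f /schreier_succP[n bs sn] f1 f2; apply/schreier_succP; exists n.
    exact: spreadable_blocks.
  by move=> _ /imfsetP[i /= si ->]; apply: leq_trans (f2 _ si); exact: sn.
- have [an [an_lt _ SP]] := schreier_limitP la.
  move=> s f /SP[n ss sn] f1 f2; apply/SP; exists n; first exact: IH.
  by move=> _ /imfsetP[i /= si ->]; apply: leq_trans (f2 _ si); exact: sn.
Qed.

Lemma schreier1 a i : (0 < i)%N -> S a [fset i].
Proof.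
move=> i0; elim/ordinal_ind: a => [|a IH|a la IH].
- by rewrite S0 /card_at_most /= cardfs1.
- apply/schreier_succP; exists 1%N; first exact: blocks1.
  by move=> j /fset1P ->.
- have [an [an_lt _ SP]] := schreier_limitP la.
  by apply/SP; exists 0%N => //; exact: IH.
Qed.

(** The families increase with the index only up to small elements: [{0}] lies in [S 0] but not in
    [S 1], and a limit family cuts each [S (an n)] at [n]. *)
Lemma schreier_tail a b : (a <= b)%O ->
  exists k, forall s, S a s -> tail_ge k s -> S b s.
Proof.
elim/ordinal_ind: b a => [|b IH|b lb IH] a.
- move=> a0; exists 0%N => s; have -> // : a = ozero.
  by apply/le_anti; rewrite a0 ozero_le.
- rewrite le_eqVlt => /predU1P[->|]; first by exists 0%N.
  rewrite lt_osuccE => /IH[k hk]; exists (maxn 1 k) => s Ss sk.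
  apply/schreier_succP; exists 1%N.
    by apply/blocks1/hk => //; apply: tail_geW sk; exact: leq_maxr.
  by apply: tail_geW sk; exact: leq_maxl.
- rewrite le_eqVlt => /predU1P[->|ab]; first by exists 0%N.
  have [an [an_lt ans SP]] := schreier_limitP lb.
  have [_ [n _ <-] an_a] := sup_limit lb ans ab.
  have [k hk] := IH _ (an_lt n) _ (ltW an_a).
  exists (maxn n k) => s Ss sk; apply/SP; exists n.
    by apply: hk => //; apply: tail_geW sk; exact: leq_maxr.
  by apply: tail_geW sk; exact: leq_maxl.
Qed.

(** For counting arguments: far enough out, [S a] contains sets of every finite cardinality, as
    [S 1] already does. *)
Lemma schreier_large a : (oone <= a)%O ->
  exists k, forall s, (forall i, i \in s -> k <= i)%N -> tail_ge #|` s| s -> S a s.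
Proof.
move=> /schreier_tail[k hk]; exists k => s sk cs; apply: hk => //.
by apply/schreier_succP; exists #|` s| => //; rewrite S0; exact: blocks_card1.
Qed.

End SchreierSequence.

End SchreierFamilies.

(** * Cantor-Bendixson derivatives of families *)

Section CubeTopology.
Context {I : choiceType}.
Implicit Types (x y : cube I) (E X : set (cube I)) (A B : {fset I}) (b c : omega1).

Definition agree A x y : Prop := forall i, i \in A -> y i = x i.

Lemma cube_nbhs x E :
  nbhs x E <-> exists A, forall y, agree A x y -> E y.
Proof.
split=> [xE|[A AE]].
- pose F := filter_from [set: {fset I}] (fun A => [set y | agree A x y]).
  have FF : Filter F.
    apply: filter_from_filter; first by exists fset0.
    move=> A B _ _; exists (A `|` B)%fset => // y ABy.
    by split=> i iA; apply: ABy; rewrite inE iA ?orbT.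
  have H : F --> (x : prod_topology (fun _ : I => bool)).
    apply/cvg_sup => i U [V] [[W] oW <-] Wx WU; exists [fset i]%fset => // y yx.
    by apply: WU; rewrite /= /preimage /= (yx i) ?inE.
  by have [A _ AE] := H _ xE; exists A.
- apply: (@filterS _ _ _ [set y | forall i, i \in A -> y i = x i]) => //.
  have -> : [set y : cube I | forall i, i \in A -> y i = x i] =
      \bigcap_(i in [set` A]) [set y : cube I | y i = x i] by [].
  apply: filter_bigI => i _.
  have := @proj_continuous I (fun=> bool) i x [set x i]; apply.
  by exact: discrete_set1.
Qed.

Lemma derived_setP E x :
  derived_set E x <-> E x /\ forall A, exists y, [/\ y <> x, E y & agree A x y].
Proof.
split=> -[Ex xE]; split=> //.
  move=> A; have /xE[y [/eqP yx Ey Ay]] : nbhs x [set y | agree A x y].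
    by apply/cube_nbhs; exists A.
  by exists y.
move=> U /cube_nbhs[A AU]; have [y [/eqP yx Ey /AU Uy]] := xE A.
by exists y.
Qed.

Lemma closedP E :
  closed E <-> forall x, (forall A, exists2 y, E y & agree A x y) -> E x.
Proof.
split=> cE x xE; apply: cE.
  move=> U /cube_nbhs[A AU]; have [y Ey /AU Uy] := xE A.
  by exists y.
move=> A; have [|y [Ey yA]] := xE [set y | agree A x y]; last by exists y.
by apply/cube_nbhs; exists A.
Qed.

Lemma cbE X b : cantor_bendixson X b =
  X `&` \bigcap_(c in [set c | (c < b)%O]) derived_set (cantor_bendixson X c).
Proof.
rewrite /cantor_bendixson omega1_recE; congr (_ `&` _).
by rewrite bigcap_image.
Qed.

Lemma cbP X b x : cantor_bendixson X b x <->
  X x /\ forall c, (c < b)%O -> derived_set (cantor_bendixson X c) x.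
Proof. by rewrite cbE. Qed.

Lemma cb_le X b c : (c <= b)%O -> cantor_bendixson X b `<=` cantor_bendixson X c.
Proof.
rewrite le_eqVlt => /predU1P[->//|cb] x /cbP[_ /(_ _ cb)].
by move=> /derived_setP[].
Qed.

Lemma cb_sub X b : cantor_bendixson X b `<=` X.
Proof. by move=> x /cbP[]. Qed.

Lemma cb_succ X b :
  cantor_bendixson X (osucc b) = derived_set (cantor_bendixson X b).
Proof.
apply/seteqP; split=> x.
  by move=> /cbP[_ h]; apply: h; exact: lt_osucc.
move=> /derived_setP[xb xl]; apply/cbP; split; first exact: (cb_sub xb).
move=> c; rewrite lt_osuccE => cb; apply/derived_setP; split; first exact: (cb_le cb xb).
by move=> A; have [y [yx yb yA]] := xl A; exists y; split => //; exact: (cb_le cb yb).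
Qed.

Lemma cb_closed X b : closed X -> closed (cantor_bendixson X b).
Proof.
move=> cX; elim/(well_founded_ind omega1_wf): b => b IH.
apply/closedP => x xb; apply/cbP; split.
  by apply: (iffLR (closedP X) cX) => A; have [y /cb_sub Xy yA] := xb A; exists y.
move=> c cb; apply/derived_setP; split.
  apply: (iffLR (closedP _) (IH c cb)) => A.
  by have [y /(cb_le (ltW cb)) Xy yA] := xb A; exists y.
move=> A; have [y yb yA] := xb A.
have [yx|yx] := pselect (y = x); last by exists y; split => //; apply: cb_le yb; exact: ltW.
by have /cbP[_ /(_ _ cb)/derived_setP[_]] := yb; rewrite yx; apply.
Qed.

Lemma cb_subset X (Y : set (cube I)) b :
  X `<=` Y -> cantor_bendixson X b `<=` cantor_bendixson Y b.
Proof.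
move=> XY; elim/(well_founded_ind omega1_wf): b => b IH x /cbP[/XY Yx xl].
apply/cbP; split => // c cb; have /derived_setP[xc xA] := xl c cb.
apply/derived_setP; split; first exact: IH.
by move=> A; have [y [yx yc yA]] := xA A; exists y; split => //; exact: IH.
Qed.

Lemma cube_compact : compact [set: cube I].
Proof.
have := @tychonoff I (fun=> bool) (fun=> setT) (fun=> bool_compact).
by congr (compact _); apply/seteqP; split.
Qed.

Lemma discrete_closed_finite E :
  closed E -> derived_set E = set0 -> finite_set E.
Proof.
move=> cE dE; apply: contrapT => iE.
have cpE : compact E by apply: subclosed_compact cube_compact _.
(* The sets cofinite in [E] form a proper filter when [E] is infinite; its cluster point is an
   accumulation point of [E]. *)
pose F : set_system (cube I) := [set B | finite_set (E `\` B)].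
have FF : ProperFilter F.
  split; first by rewrite /F /= setD0.
  split; first by rewrite /F /= setDT.
  - by move=> P Q FP FQ; rewrite /F /= setDIr finite_setU.
  - by move=> P Q PQ; apply: sub_finite_set; exact: setDS.
have [|p [Ep pF]] := cpE F FF; first by rewrite /F /= setDv.
have : derived_set E p; last by rewrite dE.
apply/derived_setP; split => // A.
have FB : F (E `\ p).
  rewrite /F /=; apply: sub_finite_set (finite_set1 p) => y [Ey nEy] /=.
  by apply: contrapT => yp; apply: nEy.
have [|y [[Ey yp] yA]] := pF _ [set y | agree A p y] FB.
  by apply/cube_nbhs; exists A.
by exists y.
Qed.

(** By compactness a decreasing family of nonempty closed derivatives has a common point, so
    derivatives do not vanish for the first time at a limit. *)
Lemma cb_limit X b : closed X -> is_limit b -> cantor_bendixson X b = set0 ->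
  exists2 c, (c < b)%O & cantor_bendixson X c = set0.
Proof.
move=> cX lb Xb; apply: contrapT => nc.
have ne c : (c < b)%O -> cantor_bendixson X c !=set0.
  by move=> cb; apply/set0P/eqP => e; apply: nc; exists c.
have cpX : compact X by apply: subclosed_compact cube_compact _.
pose F := filter_from [set c | (c < b)%O] (cantor_bendixson X).
have FF : ProperFilter F.
  apply: filter_from_proper => [|c /ne//].
  apply: filter_from_filter; first by exists ozero; exact: limit_gt0.
  move=> c d cb db; exists (Order.max c d); first by rewrite /= gt_max cb db.
  by move=> x xm; split; apply: cb_le xm; rewrite le_max lexx ?orbT.
have [|p [Xp pF]] := cpX F FF.
  by exists ozero; [exact: limit_gt0|exact: cb_sub].
have pc c : (c < b)%O -> cantor_bendixson X c p.
  move=> cb; apply: (iffLR (closedP _) (cb_closed cX)) => A.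
  have [||y [yc yA]] := pF (cantor_bendixson X c) [set y | agree A p y].
  - by exists c.
  - by apply/cube_nbhs; exists A.
  - by exists y.
have : cantor_bendixson X b p; last by rewrite Xb.
apply/cbP; split => // c cb; rewrite -cb_succ; apply: pc; exact: limit_succ.
Qed.

(** If every earlier derivative met every neighbourhood of [x] away from [x], closedness would put
    [x] in all of them, and then in the derivative of order [b]. *)
Lemma cb_not X b x : closed X -> (ozero < b)%O -> ~ cantor_bendixson X b x ->
  exists2 c, (c < b)%O & exists A, forall y, y <> x -> agree A x y ->
    ~ cantor_bendixson X c y.
Proof.
move=> cX b0 /cbP nx; apply: contrapT => nc; apply: nx.
have h c : (c < b)%O ->
    forall A, exists y, [/\ y <> x, cantor_bendixson X c y & agree A x y].
  move=> cb A; apply: contrapT => ny; apply: nc; exists c => //; exists A => y yx yA yc.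
  by apply: ny; exists y.
have xc c : (c < b)%O -> cantor_bendixson X c x.
  move=> cb; apply: (iffLR (closedP _) (cb_closed cX)) => A.
  by have [y [_ yc yA]] := h c cb A; exists y.
split=> [|c cb]; first exact: cb_sub (xc _ b0).
by apply/derived_setP; split; [exact: xc|exact: h].
Qed.

Lemma cb_union X (Y : set (cube I)) b : closed X -> closed Y ->
  cantor_bendixson (X `|` Y) b `<=` cantor_bendixson X b `|` cantor_bendixson Y b.
Proof.
move=> cX cY; elim/(well_founded_ind omega1_wf): b => b IH x xb.
have [b0|b0] := eqVneq b ozero.
  case: (cb_sub xb) => h; [left|right]; apply/cbP; split => // c;
  by rewrite b0 ltNge ozero_le.
have {}b0 : (ozero < b)%O by rewrite lt_neqAle eq_sym b0 ozero_le.
apply: contrapT => /not_orP[/(cb_not cX b0)[c cb [A hA]] /(cb_not cY b0)[d db [B hB]]].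
(* On the intersection of the two neighbourhoods both derivatives of the larger order are empty away
   from [x], and so is that of the union by induction. *)
have mb : (Order.max c d < b)%O by rewrite gt_max cb.
have /cbP[_ /(_ _ mb)/derived_setP[_ /(_ (A `|` B)%fset)[y [yx ym yAB]]]] := xb.
have [yX|yY] := IH _ mb _ ym.
- apply: (hA _ yx); last by apply: cb_le yX; rewrite le_max lexx.
  by move=> i iA; apply: yAB; rewrite inE iA.
- apply: (hB _ yx); last by apply: cb_le yY; rewrite le_max lexx orbT.
  by move=> i iA; apply: yAB; rewrite inE iA orbT.
Qed.

End CubeTopology.

(** A map that is continuous and injective on an open set [U] carries accumulation to accumulation.
    It serves for removing the minimum [n] of a set, and for adjoining [n] to sets without it. *)
Lemma cb_image (I J : choiceType) (g : cube I -> cube J) (U X : set (cube I))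
    (Y : set (cube J)) b :
  (forall x (A : {fset J}), U x -> exists B : {fset I}, forall y, agree B x y ->
     U y /\ agree A (g x) (g y)) ->
  (forall x y, U x -> U y -> g x = g y -> x = y) ->
  (forall x, X x -> U x -> Y (g x)) ->
  forall x, cantor_bendixson X b x -> U x -> cantor_bendixson Y b (g x).
Proof.
move=> gc gi gXY; elim/(well_founded_ind omega1_wf): b => b IH x /cbP[Xx xl] Ux.
apply/cbP; split=> [|c cb]; first exact: gXY.
have /derived_setP[xc xA] := xl c cb; apply/derived_setP; split; first exact: IH.
move=> A; have [B hB] := gc x A Ux; have [y [yx yc yB]] := xA B.
have [Uy gA] := hB _ yB; exists (g y); split => //; last exact: IH.
by move=> /gi-/(_ Uy Ux).
Qed.

(** * Uniform families *)

Section UniformFamilies.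
Local Open Scope fset_scope.

Implicit Types (a b c d r : omega1) (M : set nat).

Lemma in_cubeP (I : choiceType) (F : set {fset I}) (x : cube I) :
  in_cube F x <-> exists2 s, F s & forall i, x i = (i \in s).
Proof.
split=> [[s Fs <-]|[s Fs xs]]; first by exists s.
by exists s => //; apply/funext => i; rewrite xs.
Qed.

Definition below (n : nat) : {fset nat} := [fset val i | i : 'I_n].

Lemma in_below n m : (m \in below n) = (m < n)%N.
Proof.
apply/imfsetP/idP => [[i _ ->]|mn]; first exact: ltn_ord.
by exists (Ordinal mn).
Qed.

Definition chi {I : choiceType} (s : {fset I}) : cube I := fun i => i \in s.

Lemma in_cube_chi (I : choiceType) (F : set {fset I}) s : in_cube F (chi s) <-> F s.
Proof.
split=> [/in_cubeP[t Ft st]|Fs]; last by exists s.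
by have -> : s = t by apply/fsetP => i; rewrite -st.
Qed.

Lemma rank_single_empty (I : choiceType) (C : set I) r :
  is_rank (Defs.restrict [set fset0] C) r -> r = ozero.
Proof.
move=> [[x xr] _]; apply: contrapT => /eqP r0.
have {}r0 : (ozero < r)%O by rewrite lt_neqAle eq_sym r0 ozero_le.
have /cbP[_ /(_ _ r0)/derived_setP[x0 /(_ fset0)[y [yx y0 _]]]] := xr.
apply: yx; have /cb_sub/in_cubeP[s [-> _] ys] := y0.
have /cb_sub/in_cubeP[t [-> _] xt] := x0.
by apply/funext => i; rewrite ys xt.
Qed.

Lemma srk_single_empty (I : choiceType) :
  infinite_set [set: I] -> srk [set (fset0 : {fset I})] = ozero.
Proof.
move=> iI; have ne : [set r | exists C : set I, infinite_set C /\
    is_rank (Defs.restrict [set fset0] C) r] ozero.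
  exists setT; split => //; split.
    exists (chi fset0); apply/cbP; split => [|c]; first exact/in_cube_chi.
    by rewrite ltNge ozero_le.
  move=> b; case: (eqVneq b ozero) => [->//|b0] [x xb].
  have {}b0 : (ozero < b)%O by rewrite lt_neqAle eq_sym b0 ozero_le.
  have /cbP[_ /(_ _ b0)/derived_setP[x0 /(_ fset0)[y [yx y0 _]]]] := xb.
  exfalso; apply: yx; have /cb_sub/in_cubeP[s [-> _] ys] := y0.
  have /cb_sub/in_cubeP[t [-> _] xt] := x0.
  by apply/funext => i; rewrite ys xt.
by have [C [_ /rank_single_empty]] := omin_in ne.
Qed.

Lemma uniform_family_on r M H : uniform_on r M H -> family_on M H.
Proof. by case. Qed.

Lemma tail_infinite M n : infinite_set M -> infinite_set (tail_of M n).
Proof.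
move=> iM fM; apply: iM; apply: sub_finite_set (_ : M `<=` tail_of M n `|` `I_n.+1)%classic _.
  by move=> m Mm /=; rewrite ltnS; case: (leqP m n) => nm; [right|left].
by rewrite finite_setU; split => //; exact: finite_II.
Qed.

Lemma infinite_ge M n : infinite_set M -> exists2 m, M m & (n < m)%N.
Proof.
move=> /(@tail_infinite M n) iM; apply: contrapT => nm; apply: iM.
by apply: sub_finite_set (finite_set0 nat) => m [Mm nm']; apply: nm; exists m.
Qed.

Lemma uniform0 M H : uniform_on ozero M H -> H = [set fset0].
Proof.
move e : ozero => r HU; case: HU e => // [b ? ? _ _ e|a an ? ? _ [a0 _] _ _ _ _ e].
- by have := lt_osucc b; rewrite -e ltNge ozero_le.
- by case: a0.
Qed.

Lemma uniform_sections r M H : uniform_on r M H -> r <> ozero ->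
  exists an : nat -> omega1,
    [/\ forall n, M n -> uniform_on (an n) (tail_of M n) (section_at H n),
        forall n, M n -> (an n < r)%O &
        forall b N, (b < r)%O -> exists2 n, M n /\ (N < n)%N & (b <= an n)%O].
Proof.
case=> {r M H}[//|b M H [iM _ _] HU _|a an M H [iM _ _] la an_mono an_lt an_sup HU _].
  exists (fun=> b); split => // [n _|c N]; first exact: lt_osucc.
  by rewrite lt_osuccE => cb; have [m Mm nm] := infinite_ge N iM; exists m.
exists an; split => // b N ba.
have [_ [n Mn <-] bn] := sup_limit la an_sup ba.
have [m Mm] := infinite_ge (maxn n N) iM; rewrite gtn_max => /andP[nm Nm].
exists m => //; apply: ltW; apply: lt_trans bn _; exact: an_mono.
Qed.

(** Knowing the last derivative exactly drives the induction. A nonempty set with minimum [n] would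
    give a point of order [r > an n] in the section at [n]; conversely, the singletons [{n}] have
    order at least [an n] and converge to the empty set. *)
Lemma uniform_cb_top r M H : uniform_on r M H ->
  forall x, cantor_bendixson (in_cube H) r x <-> x = chi fset0.
Proof.
elim/(well_founded_ind omega1_wf): r M H => r IH M H HU.
have [iM HM H0] := uniform_family_on HU.
have [r0|/eqP r0] := eqVneq r ozero.
  move: HU; rewrite r0 => /uniform0 ->.
  move=> x; split=> [/cb_sub/in_cubeP[s /= -> xs]|->].
    by apply/funext => i; rewrite xs.
  by apply/cbP; split => [|c]; [exact/in_cube_chi|rewrite ltNge ozero_le].
have [an [aU an_lt an_cof]] := uniform_sections HU r0.
have top n : M n -> forall x, cantor_bendixson (in_cube (section_at H n)) (an n) x <->
    x = chi fset0 by move=> Mn; apply: IH; [exact: an_lt|exact: aU].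
move=> x; split=> [xr|->].
- apply: contrapT => x0.
  have /cb_sub/in_cubeP[s Hs xs] := xr.
  have s0 : s != fset0.
    by apply/eqP => s0; apply: x0; apply/funext => i; rewrite xs s0.
  have := fset_min_in s0; set n := fset_min s => ns.
  have Mn : M n by apply: HM Hs _ _.
  pose g (y : cube nat) : cube nat := fun i => (i != n) && y i.
  pose U : set (cube nat) := [set y : cube nat | y n /\ forall m, (m < n)%N -> ~~ y m].
  have Ux : U x.
    split; first by rewrite xs.
    by move=> m mn; rewrite xs; apply: contraL mn => /fset_min_le; rewrite -leqNgt.
  have gx : cantor_bendixson (in_cube (section_at H n)) r (g x).
    apply: (@cb_image _ _ g U _ _ r _ _ _ x xr Ux).
    + move=> y A [yn yU]; exists (A `|` below n.+1) => z yz.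
      have yz' m : (m <= n)%N -> z m = y m.
        move=> mn; apply: yz; rewrite in_fsetU; apply/orP; right.
        by rewrite in_below ltnS.
      split; first by split=> [|m mn]; rewrite yz' ?yU// ltnW.
      by move=> i iA; rewrite /g yz// inE iA.
    + move=> y z [yn _] [zn _] e; apply/funext => i.
      have [->|ni] := eqVneq i n; first by rewrite yn zn.
      by have := congr1 (fun h => h i) e; rewrite /g ni.
    + move=> y /in_cubeP[t Ht yt] [yn yU]; apply/in_cubeP; exists (t `\ n).
        split=> [m|]; last by rewrite fsetD1K// -yt.
        move=> /fsetD1P[mn mt]; rewrite ltn_neqAle eq_sym mn leqNgt.
        by apply/negP => /yU; rewrite yt mt.
      by move=> i; rewrite /g in_fsetD1 yt.
  have : cantor_bendixson (in_cube (section_at H n)) (osucc (an n)) (g x).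
    by apply: cb_le gx; rewrite osucc_le; exact: an_lt.
  rewrite cb_succ => /derived_setP[/(top _ Mn) g0 /(_ fset0)[y [yg + _]]].
  by move=> /(top _ Mn) y0; apply: yg; rewrite y0 g0.
- suff : forall c, (c <= r)%O -> cantor_bendixson (in_cube H) c (chi fset0).
    by apply.
  elim/(well_founded_ind omega1_wf) => c IHc cr; apply/cbP.
  split=> [|d dc]; first exact/in_cube_chi.
  apply/derived_setP; split; first by apply: IHc => //; exact: le_trans (ltW dc) cr.
  move=> A; have [N hN] := fset_bounded A.
  have [n [Mn Nn] dn] := an_cof d N (lt_le_trans dc cr).
  pose g (y : cube nat) : cube nat := fun i => (i == n) || y i.
  exists (g (chi fset0)); split.
  + by move=> /(congr1 (fun h => h n)); rewrite /g eqxx /= /chi in_fset0.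
  + have h0 : cantor_bendixson (in_cube (section_at H n)) d (chi fset0).
      by apply: (cb_le dn); apply/(top _ Mn).
    apply: (@cb_image _ _ g [set y : cube nat | ~~ y n] _ _ d _ _ _ _ h0); last first.
    * by rewrite /mkset /chi inE.
    * move=> y /in_cubeP[t [_ Ht] yt] _; apply/in_cubeP; exists (n |` t) => // i.
      by rewrite /g in_fset1U yt.
    * move=> y z /= yn zn e; apply/funext => i.
      have [->|ni] := eqVneq i n; first by rewrite (negbTE yn) (negbTE zn).
      by have := congr1 (fun h => h i) e; rewrite /g (negbTE ni).
    * move=> y B yn; exists (n |` B) => z yz; split.
        by rewrite /= yz // in_fset1U eqxx.
      by move=> i iB; rewrite /g yz// in_fset1U iB orbT.
  + move=> i /hN iN; rewrite /g /chi in_fset0 orbF.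
    by apply/negbTE; rewrite neq_ltn (ltn_trans iN Nn).
Qed.

Lemma uniform_rank r M H : uniform_on r M H -> is_rank H r.
Proof.
move=> HU; have top := uniform_cb_top HU; split.
  by exists (chi fset0); apply/top.
move=> b [x xb]; rewrite leNgt; apply/negP => rb.
have : cantor_bendixson (in_cube H) (osucc r) x by apply: cb_le xb; rewrite osucc_le.
rewrite cb_succ => /derived_setP[/top x0 /(_ fset0)[y [yx /top y0 _]]].
by apply: yx; rewrite y0 x0.
Qed.

Lemma restrictT (I : choiceType) (F : set {fset I}) : Defs.restrict F setT = F.
Proof. by apply/seteqP; split=> [s []//|s Fs]; split. Qed.

Lemma uniform_srk_le r H : uniform_on r setT H -> (srk H <= r)%O.
Proof.
move=> /uniform_rank Hr; apply: omin_le; exists setT; split; first exact: infinite_nat.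
by rewrite restrictT.
Qed.

Lemma uniform_restrict r M H M' : uniform_on r M H -> (M' `<=` M)%classic ->
  infinite_set M' -> uniform_on r M' (Defs.restrict H M').
Proof.
elim/(well_founded_ind omega1_wf): r M H M' => r IH M H M' HU MM iM'.
have fM' : family_on M' (Defs.restrict H M').
  have [_ _ H0] := uniform_family_on HU; split; first exact: iM'.
    by move=> s [].
  by split; [exact: H0|move=> i; rewrite /= in_fset0].
have sec n : M' n -> section_at (Defs.restrict H M') n = Defs.restrict (section_at H n) (tail_of M' n).
  move=> M'n; apply/seteqP; split=> s.
    move=> [ns [Hs sM]]; split => // i /= si; split; last exact: ns.
    by apply: sM; rewrite /= in_fset1U si orbT.
  move=> [[ns Hs] sM]; split => //; split => // i /= /fset1UP[->//|si].
  by case: (sM i si).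
case: HU IH MM {fM'} sec (fM') => {r M H}[M H fM ->|b M H fM HU|a an M H fM la an_m an_lt an_sup HU] IH MM sec fM'.
- apply: uniform_zero => //; apply/seteqP; split=> [s [->]//|s ->].
  by split => // i /=; rewrite in_fset0.
- apply: uniform_succ => // n M'n; rewrite sec//; apply: IH (HU n _) _ _.
  + exact: lt_osucc.
  + exact: MM.
  + by move=> m [/MM ? ?].
  + exact: tail_infinite.
- apply: (uniform_limit (an := an)) => //.
  + by move=> m n /MM Mm /MM Mn; exact: an_m.
  + by move=> n /MM; exact: an_lt.
  + split=> [_ [n /MM Mn <-]|d ud]; first exact/ltW/an_lt.
    apply: (proj2 an_sup) => _ [n Mn <-]; have [m M'm nm] := infinite_ge n iM'.
    apply: (@le_trans _ _ (an m)); last by apply: ud; exists m.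
    by apply: ltW; apply: an_m => //; exact: MM.
  + move=> n M'n; rewrite sec//; apply: IH (HU n _) _ _.
    * exact/an_lt/MM.
    * exact: MM.
    * by move=> m [/MM ? ?].
    * exact: tail_infinite.
Qed.

(** The section of the sum at [n] is the sum of [F] and the section of [G], so the induction lowers
    the rank of [G] until only [F] is left. *)
Lemma uniform_fsum rF rG M F G : hereditary F -> uniform_on rF setT F ->
  uniform_on rG M G -> uniform_on (oadd rF rG) M (Defs.restrict (fsum F G) M).
Proof.
move=> hF FU; elim/(well_founded_ind omega1_wf): rG M G => r IH M G GU.
have [iM GM G0] := uniform_family_on GU.
have [_ _ F0] := uniform_family_on FU.
have fM : family_on M (Defs.restrict (fsum F G) M).
  split; [exact: iM|by move=> s []|].
  split; last by move=> i; rewrite /= in_fset0.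
  by exists fset0, fset0; rewrite fsetU0; split => //; exact: fbefores0.
have sec n : M n -> section_at G n fset0 ->
    section_at (Defs.restrict (fsum F G) M) n =
    Defs.restrict (fsum F (section_at G n)) (tail_of M n).
  move=> Mn [_ Gn0]; apply/seteqP; split=> u.
  - move=> [nu [[s [t [Gs Ft st nust]]] uM]].
    have mem i : (i \in n |` u) = (i \in s) || (i \in t) by rewrite nust inE.
    split; last first.
      by move=> i /= iu; split; [apply: uM; rewrite /= in_fset1U iu orbT|exact: nu].
    have nn : (n \in u) = false by apply/negP => /nu; rewrite ltnn.
    have [ns|ns] := boolP (n \in s).
      exists (s `\ n), t; split => //.
      + split=> [m /fsetD1P[mn ms]|]; last by rewrite fsetD1K.
        by have := mem m; rewrite ms in_fset1U (negbTE mn) => /nu.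
      + by apply: fbeforeS st => //; exact: fsubD1set.
      + have nt : (n \in t) = false by apply/negP => /(st _ _ ns); rewrite ltnn.
        apply/fsetP => i; rewrite in_fsetU in_fsetD1; have := mem i.
        rewrite in_fset1U; have [->|] := eqVneq i n; last by move=> _ /= ->.
        by rewrite nn nt.
    (* If the minimum [n] belongs to the part in [F], the part in [G] is empty and heredity of [F]
       absorbs the removal of [n]. *)
    have nt : n \in t by have := mem n; rewrite in_fset1U eqxx (negbTE ns).
    have s0 i : (i \in s) = false.
      apply/negP => si; have := st _ _ si nt; have := mem i.
      rewrite si in_fset1U; case: eqVneq => [->|_ /nu ni]; first by rewrite ltnn.
      by move=> /(ltn_trans ni); rewrite ltnn.
    exists fset0, (t `\ n); split.
    + by split.
    + by apply: hF Ft _; exact: fsubD1set.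
    + exact: fbefore0s.
    + rewrite fset0U; apply/fsetP => i; rewrite in_fsetD1; have := mem i.
      rewrite s0 /= in_fset1U; have [->|] := eqVneq i n; last by move=> _ /= ->.
      by rewrite nn.
  - move=> [[s [t [[ns Gs] Ft st ->]]] uM]; split.
      by move=> m mst; case: (uM m mst).
    split; last first.
      by move=> i /= /fset1UP[->//|ist]; case: (uM i ist).
    exists (n |` s), t; split => //; last by rewrite fsetUA.
    move=> i j /fset1UP[->|si] tj; last exact: st.
    by have [] := uM j; rewrite //= inE tj orbT.
case: GU IH iM GM G0 fM sec => {r M G}[M G fG ->|b M G fG HU|a an M G fG la an_m an_lt an_sup HU] IH iM GM G0 fM sec.
- rewrite oadd0; have -> : fsum F [set fset0] = F.
    apply/seteqP; split=> [_ [s [t [-> Ft _ ->]]]|s Fs]; first by rewrite fset0U.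
    by exists fset0, s; rewrite fset0U; split => //; exact: fbefore0s.
  exact: uniform_restrict FU _ _.
- rewrite oaddS; apply: uniform_succ => // n Mn; rewrite sec//.
    by apply: IH (HU n Mn); exact: lt_osucc.
  by have [] := uniform_family_on (HU n Mn).
- apply: (uniform_limit (an := fun n => oadd rF (an n))) => //.
  + exact: limit_oadd.
  + by move=> m n Mm Mn mn; apply: lt_oadd2l; exact: an_m.
  + by move=> n Mn; apply: lt_oadd2l; exact: an_lt.
  + split=> [_ [n Mn <-]|d ud]; first exact/ltW/lt_oadd2l/an_lt.
    apply: limit_sup; first exact: limit_oadd.
    move=> c /(oadd_lt_limit la)[e ea ce]; apply: (le_trans ce).
    have [_ [n Mn <-] en] := sup_limit la an_sup ea.
    apply: le_trans (le_oadd2l rF (ltW en)) _; apply: ud.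
    by exists n.
  + move=> n Mn; rewrite sec//; first by apply: IH (HU n Mn); exact: an_lt.
    by have [] := uniform_family_on (HU n Mn).
Qed.

End UniformFamilies.

(** * Consecutively large families *)

Section LargeFamilies.
Local Open Scope fset_scope.

Implicit Types (a b c d r l : omega1).
Lemma spreadable_spreading F : spreadable F -> spreading F.
Proof.
move=> hF k m n m_mono n_mono mn Fm.
have m_inj : injective m.
  move=> i j e; apply/val_inj/eqP; rewrite eqn_leq leqNgt [X in _ && X]leqNgt.
  by apply/andP; split; apply/negP => /m_mono; rewrite e ltnn.
pose f x := if [pick i | m i == x] is Some i then n i else x.
have fm i : f (m i) = n i.
  rewrite /f; case: pickP => [j /eqP /m_inj -> //|/(_ i)]; by rewrite eqxx.
have -> : [fset n i | i in 'I_k] = [fset f x | x in [fset m i | i in 'I_k]].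
  apply/fsetP => x; apply/imfsetP/imfsetP => /= [[i _ ->]|[_ /imfsetP[i _ ->] ->]].
    by exists (m i); [apply/imfsetP; exists i|rewrite fm].
  by exists i => //; rewrite fm.
apply: hF => // [_ _ /imfsetP[i /= _ ->] /imfsetP[j /= _ ->]|_ /imfsetP[i /= _ ->]].
  rewrite !fm => mij; apply: n_mono; rewrite ltnNge; apply/negP.
  rewrite leq_eqVlt => /predU1P[/val_inj e|/m_mono]; first by move: mij; rewrite e ltnn.
  by move=> /(ltn_trans mij); rewrite ltnn.
by rewrite fm.
Qed.

(** The minimum of a set chooses the family for the remaining elements: the section at [n] is the
    part of [G n] beyond [n], as a uniform family of limit rank requires. *)
Definition diagonal (G : nat -> set {fset nat}) : set {fset nat} :=
  [set s | s = fset0 \/ G (fset_min s) (s `\ fset_min s)].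

Section Diagonal.
Variables (G : nat -> set {fset nat}) (r : nat -> omega1).
Hypotheses (hG : forall n, hereditary (G n)) (sG : forall n, spreadable (G n)).
Hypothesis GS : forall n, (G n `<=` G n.+1)%classic.
Hypothesis uG : forall n, uniform_on (r n) setT (G n).
Hypothesis rS : forall n, (r n < r n.+1)%O.

Lemma increasing_le m n : (m <= n)%N -> (G m `<=` G n)%classic.
Proof.
by move=> /subnK <-; elim: (n - m)%N => // k IH s /IH; exact: GS.
Qed.

Lemma ranks_lt m n : (m < n)%N -> (r m < r n)%O.
Proof.
move=> /subnK <-; elim: (n - m.+1)%N => [|k IH]; first exact: rS.
exact: lt_trans IH (rS _).
Qed.

Lemma fset_min_mono (s t : {fset nat}) : t `<=` s -> t != fset0 ->
  (fset_min s <= fset_min t)%N.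
Proof. by move=> /fsubsetP ts /fset_min_in /ts; exact: fset_min_le. Qed.

Lemma hereditary_diagonal : hereditary (diagonal G).
Proof.
move=> s t [->|Gs] ts; first by left; apply/eqP; rewrite -fsubset0.
have [->|t0] := eqVneq t fset0; first by left.
right; have mst := fset_min_mono ts t0; apply: (increasing_le mst).
apply: hG Gs _; apply/fsubsetP => i /fsetD1P[im it].
rewrite in_fsetD1 (fsubsetP ts)// andbT.
apply: contraNneq im => e.
by rewrite eqn_leq [X in _ && X]fset_min_le// andbT e.
Qed.

Lemma spreadable_diagonal : spreadable (diagonal G).
Proof.
move=> s f [->|Gs] f1 f2; first by left; rewrite imfset0.
have [->|s0] := eqVneq s fset0; first by left; rewrite imfset0.
right; have ms := fset_min_in s0.
have fmin : fset_min [fset f x | x in s] = f (fset_min s).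
  have fs : f (fset_min s) \in [fset f x | x in s] by apply/imfsetP; exists (fset_min s).
  apply/eqP; rewrite eqn_leq fset_min_le//=.
  have : [fset f x | x in s] != fset0 by apply/fset0Pn; exists (f (fset_min s)).
  move=> /fset_min_in /imfsetP[i /= si ->].
  have := fset_min_le si; rewrite leq_eqVlt => /predU1P[->//|mi].
  by apply: ltnW; exact: f1.
rewrite fmin; apply: (increasing_le (f2 _ ms)).
have -> : [fset f x | x in s] `\ f (fset_min s) = [fset f x | x in s `\ fset_min s].
  apply/fsetP => j; rewrite in_fsetD1; apply/andP/imfsetP => /=.
    move=> [jm /imfsetP[i /= si e]]; exists i => //; rewrite in_fsetD1 si andbT.
    by apply: contraNneq jm => im; rewrite e im.
  move=> [i /fsetD1P[im si] ->]; split; last by apply/imfsetP; exists i.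
  rewrite neq_ltn; apply/orP; right; apply: f1 => //.
  by rewrite ltn_neqAle eq_sym im fset_min_le.
apply: sG => // [i j /fsetD1P[_ si] /fsetD1P[_ sj]|i /fsetD1P[_ si]]; [exact: f1|exact: f2].
Qed.

Lemma uniform_diagonal : is_limit (osup (range r)) ->
  uniform_on (osup (range r)) setT (diagonal G).
Proof.
move=> la; apply: (uniform_limit (an := r)) => //.
- by split; [exact: infinite_nat|by []|left].
- by move=> m n _ _; exact: ranks_lt.
- move=> n _; apply: lt_le_trans (rS n) _; apply: osup_ub.
    exact: countable_range.
  by exists n.+1.
- split; first by apply: osup_ub; exact: countable_range.
  by move=> b; exact: osup_le.
- move=> n _; have -> : section_at (diagonal G) n = Defs.restrict (G n) (tail_of setT n).
    have nmin s : (forall m, m \in s -> (n < m)%N) -> fset_min (n |` s) = n.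
      move=> ns; apply/eqP; rewrite eqn_leq fset_min_le ?in_fset1U ?eqxx//=.
      have : n |` s != fset0 by apply/fset0Pn; exists n; rewrite in_fset1U eqxx.
      by move=> /fset_min_in /fset1UP[->//|/ns/ltnW].
    have ns_s s : (forall m, m \in s -> (n < m)%N) -> (n |` s) `\ n = s.
      move=> ns; apply/fsetP => i; rewrite in_fsetD1 in_fset1U.
      by case: eqVneq => //= ->; apply/esym/negP => /ns; rewrite ltnn.
    apply/seteqP; split=> s.
      move=> [ns [e|]].
        have : n \in n |` s by rewrite in_fset1U eqxx.
        by rewrite e in_fset0.
      by rewrite nmin// ns_s// => Gs; split => // i /ns.
    move=> [Gs sn]; have ns m : m \in s -> (n < m)%N by move=> /sn[].
    by split => //; right; rewrite nmin// ns_s.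
  by apply: uniform_restrict (uG n) _ _ => //; apply: tail_infinite; exact: infinite_nat.
Qed.

Lemma ranks_limit : is_limit (osup (range r)).
Proof.
have rl n : (r n < osup (range r))%O.
  apply: lt_le_trans (rS n) _; apply: osup_ub; first exact: countable_range.
  by exists n.+1.
split=> [e|b e]; first by have := rl 0%N; rewrite e ltNge ozero_le.
have : (osup (range r) <= b)%O; last by rewrite e osucc_le ltxx.
by apply: osup_le => _ [n _ <-]; rewrite -lt_osuccE -e.
Qed.

End Diagonal.

Fixpoint fsums (K : nat -> set {fset nat}) (n : nat) : set {fset nat} :=
  if n is m.+1 then fsum (fsums K m) (K m.+1) else K 0%N.

Fixpoint osums (k : nat -> omega1) (n : nat) : omega1 :=
  if n is m.+1 then oadd (osums k m) (k m.+1) else k 0%N.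

(** A diagonal family is hereditary and spreading when the families are nested, and uniform when
    their ranks increase. Arbitrary [K n] satisfy neither; their partial sums satisfy both, since
    the empty set belongs to each [K n] and its rank is at least one. *)
Lemma fsums_diagonal (K : nat -> set {fset nat}) (k : nat -> omega1) :
  (forall n, hereditary (K n)) -> (forall n, spreadable (K n)) ->
  (forall n, uniform_on (k n) setT (K n)) -> (forall n, (oone <= k n)%O) ->
  [/\ forall n, hereditary (fsums K n),
      (forall m n, (m <= n)%N -> (fsums K m `<=` fsums K n)%classic),
      (forall n, (K n `<=` fsums K n)%classic),
      hereditary (diagonal (fsums K)) /\ spreadable (diagonal (fsums K)) &
      uniform_on (osup (range (osums k))) setT (diagonal (fsums K))].
Proof.
move=> hK sK uK k1.
have hG n : hereditary (fsums K n).
  by elim: n => [|n IH]; [exact: hK|exact: hereditary_fsum].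
have sG n : spreadable (fsums K n).
  by elim: n => [|n IH]; [exact: sK|exact: spreadable_fsum].
have K0 n : K n fset0 by case: (uniform_family_on (uK n)).
have G0 n : fsums K n fset0.
  elim: n => [|n IH]; first exact: K0.
  by exists fset0, fset0; rewrite fsetU0; split => //; exact: fbefores0.
have GS n : (fsums K n `<=` fsums K n.+1)%classic.
  by move=> s Gs; exists fset0, s; rewrite fset0U; split => //; exact: fbefore0s.
have uG n : uniform_on (osums k n) setT (fsums K n).
  elim: n => [|n IH]; first exact: uK.
  by have := uniform_fsum (hG n) IH (uK n.+1); rewrite restrictT.
have rS n : (osums k n < osums k n.+1)%O.
  by rewrite /= -{1}[osums k n]oadd0 lt_oadd2l// -osucc_le; exact: k1.
split => //.
- by move=> m n; exact: increasing_le.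
- move=> [//|n] s Ks; exists s, fset0; rewrite fsetU0; split => //; exact: fbefores0.
- by split; [exact: hereditary_diagonal|exact: spreadable_diagonal].
- by apply: uniform_diagonal => //; exact: ranks_limit.
Qed.

Section SchreierInUniform.
Variable S : omega1 -> set {fset nat}.
Hypothesis HS : is_schreier_sequence S.

Lemma card_at_most1_uniform : uniform_on oone setT (card_at_most 1 : set {fset nat}).
Proof.
apply: uniform_succ.
  by split; [exact: infinite_nat|by []|rewrite /card_at_most /mkset cardfs0].
move=> n _; apply: uniform_zero; last first.
  apply/seteqP; split=> [s [ns]|s ->].
    rewrite /card_at_most /mkset cardfsU1.
    have -> : n \notin s by apply/negP => /ns; rewrite ltnn.
    by rewrite add1n ltnS leqn0 cardfs_eq0 => /eqP.
  split; first by move=> m; rewrite in_fset0.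
  by rewrite /card_at_most /mkset fsetU0 cardfs1.
split; first by apply: tail_infinite; exact: infinite_nat.
  by move=> s [ns _] i /= /ns.
split; first by move=> m; rewrite in_fset0.
by rewrite /card_at_most /mkset fsetU0 cardfs1.
Qed.

(** Multiplication accepts only members of [frakS], and a Schreier family is in general not one of
    them: [{0}] is missing from [S 1], so its section at [0] is empty. An enlargement whose rank is
    still at most [omega ^ a] is enough. *)
Lemma schreier_uniform a : exists H r, [/\ hereditary H, spreadable H,
  uniform_on r setT H, (oone <= r)%O /\ (r <= oexp oomega a)%O &
  (S a `<=` H)%classic].
Proof.
have o1 := oone_le_oomega; have [S0 _ _] := HS.
elim/ordinal_ind: a => [|a [H [r [hH sH uH [r1 ra] SH]]]|a la IH].
- exists (card_at_most 1), oone; split => //; last by rewrite S0.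
  + by rewrite -S0; exact: schreier_her.
  + by rewrite -S0; exact: schreier_spread.
  + exact: card_at_most1_uniform.
  + by rewrite oexp0.
- have [|||| hG Gmn KG [hD sD] uD] := @fsums_diagonal (fun=> H) (fun=> r) => //.
  exists (diagonal (fsums (fun=> H))), (osup (range (osums (fun=> r)))); split => //.
  + split.
      apply: le_trans r1 _; apply: osup_ub; first exact: countable_range.
      by exists 0%N.
    apply: osup_le => _ [n _ <-]; rewrite oexpS//.
    apply: (@le_trans _ _ (omul (oexp oomega a) (onat n.+1))); last exact/le_omul2l/ltW/onat_lt.
    elim: n => [|n IHn]; first by rewrite /= omul1.
    by rewrite /= omulS; apply: le_trans (le_oadd2r _ IHn) (le_oadd2l _ ra).
  + move=> t /(schreier_succP HS)[n Bt tn].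
    have [->|t0] := eqVneq t fset0; first by left.
    right; have nm : (n <= fset_min t)%N by apply: tn; exact: fset_min_in.
    have H0 : H fset0 by apply: SH; exact: schreier_fset0.
    (* [fsums] of index [m] adds [m + 1] copies, so a set made of at most [fset_min t] blocks
       fits. *)
    have BG m u : blocks H m.+1 u -> fsums (fun=> H) m u.
      elim: m u => [|m IHm] u.
        by move=> [s [_ [Hs -> _ ->]]]; rewrite fsetU0.
      by move=> [s [v [Hs Bv sv ->]]]; exists s, v; split => //; exact: IHm.
    apply: (hG _ t); last exact: fsubD1set.
    apply: BG; apply: (blocks_le H0 (leqW nm)).
    elim: n t Bt {t0 nm tn} => // n IHn t [s [v [Ss Bv sv ->]]].
    by exists s, v; split => //; [exact: SH|exact: IHn].
- have [an [an_lt ans SP]] := schreier_limitP HS la.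
  have /choice[Kk hKk] : forall n, exists Kk : set {fset nat} * omega1,
      [/\ hereditary Kk.1, spreadable Kk.1, uniform_on Kk.2 setT Kk.1,
      (oone <= Kk.2)%O /\ (Kk.2 <= oexp oomega (an n))%O & (S (an n) `<=` Kk.1)%classic].
    by move=> n; have [H [r h]] := IH _ (an_lt n); exists (H, r).
  pose K n := (Kk n).1; pose k n := (Kk n).2.
  have [|||| hG Gmn KG [hD sD] uD] := @fsums_diagonal K k.
  + by move=> n; case: (hKk n).
  + by move=> n; case: (hKk n).
  + by move=> n; case: (hKk n).
  + by move=> n; case: (hKk n) => _ _ _ [].
  exists (diagonal (fsums K)), (osup (range (osums k))); split => //.
  + split.
      apply: (@le_trans _ _ (osums k 0%N)); first by case: (hKk 0%N) => _ _ _ [].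
      by apply: osup_ub; [exact: countable_range|exists 0%N].
    have klt n : (k n < oexp oomega a)%O.
      have [_ _ _ [_ ka] _] := hKk n; apply: (le_lt_trans ka).
      exact: oexp_lt2l.
    apply: osup_le => _ [n _ <-]; apply: ltW.
    elim: n => [|n IHn]; first exact: klt.
    by apply: oexp_oomega_oadd => //; exact: klt.
  + move=> t /SP[n St tn].
    have [->|t0] := eqVneq t fset0; first by left.
    right; have nm : (n <= fset_min t)%N by apply: tn; exact: fset_min_in.
    apply: (hG _ t); last exact: fsubD1set.
    by apply: (Gmn _ _ nm); apply: KG; case: (hKk n) => _ _ _ _; apply.
Qed.

End SchreierInUniform.

Section Families.
Variables (S : omega1 -> set {fset nat}) (kappa : choiceType).
Hypothesis HS : is_schreier_sequence S.
Hypothesis ik : infinite_set [set: kappa].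

(** Homogeneity turns a bound on the small rank into one on the rank, which is below
    [oiota (srk F) <= l]. *)
Lemma homogeneous_cb (F : set {fset kappa}) l : exp_indecomposable l ->
  homogeneous F -> (srk F < l)%O ->
  [/\ closed (in_cube F), hereditary F, F fset0 & exists2 b, (b < l)%O &
    cantor_bendixson (in_cube F) b = set0].
Proof.
move=> li [a [cF hF h]] Fl; have ll := indec_limit li.
have l0 := limit_gt0 ll.
have F0 : F fset0.
  case: h => [[_ ->]//|[_ F1 _ _]]; apply: F1.
  by rewrite /card_at_most /mkset cardfs0.
split => //; case: h => [[_ eF]|[_ F1 ea [r [rF _ ra]]]].
  exists (osucc ozero); first exact: limit_succ.
  apply/seteqP; split=> // x; rewrite cb_succ => /derived_setP[x0 /(_ fset0)[y [yx y0 _]]].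
  apply: yx; have /cb_sub/in_cubeP[s] := y0; rewrite eF => -> ys.
  have /cb_sub/in_cubeP[t] := x0; rewrite eF => -> xt.
  by apply/funext => i; rewrite ys xt.
exists (osucc r).
  apply: limit_succ => //; apply: (lt_le_trans ra); rewrite ea.
  exact: oiota_le.
apply/eqP/negPn/negP => /set0P ne; have [_ /(_ _ ne)] := rF.
by rewrite osucc_le ltxx.
Qed.

(* [S a] being contained in a uniform family of rank at most [omega ^ a], the
   multiplication can be iterated below the next exp-indecomposable ordinal. *)
Lemma consecutively_large_families (B : set (set {fset kappa})) times a :
  is_basis B times -> (oone <= a)%O ->
  exists F : nat -> set {fset kappa},
    [/\ forall n, [/\ closed (in_cube (F n)), hereditary (F n), F n fset0 &
          exists2 b, (b < oiota (oexp oomega a))%O &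
          cantor_bendixson (in_cube (F n)) b = set0],
        forall i, F 0%N [fset i] &
        forall n (s : nat -> {fset kappa}), (forall k, F n (s k)) ->
          exists2 phi : nat -> nat, increasing_seq phi &
            forall x, S a x -> F n.+1 (\bigcup_(k <- x) s (phi k))].
Proof.
move=> [[Bh _ Bex] [_ _ _] Bm] a1.
have [li la] := oiotaP (oexp oomega a); set l := oiota _ in li la *.
have o1 := oone_le_oomega.
have ol : (oomega < l)%O.
  by apply: le_lt_trans la; rewrite -{1}[oomega]oexp1//; exact: le_oexp2l.
have [H [r [hH sH uH [_ ra] SH]]] := schreier_uniform HS a.
have HfS : frakS H by split => //; [exact: spreadable_spreading|exists r].
have Hl : (srk H < l)%O.
  apply: (le_lt_trans (uniform_srk_le uH)); exact: le_lt_trans ra la.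
have [F0 BF0 sF0] := Bex _ (lexx oomega).
pose F n := iter n (fun G => times G H) F0.
have BF n : B (F n).
  by elim: n => // n IH; have [] := Bm _ _ IH HfS.
have Fl n : (srk (F n) < l)%O.
  elim: n => [|n IH]; first by rewrite sF0.
  have [_ [[_ e] _]] := Bm _ _ (BF n) HfS.
  have [_ lt1] := oiotaP (srk (F n.+1)).
  (* The small rank of the product is known only up to [oiota]; this suffices because [l] is itself
     exp-indecomposable. *)
  apply: (lt_le_trans lt1); rewrite [oiota _]e; apply: oiota_le => //.
  exact: indec_omul.
exists F; split.
- by move=> n; apply: homogeneous_cb => //; exact: Bh.
- have [b [_ _ [[_ e]|[_ F1 _ _]]]] := Bh _ BF0.
    (* The initial family has small rank [omega], which excludes the family consisting of the empty
       set; hence it contains the singletons. *)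
    have := onat_lt 0; rewrite -sF0 e srk_single_empty//.
    by rewrite ltxx.
  by move=> i; apply: F1; rewrite /card_at_most /mkset cardfs1.
- move=> n s Fs; have [_ [_ /(_ s Fs)[phi phi1 phi2]]] := Bm _ _ (BF n) HfS.
  by exists phi => // x Sx; apply: phi2; exact: SH.
Qed.

End Families.

End LargeFamilies.

Local Open Scope card_scope.

(** * Finite sequences over an infinite set *)

(** Comparability of cardinals: a maximal partial injection, seen as a subset of the product, is
    defined on all of [A] or covers [B]. *)
Lemma injection_dichotomy (T U : Type) (A : set T) (B : set U) :
  A !=set0 -> B !=set0 ->
  (exists2 f : T -> U, forall x, A x -> B (f x) & forall x y, A x -> A y -> f x = f y -> x = y) \/
  (exists2 g : U -> T, forall x, B x -> A (g x) & forall x y, B x -> B y -> g x = g y -> x = y).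
Proof.
move=> [a0 Aa0] [b0 Bb0].
pose P (G : set (T * U)) := (forall p, G p -> A p.1 /\ B p.2) /\
  (forall p q, G p -> G q -> p.1 = q.1 <-> p.2 = q.2).
have [F FP Ftot|G [[GA Ginj] Gmax]] := @Zorn_bigcup _ P.
  split=> [p [X FX Xp]|p q [X FX Xp] [Y FY Yq]]; first by case: (FP _ FX) => h _; exact: h.
  by case: (Ftot _ _ FX FY) => XY; [have := (FP _ FY).2 _ _ (XY _ Xp) Yq|
    have := (FP _ FX).2 _ _ Xp (XY _ Yq)].
have [allA|/existsNP[a /not_implyP[Aa na]]] := pselect (forall x, A x -> exists y, G (x, y)).
  left; have /choice[f hf] : forall x, exists y, A x -> G (x, y).
    by move=> x; have [/allA[y]|] := pselect (A x); [exists y|exists b0].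
  exists f => [x /hf/GA[]//|x y /hf gx /hf gy fxy].
  by apply/(Ginj _ _ gx gy).
right; have allB y : B y -> exists x, G (x, y).
  move=> By; apply: contrapT => ny; apply: (Gmax (G `|` [set (a, y)])).
    split=> [p Gp|/(_ (a, y) (or_intror erefl)) Gay]; first by left.
    by apply: na; exists y.
  split=> [p [/GA//|->]//|p q [Gp|->] [Gq|->]]; [exact: Ginj| | |by []].
    by split=> /= e; exfalso; [apply: na; exists p.2|apply: ny; exists p.1]; rewrite -e -surjective_pairing.
  by split=> /= e; exfalso; [apply: na; exists q.2|apply: ny; exists q.1]; rewrite e -surjective_pairing.
have /choice[g hg] : forall y, exists x, B y -> G (x, y).
  by move=> y; have [/allB[x]|] := pselect (B y); [exists x|exists a0].
exists g => [x /hg/GA[]//|x y /hg gx /hg gy gxy].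
by apply/(Ginj _ _ gx gy).
Qed.

(* Zorn's lemma is applied to the partial injections [seq A -> A], ordered by
   extension; the domain A of a maximal one has the cardinality of T, since
   otherwise a copy of A inside the complement of A could be added. *)
Lemma seq_injection (T : choiceType) : infinite_set [set: T] ->
  exists h : seq T -> T, injective h.
Proof.
move=> infT.
pose over (A : set T) (s : seq T) := forall x, x \in s -> A x.
pose good (p : set T * (seq T -> T)) :=
  (forall s, over p.1 s -> p.1 (p.2 s)) /\
  (forall s t, over p.1 s -> over p.1 t -> p.2 s = p.2 t -> s = t).
pose R (p q : {p | good p}) := `[< (sval p).1 `<=` (sval q).1 /\
  forall s, over (sval p).1 s -> (sval p).2 s = (sval q).2 s >].
have over_sub A B s : A `<=` B -> over A s -> over B s by move=> AB h x /h/AB.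
have [e einj] : exists e : nat -> T, injective e.
  have /infiniteP/card_leP[f] := infT; exists (fun n => val (f (SigSub (mem_set (I : setT n))))).
  move=> m n /val_inj /(@inj _ _ _ f) h.
  by have := h (mem_set I) (mem_set I) => /(congr1 val).
pose de x : nat := xget 0%N [set n | e n = x].
have deK n : de (e n) = n.
  by apply: einj; apply: (@xgetI _ 0%N [set m | e m = e n] n).
(* The starting point is a countable set, where sequences are coded by numbers. *)
have base : good (range e, fun s => e (choice.pickle (map de s))).
  split=> [s _ /=|s t /= hs ht /einj /(pcan_inj choice.pickleK) st]; first by exists (choice.pickle (map de s)).
  rewrite -(map_id s) -(map_id t).
  have eK u : over (range e) u -> map id u = map e (map de u).
    move=> hu; rewrite -map_comp; apply/eq_in_map => x /hu[n _ <-] /=.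
    by rewrite deK.
  by rewrite (eK s hs) (eK t ht) st.
have [p|p q r /asboolP[pq1 pq2] /asboolP[qr1 qr2]|F Ftot|] :=
    @ZL_preorder _ (exist good _ base : {p | good p}) R.
- by apply/asboolP; split.
- apply/asboolP; split; first exact: subset_trans pq1 qr1.
  by move=> s sp; rewrite pq2// qr2//; exact: over_sub sp.
- have [[p0 Fp0]|/forallNP F0] := pselect (exists p, F p); last first.
    by exists (exist good _ base) => p /F0.
  pose A := \bigcup_(p in F) (sval p).1.
  have cover s : over A s -> exists2 p, F p & over (sval p).1 s.
    elim: s => [|x s IH] hs; first by exists p0.
    have [p Fp px] := hs x (mem_head _ _).
    have [|q Fq qs] := IH; first by move=> y ys; apply: hs; rewrite in_cons ys orbT.
    have [/asboolP[h _]|/asboolP[h _]] := Ftot _ _ Fp Fq.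
      exists q => // y; rewrite in_cons => /orP[/eqP ->|/qs//]; exact: h.
    exists p => // y; rewrite in_cons => /orP[/eqP -> //|/qs/h//].
  have /choice[f hf] : forall s, exists v, forall p, F p -> over (sval p).1 s -> (sval p).2 s = v.
    move=> s; have [[p Fp ps]|h] := pselect (exists2 p, F p & over (sval p).1 s).
      exists ((sval p).2 s) => q Fq qs.
      by have [/asboolP[_ ->]|/asboolP[_ ->]] := Ftot _ _ Fp Fq.
    by exists (e 0%N) => p Fp ps; case: h; exists p.
  have gA : good (A, f).
    split=> [s /cover[p Fp ps]|s t /cover[p Fp ps] /cover[q Fq qt]] /=.
      by rewrite -(hf _ p)//; exists p => //; exact: (svalP p).1.
    have [/asboolP[h _]|/asboolP[h _]] := Ftot _ _ Fp Fq.
      rewrite -(hf s q)//; last exact: over_sub ps.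
      rewrite -(hf t q)//; apply: (svalP q).2 => //; exact: over_sub ps.
    rewrite -(hf s p)// -(hf t p)//; last exact: over_sub qt.
    apply: (svalP p).2 => //; exact: over_sub qt.
  exists (exist good _ gA) => p Fp; apply/asboolP; split=> [x px|s ps] /=; first by exists p.
  by rewrite -(hf s p).
move=> [[A f] gAf] max; have [/= fA finj] := gAf.
have A0 : A !=set0 by exists (f [::]); exact: fA.
have over1 x : A x -> over A [:: x] by move=> Ax y; rewrite inE => /eqP ->.
have over2 x y : A x -> A y -> over A [:: x; y].
  by move=> Ax Ay z; rewrite !inE => /orP[] /eqP ->.
have inject (h : T -> T) (D : set T) :
    (forall x y, D x -> D y -> h x = h y -> x = y) ->
    forall s t, over D s -> over D t -> map h s = map h t -> s = t.
  move=> hinj; elim=> [|x s IH] [|y t]//= hs ht [exy est].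
  congr (_ :: _); first by apply: hinj => //; [apply: hs|apply: ht]; exact: mem_head.
  by apply: IH => // z zs; [apply: hs|apply: ht]; rewrite in_cons zs orbT.
have map_over (h : T -> T) (D : set T) s : (forall x, D x -> A (h x)) -> over D s -> over A (map h s).
  by move=> hA hs _ /mapP[x /hs/hA ? ->].
suff [h hA hinj] : exists2 h : T -> T, forall x, A (h x) & injective h.
  exists (fun s => f (map h s)) => s t st; apply: (inj_map hinj).
  by apply: finj st => _ /mapP[x _ ->].
have [AT|/existsNP[y0 ny0]] := pselect (forall x, A x); first by exists id.
have [||[j jA jinj]|[k kA kinj]] := @injection_dichotomy _ _ A (~` A).
- by [].
- by exists y0.
- pose dj y := xget y0 [set x | A x /\ j x = y].
  have djK x : A x -> dj (j x) = x.
    move=> Ax; have [Ad jd] := @xgetI _ y0 [set z | A z /\ j z = j x] x (conj Ax erefl).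
    exact: jinj.
  pose A' := A `|` (j @` A).
  (* Sequences of lengths one and two keep the two copies of [A] apart inside [A]. *)
  pose h x := if `[< A x >] then f [:: x] else f [:: dj x; dj x].
  have hA x : A' x -> A (h x).
    move=> A'x; rewrite /h; case: asboolP => Ax; first exact/fA/over1.
    by case: A'x => // -[z Az <-]; rewrite djK//; exact/fA/over2.
  have hinj x y : A' x -> A' y -> h x = h y -> x = y.
    have new z : A' z -> ~ A z -> exists2 w, A w & j w = z by case=> // -[w ? ?]; exists w.
    move=> A'x A'y; rewrite /h; case: asboolP => Ax; case: asboolP => Ay.
    + by move/finj => /(_ (over1 _ Ax) (over1 _ Ay)) [].
    + have [w Aw wy] := new _ A'y Ay; rewrite -wy djK// => /finj.
      by move=> /(_ (over1 _ Ax) (over2 _ _ Aw Aw)).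
    + have [w Aw wx] := new _ A'x Ax; rewrite -wx djK// => /finj.
      by move=> /(_ (over2 _ _ Aw Aw) (over1 _ Ay)).
    + have [w Aw wx] := new _ A'x Ax; have [v Av vy] := new _ A'y Ay.
      rewrite -wx -vy !djK// => /finj.
      by move=> /(_ (over2 _ _ Aw Aw) (over2 _ _ Av Av)) [->].
  (* Sequences with a new letter go to the new copy [j A], which is disjoint from [A]; the old
     values are kept. *)
  pose f' s := if `[< over A s >] then f s else j (f (map h s)).
  have gA' : good (A', f').
    split=> [s /= hs|s t /= hs ht]; rewrite /f'.
      case: asboolP => As; first by left; exact: fA.
      by right; exists (f (map h s)) => //; apply: fA; exact: map_over hs.
    case: asboolP => As; case: asboolP => At.
    + exact: finj.
    + by move=> e1; case: (jA (f (map h t))); [apply: fA; exact: map_over ht|rewrite -e1; exact: fA].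
    + by move=> e1; case: (jA (f (map h s))); [apply: fA; exact: map_over hs|rewrite e1; exact: fA].
    + move=> /jinj e1; apply: (inject _ _ hinj) => //; apply: finj.
      * exact: map_over hs.
      * exact: map_over ht.
      * by apply: e1; apply: fA; [exact: map_over hs|exact: map_over ht].
  have /asboolP[/= A'A _] : R (exist good _ gA') (exist good _ gAf).
    apply: max; apply/asboolP; split=> [x Ax|s As] /=; first by left.
    by rewrite /f'; case: asboolP.
  have [x Ax] := A0; case: (jA _ Ax); apply: A'A; right; exists x => //.
(* Here the complement of [A] embeds into [A], so the same coding by length embeds all of [T] into
   [A]. *)
- exists (fun x => if `[< A x >] then f [:: x] else f [:: k x; k x]) => [x|x y].
    by case: asboolP => Ax; apply: fA; [exact: over1|apply: over2; exact: kA].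
  case: asboolP => Ax; case: asboolP => Ay.
  + by move/finj => /(_ (over1 _ Ax) (over1 _ Ay)) [].
  + by move/finj => /(_ (over1 _ Ax) (over2 _ _ (kA _ Ay) (kA _ Ay))).
  + by move/finj => /(_ (over2 _ _ (kA _ Ax) (kA _ Ax)) (over1 _ Ay)).
  + move/finj => /(_ (over2 _ _ (kA _ Ax) (kA _ Ax)) (over2 _ _ (kA _ Ay) (kA _ Ay))) [e1].
    exact: kinj.
Qed.

Local Open Scope fset_scope.
Local Open Scope ring_scope.

(** * Averages small on families of small rank *)

Section Averages.
Context {R : realType}.
Implicit Types (s t J : {fset nat}) (c : nat -> R).

Lemma sum_fsetU (I : choiceType) (V : zmodType) (s t : {fset I}) (F : I -> V) :
  (forall i, i \in s -> i \in t -> False) ->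
  \sum_(i <- s `|` t) F i = \sum_(i <- s) F i + \sum_(i <- t) F i.
Proof.
move=> st; rewrite -big_cat; apply: perm_big; apply: uniq_perm => /=.
- exact: fset_uniq.
- rewrite cat_uniq !fset_uniq andbT /=; apply/hasPn => i it.
  by apply/negP => /st; apply.
- by move=> i; rewrite mem_cat -in_fsetU.
Qed.

Definition average s c : Prop := (forall k, 0 <= c k) /\ \sum_(k <- s) c k = 1.

Lemma average1 k : average [fset k] (fun=> 1).
Proof. by split=> // ; rewrite big_seq_fset1. Qed.

Lemma average_le s c (F : nat -> R) (C : R) : average s c ->
  (forall k, k \in s -> F k <= C) -> \sum_(k <- s) c k * F k <= C.
Proof.
move=> [c0 c1] FC; rewrite -[leRHS]mul1r -c1 mulr_suml big_seq [leRHS]big_seq.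
by apply: ler_sum => k ks; apply: ler_wpM2l => //; exact: FC.
Qed.

(* Unions of [n] successive sets, each charging little to the tests that meet
   its predecessors: a test pays the bound [D] at most once. *)
Lemma averaging (T : Type) (tests : set T) (phi : nat -> T -> R) (D e : R)
    (G : set {fset nat}) (m0 : nat) :
  0 < e ->
  (forall k x, tests x -> 0 <= phi k x <= D) ->
  (forall J M, tail_ge m0 J -> exists s c, [/\ G s, tail_ge M s, average s c &
     forall x k, tests x -> k \in J -> phi k x != 0 -> \sum_(k <- s) c k * phi k x <= e]) ->
  forall m, exists n s c, [/\ blocks G n s, tail_ge n s, tail_ge m s, average s c &
    forall x, tests x -> \sum_(k <- s) c k * phi k x <= e + e].
Proof.
move=> e0 phiD next m.
(* Dividing by the number [n + 1] of sets makes the single payment [D] at most [e]. *)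
have [n nD] : exists n : nat, D / e < n.+1%:R.
  exists (Num.bound `|D / e|); apply: (le_lt_trans (ler_norm _)).
  by apply: (lt_trans (archi_boundP (normr_ge0 _))); rewrite ltr_nat.
pose M := maxn n.+1 (maxn m m0).
suff [s [c [Bs Ms c0 cN cD]]] : exists s c, [/\ blocks G n.+1 s, tail_ge M s,
    forall k, 0 <= c k, \sum_(k <- s) c k = n.+1%:R &
    forall x, tests x -> \sum_(k <- s) c k * phi k x <= D + n.+1%:R * e].
  exists n.+1, s, (fun k => c k / n.+1%:R); split => //.
  - by apply: tail_geW Ms; rewrite /M leq_max leqnn.
  - by apply: tail_geW Ms; rewrite /M !leq_max leqnn orbT.
  - split=> [k|]; first by rewrite divr_ge0.
    by rewrite -mulr_suml cN divff.
  - move=> x tx; under eq_bigr do rewrite mulrAC.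
    rewrite -mulr_suml ler_pdivrMr//; apply: le_trans (cD _ tx) _.
    rewrite mulrDl [e * _]mulrC lerD2r; apply: ltW.
    by rewrite -ltr_pdivrMr.
elim: (n.+1) => [|N [s [c [Bs Ms c0 cN cD]]]].
  exists fset0, (fun=> 0); split => //; first by rewrite big1.
  move=> x tx; rewrite big1 => [|k _]; last by rewrite mul0r.
  rewrite mul0r addr0.
  by have /andP[] := phiD 0%N _ tx; exact: le_trans.
have [p hp] := fset_bounded s.
have [|t [d [Gt pt [d0 d1] dD]]] := next s (maxn p M).
  by apply: tail_geW Ms; rewrite /M !leq_max leqnn !orbT.
have st : fbefore s t.
  move=> i j /hp ip jt; apply: (leq_trans ip); apply: leq_trans (pt _ jt).
  exact: leq_maxl.
have disj i : i \in s -> i \in t -> False by move=> si /(st _ _ si); rewrite ltnn.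
pose f k := if k \in s then c k else d k.
have fs (F : nat -> R) : \sum_(k <- s `|` t) f k * F k =
    \sum_(k <- s) c k * F k + \sum_(k <- t) d k * F k.
  rewrite sum_fsetU//; congr (_ + _); rewrite big_seq [RHS]big_seq; apply: eq_bigr => k ks.
    by rewrite /f ks.
  by rewrite /f; case: ifPn => // /disj /(_ ks).
exists (s `|` t), f; split.
- exact: blocks_cat.
- move=> i /fsetUP[/Ms//|/pt]; apply: leq_trans; exact: leq_maxr.
- by move=> k; rewrite /f; case: ifP.
- have e1 (F : nat -> R) (q : seq nat) : \sum_(k <- q) F k * 1 = \sum_(k <- q) F k.
    by apply: eq_bigr => k _; rewrite mulr1.
  by have := fs (fun=> 1); rewrite !e1 => ->; rewrite cN d1 natr1.
- move=> x tx; rewrite fs -natr1 mulrDl mul1r addrA.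
  (* A test that meets the earlier sets is charged at most [e] by the new one; for any other test
     the new set is the first to be met, and costs at most [D]. *)
  have [/hasP[k ks kx]|/hasPn nx] := boolP (has (fun k => phi k x != 0) s).
    by apply: lerD; [exact: cD|exact: dD kx].
  rewrite [X in X + _]big_seq big1 ?add0r; last first.
    by move=> k /nx; rewrite negbK => /eqP ->; rewrite mulr0.
  apply: (@le_trans _ _ D).
    by apply: average_le => // k _; case/andP: (phiD k _ tx).
  by rewrite -addrA lerDl addr_ge0 ?mulr_ge0// ltW.
Qed.

Section OverSchreier.
Variable S : omega1 -> set {fset nat}.
Hypothesis HS : is_schreier_sequence S.
Implicit Types (a b d : omega1).

Lemma disjoint_avoid (I : choiceType) (B : nat -> {fset I}) (A : {fset I}) :
  (forall k l i, i \in B k -> i \in B l -> k = l) ->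
  exists m, forall k i, (m <= k)%N -> i \in B k -> i \notin A.
Proof.
move=> Bd; suff [m hm] : exists m, forall k i, (m <= k)%N -> i \in B k ->
    i \notin (A : seq I) by exists m.
elim: (A : seq I) => [|j A' [m hm]]; first by exists 0%N.
have [[l jl]|nj] := pselect (exists l, j \in B l).
  exists (maxn m l.+1) => k i; rewrite geq_max => /andP[mk lk] iB.
  rewrite in_cons negb_or (hm k) ?andbT//; apply: contraTneq lk => ij.
  by rewrite (Bd k l j) ?ltnn// -?ij.
exists m => k i mk iB; rewrite in_cons negb_or (hm k) ?andbT//.
by apply: contra_notN nj => /eqP <-; exists k.
Qed.

(** At a successor the last derivative is a finite set of finite sets, which the blocks [B k] avoid
    from some [k] on. The tests that meet some of these later blocks then have smaller rank, and the
    induction hypothesis provides the next set for [averaging]. *)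
Lemma cb_average (I : choiceType) (B : nat -> {fset I}) (phi : nat -> cube I -> R) D b :
  (forall k l i, i \in B k -> i \in B l -> k = l) ->
  (forall k x, phi k x != 0 -> exists2 i, i \in B k & x i) ->
  forall (K : set (cube I)) e m, closed K ->
  (forall x, K x -> exists s : {fset I}, x = chi s) ->
  (forall k x, K x -> 0 <= phi k x <= D) ->
  cantor_bendixson K b = set0 -> 0 < e ->
  exists s c, [/\ S b s, tail_ge m s, average s c &
    forall x, K x -> \sum_(k <- s) c k * phi k x <= e].
Proof.
move=> Bd phiB; elim/ordinal_ind: b => [|b IH|b lb IH] K e m cK finK phiD Kb e0.
- exists [fset m], (fun=> 1); split.
  + by have [-> _ _] := HS; rewrite /card_at_most /mkset cardfs1.
  + by move=> i /fset1P ->.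
  + exact: average1.
  + move=> x Kx; have : cantor_bendixson K ozero x; last by rewrite Kb.
    by apply/cbP; split => // c; rewrite ltNge ozero_le.
- have cE : closed (cantor_bendixson K b) by exact: cb_closed.
  have fE : finite_set (cantor_bendixson K b).
    by apply: discrete_closed_finite => //; rewrite -cb_succ.
  have [A hA] : exists A : {fset I}, forall x i, cantor_bendixson K b x -> x i -> i \in A.
    have [X EX] := finite_fsetP.1 fE.
    suff [A hA] : exists A : {fset I}, forall x i, x \in (X : seq (cube I)) -> x i -> i \in A.
      by exists A => x i; rewrite EX; exact: hA.
    have : forall x, x \in (X : seq (cube I)) -> K x.
      by move=> x xX; apply: (@cb_sub _ K b); rewrite EX.
    elim: (X : seq (cube I)) => [|x X' IHX] XK; first by exists fset0.
    have [|A hA] := IHX; first by move=> y yX; apply: XK; rewrite in_cons yX orbT.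
    have [s xs] := finK _ (XK _ (mem_head _ _)).
    exists (s `|` A) => y i; rewrite in_cons in_fsetU => /predU1P[->|yX yi].
      by rewrite xs /chi => ->.
    by rewrite (hA y i yX yi) orbT.
  have [m1 hm1] := disjoint_avoid A Bd.
  have e2 : 0 < e / 2 by rewrite divr_gt0.
  have [J M Jm1|n [s [c [Bs ns ms cs cD]]]] := @averaging _ K phi D (e / 2) (S b) m1 e2 phiD _ m.
    (* Meeting the blocks of [J] is a condition on finitely many coordinates, so this set of tests
       is closed. *)
    pose KJ : set (cube I) := [set x | K x /\ exists k i, [/\ k \in J, i \in B k & x i]].
    have KJK : (KJ `<=` K)%classic by move=> x [].
    have cKJ : closed KJ.
      apply/closedP => x xJ; split.
        by apply: (iffLR (closedP K) cK) => A'; have [y /KJK Ky yA] := xJ A'; exists y.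
      have [y [_ [k [i [kJ ik yi]]]] yx] := xJ (\bigcup_(k <- J) B k).
      exists k, i; split => //; rewrite -(yx i)//.
      by apply/bigfcupP; exists k; rewrite ?kJ.
    have KJb : cantor_bendixson KJ b = set0.
      apply/seteqP; split=> // x xb.
      have [_ [k [i [kJ ik xi]]]] := cb_sub xb.
      have := hA _ _ (cb_subset KJK xb) xi.
      by apply/negP; apply: hm1 ik; exact: Jm1.
    have [s [c [Ss Ms cs cD]]] := IH KJ (e / 2) M cKJ (fun x Kx => finK x (KJK _ Kx))
      (fun k x Kx => phiD k x (KJK _ Kx)) KJb e2.
    exists s, c; split => // x k Kx kJ /phiB[i ik xi]; apply: cD; split => //.
    by exists k, i.
  exists s, c; split => //; first by apply/(schreier_succP HS); exists n.
  by move=> x /cD; rewrite -splitr.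
- have [c cb Kc] := cb_limit cK lb Kb.
  have [k hk] := schreier_tail HS (ltW cb).
  have [s [f [Sf sf af fD]]] := IH c cb K e (maxn m k) cK finK phiD Kc e0.
  exists s, f; split => //.
    by apply: hk => //; apply: tail_geW sf; exact: leq_maxr.
  by apply: tail_geW sf; exact: leq_maxl.
Qed.

Section SpecialAverages.
Variables (d : omega1) (sj : nat -> {fset nat}) (P : nat -> nat).
Hypotheses (Ssj : forall j, S d (sj j)) (sj_before : forall j l, (j < l)%N ->
  fbefore (sj j) (sj l)) (sj_ge : forall j, tail_ge j (sj j)).
Hypotheses (P_mono : {homo P : i j / (i < j)%N}) (P_ge : forall j, (j <= P j)%N).

Definition block_union J : {fset nat} := \bigcup_(j <- J) sj j.

(** Averages supported on the [sj j] can be averaged again over such [J], the result being supported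
    on a set of [S b]. *)
Definition block_family b : set {fset nat} := [set J | S b (block_union J)].

Lemma mem_block_union J i : i \in block_union J <-> exists2 j, j \in J & i \in sj j.
Proof.
split=> [/bigfcupP[j /andP[jJ _] ij]|[j jJ ij]]; first by exists j.
by apply/bigfcupP; exists j; rewrite ?jJ.
Qed.

Lemma block_union_ge n J : tail_ge n J -> tail_ge n (block_union J).
Proof.
by move=> nJ i /mem_block_union[j /nJ nj /sj_ge]; exact: leq_trans.
Qed.

Lemma block_union_before J J' : fbefore J J' -> fbefore (block_union J) (block_union J').
Proof.
move=> JJ i i' /mem_block_union[j jJ ij] /mem_block_union[j' jJ' ij'].
by apply: sj_before ij ij'; exact: JJ.
Qed.

Lemma block_unionU J J' : block_union (J `|` J') = block_union J `|` block_union J'.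
Proof.
apply/fsetP => i; apply/idP/idP.
  move=> /mem_block_union[j /fsetUP[jJ|jJ] ij]; apply/fsetUP.
    by left; apply/mem_block_union; exists j.
  by right; apply/mem_block_union; exists j.
move=> /fsetUP[] /mem_block_union[j jJ ij]; apply/mem_block_union; exists j => //;
  by rewrite in_fsetU jJ ?orbT.
Qed.

Lemma block_family_succ b n J : blocks (block_family b) n J -> tail_ge n J ->
  block_family (osucc b) J.
Proof.
move=> BJ nJ; apply/(schreier_succP HS); exists n; last exact: block_union_ge.
elim: n J BJ {nJ} => [|n IH] J; first by move=> ->; rewrite /block_union big_seq_fset0.
move=> [J1 [J2 [BJ1 BJ2 J12 ->]]]; exists (block_union J1), (block_union J2); split.
- exact: BJ1.
- exact: IH.
- exact: block_union_before.
- exact: block_unionU.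
Qed.

Lemma block_family_tail b b' : (b <= b')%O ->
  exists k, forall J, tail_ge k J -> block_family b J -> block_family b' J.
Proof.
move=> /(schreier_tail HS)[k hk]; exists k => J kJ bJ; apply: hk => //.
exact: block_union_ge.
Qed.

(** Induction on [a] through [averaging]: a test in [S a] that meets the image under [P] of a given
    [J] has a bounded minimum, hence is made of boundedly many sets of lower order, against which
    the next average is chosen. The averaging adds the successor to [oadd d a]. *)
Lemma special_average a (e : R) m : 0 < e ->
  exists J c, [/\ block_family (osucc (oadd d a)) J, tail_ge m J, average J c &
    forall t, S a t -> \sum_(j <- J) c j * (P j \in t)%:R <= e].
Proof.
have phi01 : forall (j : nat) (t : {fset nat}), 0 <= ((P j \in t)%:R : R) <= 1.
  by move=> j t; case: (P j \in t); rewrite ?lexx ?ler01.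
elim/ordinal_ind: a e m => [|a IH|a la IH] e m e0; have e2 : 0 < e / 2 by rewrite divr_gt0.
- have [J M _|n [s [c [Bs ns ms cs cD]]]] := @averaging _ (S ozero)
    (fun j t => (P j \in t)%:R) 1 (e / 2) (block_family d) 0 e2 (fun k x _ => phi01 k x) _ m.
    have [p hp] := fset_bounded J.
    exists [fset maxn p M], (fun=> 1); split.
    + by rewrite /block_family /block_union /= big_seq_fset1.
    + by move=> i /fset1P ->; exact: leq_maxr.
    + exact: average1.
    + move=> t k; have [-> _ _] := HS; rewrite /card_at_most /mkset => t1 /hp kp.
      rewrite pnatr_eq0 eqb0 negbK big_seq_fset1 mul1r => kt.
      have -> : P (maxn p M) \in t = false; last exact: ltW.
      apply/negP => pt; move: t1.
      have kP : (P k < P (maxn p M))%N.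
        by apply: P_mono; apply: leq_trans kp _; exact: leq_maxl.
      have : [fset P k; P (maxn p M)] `<=` t.
        by apply/fsubsetP => i; rewrite !inE => /orP[] /eqP ->.
      by move=> /fsubset_leq_card; rewrite cardfs2 (ltn_eqF kP) => /leq_trans h /h.
  exists s, c; split => //; first by rewrite oadd0; exact: block_family_succ ns.
  by move=> t /cD; rewrite -splitr.
- have [J M _|n [s [c [Bs ns ms cs cD]]]] := @averaging _ (S (osucc a))
    (fun j t => (P j \in t)%:R) 1 (e / 2) (block_family (osucc (oadd d a))) 0 e2
    (fun k x _ => phi01 k x) _ m.
    have [p hp] := fset_bounded J.
    (* The minimum of such a test is less than [P p], so it has at most that many pieces in [S a];
       each may cost this share. *)
    have ep : 0 < e / 2 / (P p).+1%:R by rewrite divr_gt0.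
    have [J' [c [bJ' MJ' cJ' cD]]] := IH _ M ep.
    exists J', c; split => // t k /(schreier_succP HS)[n Bt nt] /hp kp.
    rewrite pnatr_eq0 eqb0 negbK => kt.
    have nP : (n <= (P p).+1)%N.
      apply: leqW; apply: leq_trans (nt _ kt) _; apply: ltnW; exact: P_mono.
    have e3 := divr_ge0 (ltW e2) (ler0n R (P p).+1).
    apply: (@le_trans _ _ (n%:R * (e / 2 / (P p).+1%:R))); last first.
      rewrite mulrCA -[leRHS]mulr1 ler_pM2l// ler_pdivrMr ?ltr0n// mul1r.
      by rewrite ler_nat.
    elim: n t Bt {nt kt nP} => [|n IHn] t.
      by move=> ->; rewrite mul0r; under eq_bigr do rewrite in_fset0 mulr0; rewrite big1.
    move=> [t1 [t2 [St1 Bt2 _ ->]]].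
    rewrite -natr1 mulrDl mul1r addrC.
    apply: le_trans (lerD (cD _ St1) (IHn _ Bt2)).
    rewrite -big_split /=; apply: ler_sum => j _; rewrite -mulrDr.
    apply: ler_wpM2l; first by case: cJ'.
    by rewrite in_fsetU; case: (_ \in t1); case: (_ \in t2);
      rewrite ?addr0 ?add0r// lerDl.
  exists s, c; split => //; first by rewrite oaddS; exact: block_family_succ ns.
  by move=> t /cD; rewrite -splitr.
- have [an [an_lt ans SP]] := schreier_limitP HS la.
  have [J M _|n [s [c [Bs ns ms cs cD]]]] := @averaging _ (S a)
    (fun j t => (P j \in t)%:R) 1 (e / 2) (block_family (oadd d a)) 0 e2
    (fun k x _ => phi01 k x) _ m.
    have [p hp] := fset_bounded J.
    (* Only the finitely many families [S (an n)] with [n <= P p] can contain the test; up to a tail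
       they all lie in one [S a']. *)
    have [a' a'a [k0 hk0]] : exists2 a', (a' < a)%O & exists k0, forall n t, (n <= P p)%N ->
        S (an n) t -> tail_ge k0 t -> S a' t.
      elim: (P p) => [|q [a' a'a [k0 hk0]]].
        by exists (an 0%N) => //; exists 0%N => n t; rewrite leqn0 => /eqP ->.
      exists (Order.max a' (an q.+1)); first by rewrite gt_max a'a an_lt.
      have [|k1 hk1] := schreier_tail HS (a := a') (b := Order.max a' (an q.+1)).
        by rewrite le_max lexx.
      have [|k2 hk2] := schreier_tail HS (a := an q.+1) (b := Order.max a' (an q.+1)).
        by rewrite le_max lexx orbT.
      exists (maxn k0 (maxn k1 k2)) => n t; rewrite leq_eqVlt ltnS => /predU1P[->|nq] St kt.
        by apply: hk2 => //; apply: tail_geW kt; rewrite !leq_max leqnn !orbT.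
      apply: hk1; last by apply: tail_geW kt; rewrite !leq_max leqnn !orbT.
      by apply: (hk0 n) => //; apply: tail_geW kt; rewrite !leq_max leqnn.
    have [|k1 hk1] := @block_family_tail (osucc (oadd d a')) (oadd d a).
      by rewrite osucc_le; exact: lt_oadd2l.
    have [J' [c [bJ' MJ' cJ' cD]]] := IH _ a'a _ (maxn k0 (maxn k1 M)) e2.
    exists J', c; split => //.
    + by apply: hk1 => //; apply: tail_geW MJ'; rewrite !leq_max leqnn !orbT.
    + by apply: tail_geW MJ'; rewrite !leq_max leqnn !orbT.
    + move=> t k /SP[n St nt] /hp kp; rewrite pnatr_eq0 eqb0 negbK => kt.
      have nP : (n <= P p)%N.
        apply: leq_trans (nt _ kt) _; apply: ltnW; exact: P_mono.
      (* Cutting at [k0] loses nothing, since [P j >= j >= k0] for [j] in the new set. *)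
      pose t' := [fset i in t | (k0 <= i)%N].
      have St' : S a' t'.
        apply: (hk0 n) => //; last by move=> i; rewrite !inE => /andP[].
        apply: (schreier_her HS) St _; apply/fsubsetP => i.
        by rewrite !inE => /andP[].
      apply: le_trans (cD _ St'); rewrite big_seq [leRHS]big_seq.
      apply: ler_sum => j jJ; apply: ler_wpM2l; first by case: cJ'.
      have -> // : (P j \in t') = (P j \in t).
      rewrite !inE /=; case: (P j \in t) => //=.
      apply: leq_trans (P_ge j); apply: leq_trans (MJ' _ jJ).
      by rewrite !leq_max leqnn.
  exists s, c; split => //; first exact: block_family_succ ns.
  by move=> t /cD; rewrite -splitr.
Qed.

End SpecialAverages.
End OverSchreier.
End Averages.

(** * Increasing sequences of indices *)

Lemma increasing_subsequence (P : nat -> Prop) :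
  (forall N, exists2 k, (N <= k)%N & P k) ->
  exists2 phi : nat -> nat, increasing_seq phi & forall j, P (phi j).
Proof.
move=> h; have /choice[g gP] : forall N, exists k, (N <= k)%N /\ P k.
  by move=> N; have [k ? ?] := h N; exists k.
pose phi := fix phi j := if j is j'.+1 then g (phi j').+1 else g 0%N.
exists phi; last by case=> [|j] /=; [case: (gP 0%N)|case: (gP (phi j).+1)].
by apply/increasing_seqP => j /=; case: (gP (phi j).+1).
Qed.

Lemma increasing_lt (phi : nat -> nat) i j : increasing_seq phi ->
  (i < j)%N -> (phi i < phi j)%N.
Proof.
move=> phi1 ij; have := phi1 j i; rewrite /Order.le /= => h.
by rewrite ltnNge h -ltnNge.
Qed.

Lemma increasing_comp (psi phi : nat -> nat) :
  increasing_seq psi -> increasing_seq phi -> increasing_seq (psi \o phi).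
Proof.
move=> psi1 phi1; apply/increasing_seqP => j /=.
by apply: increasing_lt => //; exact: increasing_lt.
Qed.

Lemma increasing_ge (phi : nat -> nat) j : increasing_seq phi -> (j <= phi j)%N.
Proof.
move=> phi1; elim: j => // j IH; apply: leq_ltn_trans IH _.
by apply: increasing_lt => //.
Qed.

(** * Norms mixing families along a Tsirelson space *)

Section TsirelsonNorm.
Context {R : realType}.

(* The norming set of the Tsirelson space of the admissibility family [A],
   positive functionals only; [q j] bounds the support of [f j] from below. *)
Inductive tsirelson (A : set {fset nat}) : (nat -> R) -> Prop :=
| tsirelson_zero : tsirelson A (fun=> 0)
| tsirelson_unit n : tsirelson A (fun m => (m == n)%:R)
| tsirelson_half (J : {fset nat}) (q : nat -> nat) (f : nat -> nat -> R) :
    A [fset q j | j in J] ->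
    {in J &, {homo q : i j / (i < j)%N}} ->
    (forall j, j \in J -> tsirelson A (f j)) ->
    (forall j m, j \in J -> f j m != 0 -> (q j <= m)%N) ->
    (forall j j' m, j \in J -> j' \in J -> f j m != 0 -> (j < j')%N -> (m < q j')%N) ->
    tsirelson A (fun m => 2^-1 * \sum_(j <- J) f j m).

Lemma sum_unique_le (J : {fset nat}) (F : nat -> R) (C : R) : 0 <= C ->
  (forall j, j \in J -> F j <= C) ->
  (forall i j, i \in J -> j \in J -> (i < j)%N -> F i != 0 -> F j != 0 -> False) ->
  \sum_(j <- J) F j <= C.
Proof.
move=> C0 FC uF.
have [/hasP[i iJ Fi]|/hasPn F0] := boolP (has (fun i => F i != 0) J).
  rewrite (big_fsetD1 i)//= big_seq big1 ?addr0; first exact: FC.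
  move=> j /fsetD1P[ij jJ]; apply/eqP; apply: contraT => Fj.
  by case: (ltngtP i j) ij => // [h|h] _; exfalso; [exact: (uF i j)|exact: (uF j i)].
by rewrite big_seq big1// => j /F0; rewrite negbK => /eqP.
Qed.

Lemma tsirelson_bound A f m : tsirelson A f -> 0 <= f m <= 1.
Proof.
move=> Af; elim: Af => {f} [|n|J q f _ qm _ IH fq fq'].
- by rewrite lexx ler01.
- by case: eqP; rewrite ?lexx ?ler01.
- apply/andP; split.
    by rewrite mulr_ge0 ?invr_ge0// big_seq sumr_ge0// => j /IH/andP[].
  rewrite -[leRHS]mulr1; apply: ler_pM => //.
  + by rewrite big_seq sumr_ge0// => j /IH/andP[].
  + by rewrite invf_le1// ler1n.
  + apply: sum_unique_le => // [j /IH/andP[]//|i j iJ jJ ij fi fj].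
    by have := leq_trans (fq' i j m iJ jJ fi ij) (fq j m jJ fj); rewrite ltnn.
Qed.

(** Used to cut a functional to an interval; the lower bounds [q j] stay valid when coordinates are
    erased. *)
Lemma tsirelson_mask A f (p : pred nat) : tsirelson A f ->
  tsirelson A (fun m => (p m)%:R * f m).
Proof.
move=> Af; elim: Af => {f} [|n|J q f AJ qm _ IH fq fq'].
- have -> : (fun m : nat => (p m)%:R * 0) = (fun=> 0) :> (nat -> R).
    by apply/funext => m; rewrite mulr0.
  exact: tsirelson_zero.
- case pn : (p n).
    have -> : (fun m : nat => (p m)%:R * (m == n)%:R) = (fun m => (m == n)%:R) :> (nat -> R).
      by apply/funext => m; case: eqVneq => [->|]; rewrite ?mulr0// pn mul1r.
    exact: tsirelson_unit.
  have -> : (fun m : nat => (p m)%:R * (m == n)%:R) = (fun=> 0) :> (nat -> R).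
    by apply/funext => m; case: eqVneq => [->|]; rewrite ?mulr0// pn mul0r.
  exact: tsirelson_zero.
- have -> : (fun m : nat => (p m)%:R * (2^-1 * \sum_(j <- J) f j m)) =
      (fun m => 2^-1 * \sum_(j <- J) ((p m)%:R * f j m)) :> (nat -> R).
    by apply/funext => m; rewrite mulrCA mulr_sumr.
  apply: tsirelson_half AJ qm IH _ _.
    by move=> j m jJ h; apply: fq => //; apply: contraNneq h => ->; rewrite mulr0.
  move=> j j' m jJ j'J h; apply: fq' => //; apply: contraNneq h => ->; rewrite mulr0.
  by [].
Qed.

Lemma sum_ord_le (n n' : nat) (G : nat -> R) : (forall i, 0 <= G i) -> (n <= n')%N ->
  \sum_(i < n) G i <= \sum_(i < n') G i.
Proof.
move=> G0 /subnK <-; elim: (n' - n)%N => // k IH.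
by rewrite addSn big_ord_recr /=; apply: le_trans IH _; rewrite lerDl.
Qed.

Section Intervals.
Variable q : nat -> nat.
Hypothesis qS : forall j, (q j < q j.+1)%N.

Lemma q_lt i j : (i < j)%N -> (q i < q j)%N.
Proof.
by move=> /subnK <-; elim: (j - i.+1)%N => [//|k IH]; rewrite addSn; apply: ltn_trans IH _.
Qed.

Lemma q_le i j : (i <= j)%N -> (q i <= q j)%N.
Proof. by rewrite leq_eqVlt => /predU1P[->//|/q_lt/ltnW]. Qed.

Lemma q_ge j : (j <= q j)%N.
Proof. by elim: j => // j IH; exact: leq_ltn_trans IH (qS j). Qed.

(** The default covers [n < q 0], where no functional of the blocks is supported. *)
Definition qidx n : nat := xget 0%N [set j | (q j <= n < q j.+1)%N].

Lemma qidxE j n : (q j <= n < q j.+1)%N -> qidx n = j.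
Proof.
move=> jn; have := @xgetI _ 0%N [set j | (q j <= n < q j.+1)%N] j jn.
rewrite /= -/(qidx n); move: jn => /andP[j1 j2] /andP[h1 h2].
case: (ltngtP (qidx n) j) => // h; exfalso.
  by have := leq_trans h2 (leq_trans (q_le h) j1); rewrite ltnn.
by have := leq_trans j2 (leq_trans (q_le h) h1); rewrite ltnn.
Qed.

End Intervals.

Section Functionals.
Variables (kappa : choiceType) (A : set {fset nat}) (F : nat -> set {fset kappa}).
Hypotheses (Fher : forall n, hereditary (F n)) (F0 : forall n, F n fset0)
  (Fsing : forall i, F 0%N [fset i]).

Implicit Types (x y : kappa -> R) (t : {fset kappa}) (u : nat -> kappa -> R).

Definition seg t x : R := \sum_(i <- t) `|x i|.

Lemma seg_ge0 t x : 0 <= seg t x.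
Proof. exact: sumr_ge0. Qed.

Lemma seg_mono t x y : (forall i, i \in t -> `|x i| <= `|y i|) -> seg t x <= seg t y.
Proof. by move=> xy; rewrite /seg big_seq [leRHS]big_seq; apply: ler_sum. Qed.

Lemma seg_triangle t x y : seg t (fun i => x i + y i) <= seg t x + seg t y.
Proof. by rewrite -big_split; apply: ler_sum => i _; exact: ler_normD. Qed.

Lemma seg_scale t c x : seg t (fun i => c * x i) = `|c| * seg t x.
Proof. by rewrite mulr_sumr; apply: eq_bigr => i _; rewrite normrM. Qed.

Lemma seg_subset (s t : {fset kappa}) x : s `<=` t -> seg s x <= seg t x.
Proof.
move=> st; rewrite /seg -[t](fsetID s) sum_fsetU.
  by rewrite (fsetIidPr st) lerDl sumr_ge0.
by move=> i; rewrite in_fsetI in_fsetD => /andP[_ ->].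
Qed.

(** The length [fun_n] truncates the sum, so that a seminorm depends on finitely many coordinates;
    semicontinuity of the norm and completeness rest on this. *)
Record functional := Functional {
  fun_w : nat -> R ;
  fun_t : nat -> {fset kappa} ;
  fun_n : nat ;
  fun_wA : tsirelson A fun_w ;
  fun_tF : forall n, F n (fun_t n) }.

Definition pnorm (l : functional) (x : kappa -> R) : R :=
  \sum_(n < fun_n l) fun_w l n / 2 ^+ n * seg (fun_t l n) x.

Lemma weight_ge0 (l : functional) n : 0 <= fun_w l n / 2 ^+ n.
Proof.
by rewrite divr_ge0 ?exprn_ge0//; have /andP[] := tsirelson_bound n (fun_wA l).
Qed.

Lemma pnorm_ge0 l x : 0 <= pnorm l x.
Proof. by apply: sumr_ge0 => n _; rewrite mulr_ge0 ?weight_ge0 ?seg_ge0. Qed.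

Lemma pnorm_mono l x y : (forall i, `|x i| <= `|y i|) -> pnorm l x <= pnorm l y.
Proof.
move=> xy; apply: ler_sum => n _; apply: ler_wpM2l; first exact: weight_ge0.
by apply: seg_mono => i _; exact: xy.
Qed.

Lemma pnorm_triangle l x y : pnorm l (fun i => x i + y i) <= pnorm l x + pnorm l y.
Proof.
rewrite -big_split /=; apply: ler_sum => n _; rewrite -mulrDr.
by apply: ler_wpM2l; [exact: weight_ge0|exact: seg_triangle].
Qed.

Lemma pnorm_scale l c x : pnorm l (fun i => c * x i) = `|c| * pnorm l x.
Proof. by rewrite mulr_sumr; apply: eq_bigr => n _; rewrite seg_scale mulrCA. Qed.

Lemma geometric_le n : \sum_(i < n) (2 ^+ i)^-1 <= 2 :> R.
Proof.
suff : \sum_(i < n) (2 ^+ i)^-1 = 2 - 2 / 2 ^+ n :> R.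
  by move=> ->; rewrite gerBl divr_ge0 ?exprn_ge0.
elim: n => [|n IH]; first by rewrite big_ord0 expr0 divr1 subrr.
have h : (2 ^+ n : R) != 0 by rewrite expf_neq0.
rewrite big_ord_recr /= IH exprS invfM mulrA divff// mul1r.
by rewrite -addrA; congr (_ + _); lra.
Qed.

Lemma pnorm_unit l i : pnorm l (fun j => (j == i)%:R) <= 2.
Proof.
apply: le_trans (geometric_le (fun_n l)); apply: ler_sum => n _.
rewrite -[leRHS]mulr1; apply: ler_pM; rewrite ?weight_ge0 ?seg_ge0//.
  rewrite -[leRHS]mul1r; apply: ler_wpM2r; first by rewrite invr_ge0 exprn_ge0.
  by have /andP[] := tsirelson_bound n (fun_wA l).
have [it|it] := boolP (i \in fun_t l n).
  rewrite /seg (big_fsetD1 i)//= eqxx normr1 big_seq big1 ?addr0//.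
  by move=> j /fsetD1P[/negbTE ->]; rewrite normr0.
rewrite /seg big_seq big1// => j jt; case: eqVneq => [ji|]; rewrite ?normr0//.
by rewrite -ji jt in it.
Qed.

Lemma pnorm_local l : exists B : {fset kappa}, forall x y,
  (forall i, i \in B -> x i = y i) -> pnorm l x = pnorm l y.
Proof.
exists (\bigcup_(n <- iota 0 (fun_n l)) fun_t l n) => x y xy.
apply: eq_bigr => n _; congr (_ * _); rewrite /seg big_seq [RHS]big_seq.
apply: eq_bigr => i it; rewrite xy//; apply/bigfcupP; exists (n : nat) => //.
by rewrite mem_iota /= add0n ltn_ord.
Qed.

(** The unit functionals make each family [F n] visible by itself, up to the factor [2 ^- n]. *)
Lemma pnorm_single n t : F n t -> exists l, forall x, pnorm l x = seg t x / 2 ^+ n.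
Proof.
move=> Ft; pose tt m := if m == n then t else fset0.
have ttF m : F m (tt m) by rewrite /tt; case: eqP => [->|].
exists (Functional n.+1 (tsirelson_unit A n) ttF) => x.
rewrite /pnorm /= big_ord_recr /= eqxx big1 ?add0r; first by rewrite /tt eqxx mul1r mulrC.
by move=> m _; rewrite (ltn_eqF (ltn_ord m)) !mul0r.
Qed.

Lemma pnorm_pos i : exists l, 0 < pnorm l (fun j => (j == i)%:R).
Proof.
have [l hl] := pnorm_single (Fsing i); exists l.
by rewrite hl /seg big_seq_fset1 eqxx normr1 divr_gt0.
Qed.

Definition comb (s : {fset nat}) (c : nat -> R) u : kappa -> R :=
  fun i => \sum_(k <- s) c k * u k i.

Lemma pnorm_comb l s c u (M : R) : average s c -> (forall k, pnorm l (u k) <= M) ->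
  pnorm l (comb s c u) <= M.
Proof.
move=> sc uM; apply: le_trans (average_le sc (fun k _ => uM k)).
rewrite /comb; elim: (s : seq nat) => [|k s' IH].
  have -> : pnorm l (fun i => \sum_(k <- [::]) c k * u k i) = 0; last by rewrite big_nil.
  rewrite /pnorm big1// => n _; rewrite [seg _ _]big1 ?mulr0// => i _.
  by rewrite big_nil normr0.
rewrite big_cons; under eq_fun do rewrite big_cons.
apply: le_trans (pnorm_triangle _ _ _) _; apply: lerD => //.
by rewrite pnorm_scale ger0_norm//; case: sc.
Qed.

Section Disjoint.
Variables (u : nat -> kappa -> R) (B : nat -> {fset kappa}).
Hypotheses (Bd : forall k l i, i \in B k -> i \in B l -> k = l)
  (uB : forall k i, u k i != 0 -> i \in B k).

Lemma u_out k i : i \notin B k -> u k i = 0.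
Proof. by move=> iB; apply/eqP; apply: contraNT iB => /uB. Qed.

Lemma comb_at (phi : nat -> nat) s c k i : injective phi -> k \in s ->
  i \in B (phi k) -> comb s c (u \o phi) i = c k * u (phi k) i.
Proof.
move=> phi_inj ks ik; rewrite /comb (big_fsetD1 k)//= big_seq big1 ?addr0//.
move=> j /fsetD1P[jk js]; rewrite u_out ?mulr0//; apply/negP => ij.
by move: jk; rewrite (phi_inj _ _ (Bd ij ik)) eqxx.
Qed.

Lemma comb_ge (phi : nat -> nat) s c k i : injective phi -> k \in s ->
  `|c k * u (phi k) i| <= `|comb s c (u \o phi) i|.
Proof.
move=> phi_inj ks; have [iB|iB] := boolP (i \in B (phi k)).
  by rewrite (@comb_at phi s c k).
by rewrite u_out// mulr0 normr0.
Qed.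

Hypothesis Aspread : spreadable A.
Hypothesis CL : forall n (s : nat -> {fset kappa}), (forall k, F n (s k)) ->
  exists2 phi : nat -> nat, increasing_seq phi &
    forall x : {fset nat}, A x -> F n.+1 (\bigcup_(k <- x) s (phi k)).

Let l1_lower := exists2 phi : nat -> nat, increasing_seq phi &
  exists2 C : R, 0 < C & forall s c, A s ->
    exists l, C * (\sum_(k <- s) `|c k|) <= pnorm l (comb s c (u \o phi)).

Lemma increasing_inj (phi : nat -> nat) : increasing_seq phi -> injective phi.
Proof.
move=> h i j e; apply/eqP; rewrite eqn_leq.
by have := h i j; have := h j i; rewrite e lexx => <- <-.
Qed.

(** Each test is first cut to its own block, so that the union given by [CL] adds up the blocks
    without interference. The union lies in [F n.+1], whence the constant [e / 2 ^+ n.+1]. *)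
Lemma l1_from_segments n (e : R) : 0 < e ->
  (forall N, exists2 k, (N <= k)%N & exists2 t, F n t & e <= seg t (u k)) -> l1_lower.
Proof.
move=> e0 /increasing_subsequence[psi psi1 hpsi].
have /choice[t ht] : forall j, exists t, F n t /\ e <= seg t (u (psi j)).
  by move=> j; have [t ? ?] := hpsi j; exists t.
pose t' j := t j `&` B (psi j).
have Ft' j : F n (t' j).
  by have [Ft _] := ht j; apply: (Fher Ft); exact: fsubsetIl.
have [phi phi1 hphi] := CL Ft'.
have inc : increasing_seq (psi \o phi) by exact: increasing_comp.
exists (psi \o phi) => //; exists (e / 2 ^+ n.+1); first by rewrite divr_gt0 ?exprn_gt0.
move=> s c As; have [l hl] := pnorm_single (hphi s As).
exists l; rewrite hl mulrAC ler_pM2r ?invr_gt0 ?exprn_gt0//.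
have -> : seg (\bigcup_(k <- s) t' (phi k)) (comb s c (u \o (psi \o phi))) =
    \sum_(k <- s) seg (t' (phi k)) (comb s c (u \o (psi \o phi))).
  have dj k k2 i : i \in B (psi (phi k)) -> i \in B (psi (phi k2)) -> k = k2.
    by move=> ik il; apply: (increasing_inj inc); exact: Bd ik il.
  elim: (s : seq nat) (fset_uniq s) => [|k s' IH] /=.
    by rewrite /seg !big_nil.
  move=> /andP[ks us]; rewrite !big_cons /seg sum_fsetU.
    by congr (_ + _); exact: IH.
  move=> i; rewrite in_fsetI => /andP[_ ik] /bigfcupP[j /andP[js _]].
  by rewrite in_fsetI => /andP[_ ij]; rewrite (dj _ _ _ ik ij) js in ks.
rewrite mulr_sumr big_seq [leRHS]big_seq; apply: ler_sum => k ks.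
have -> : seg (t' (phi k)) (comb s c (u \o (psi \o phi))) =
    `|c k| * seg (t' (phi k)) (u (psi (phi k))).
  rewrite -seg_scale; apply: eq_big_seq => i.
  by rewrite in_fsetI => /andP[_ ik]; rewrite (@comb_at (psi \o phi) s c k)//; exact: increasing_inj.
rewrite mulrC; apply: ler_wpM2l => //.
have [_ h] := ht (phi k); apply: (le_trans h).
rewrite /t' -[in leLHS](fsetID (B (psi (phi k))) (t (phi k))) /seg sum_fsetU; last first.
  by move=> i; rewrite in_fsetI in_fsetD => /andP[_ ->].
rewrite [X in _ + X]big_seq [X in _ + X]big1 ?addr0// => i /fsetDP[_ iB].
by rewrite u_out// normr0.
Qed.

Section Spread.
Variable d : R.
Hypotheses (d0 : 0 < d) (big : forall k, exists l, d <= pnorm l (u k)).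
Hypothesis small : forall n (e : R), 0 < e ->
  exists N, forall k, (N <= k)%N -> forall t, F n t -> seg t (u k) <= e.

(** For large [k] each of the first [q] families sees at most [d / 4] of [u k]; as the weights sum
    to at most 2, at least half of the norm remains on the coordinates in [[q, q')]. *)
Lemma block_step q N : exists kf : nat * (nat -> R) * (nat -> {fset kappa}) * nat,
  let: (k, f, ts, q') := kf in
  [/\ (N <= k)%N /\ (q < q')%N, tsirelson A f,
      forall m, f m != 0 -> (q <= m < q')%N, forall n, F n (ts n) &
      d / 2 <= \sum_(n < q') f n / 2 ^+ n * seg (ts n) (u k)].
Proof.
have d4 : 0 < d / 4 by rewrite divr_gt0.
have [N' hN'] : exists N', forall k, (N' <= k)%N -> forall n, (n < q)%N ->
    forall t, F n t -> seg t (u k) <= d / 4.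
  elim: q => [|q' [N1 h1]]; first by exists 0%N.
  have [N2 h2] := small q' d4; exists (maxn N1 N2) => k.
  rewrite geq_max => /andP[k1 k2] n; rewrite ltnS leq_eqVlt => /predU1P[->|nq].
    exact: h2.
  exact: h1.
pose k := maxn N N'; have [l hl] := big k.
pose q' := maxn (fun_n l) q.+1.
pose f m := (q <= m < q')%:R * fun_w l m.
exists (k, f, fun_t l, q'); split.
- by split; [exact: leq_maxl|exact: leq_maxr].
- exact: tsirelson_mask (fun_wA l).
- by move=> m; rewrite /f; case: (_ && _) => //; rewrite mul0r eqxx.
- exact: fun_tF.
- have f0 n : 0 <= f n / 2 ^+ n * seg (fun_t l n) (u k).
    rewrite /f -mulrA -mulrA mulr_ge0 ?ler0n// mulrA mulr_ge0 ?seg_ge0//.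
    exact: weight_ge0.
  apply: le_trans (sum_ord_le f0 (leq_maxl _ _ : (fun_n l <= q')%N)).
  have : pnorm l (u k) <= \sum_(n < fun_n l) f n / 2 ^+ n * seg (fun_t l n) (u k) +
      \sum_(n < fun_n l) (2 ^+ n)^-1 * (d / 4).
    rewrite -big_split; apply: ler_sum => n _ /=; rewrite /f.
    have [qn|nq] := leqP q n.
      have -> : (n < q')%N by apply: (leq_trans (ltn_ord n)); exact: leq_maxl.
      by rewrite mul1r lerDl mulr_ge0 ?invr_ge0 ?exprn_ge0// ltW.
    rewrite !mul0r add0r -mulrA mulrC -mulrA.
    have [w0 w1] := andP (tsirelson_bound n (fun_wA l)).
    apply: ler_wpM2l; first by rewrite invr_ge0 exprn_ge0.
    rewrite -[leRHS]mulr1; apply: ler_pM => //; first exact: seg_ge0.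
    by apply: (hN' k _ n nq); [exact: leq_maxr|exact: fun_tF].
  rewrite -mulr_suml => h; have := geometric_le (fun_n l).
  move=> /(ler_wpM2r (ltW d4)) h2; have := le_trans hl h.
  by move: h2; set X := \sum_(_ < _) _; set Y := _ * _; lra.
Qed.

Lemma l1_from_blocks : l1_lower.
Proof.
have /choice[g hg] : forall qN : nat * nat, exists kf : nat * (nat -> R) * (nat -> {fset kappa}) * nat,
  let: (k, f, ts, q') := kf in
  [/\ (qN.2 <= k)%N /\ (qN.1 < q')%N, tsirelson A f,
      forall m, f m != 0 -> (qN.1 <= m < q')%N, forall n, F n (ts n) &
      d / 2 <= \sum_(n < q') f n / 2 ^+ n * seg (ts n) (u k)].
  by move=> [q N]; exact: block_step.
(* The state holds the start of the next interval and a lower bound for the next index. *)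
pose st := fix st j := if j is j'.+1 then ((g (st j')).2, (g (st j')).1.1.1.+1) else (0%N, 0%N).
pose q j := (st j).1; pose phi j := (g (st j)).1.1.1.
pose f j := (g (st j)).1.1.2; pose ts j := (g (st j)).1.2.
have hst j : [/\ ((st j).2 <= phi j)%N /\ (q j < q j.+1)%N, tsirelson A (f j),
      forall m, f j m != 0 -> (q j <= m < q j.+1)%N, forall n, F n (ts j n) &
      d / 2 <= \sum_(n < q j.+1) f j n / 2 ^+ n * seg (ts j n) (u (phi j))].
  have := hg (st j); rewrite /q /phi /f /ts /=.
  by case: (g (st j)) => [[[? ?] ?] ?].
have qS j : (q j < q j.+1)%N by case: (hst j) => -[].
have phi1 : increasing_seq phi.
  by apply/increasing_seqP => j; case: (hst j.+1) => -[].
exists phi => //; exists (d / 4); first by rewrite divr_gt0.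
move=> s c As; have [p hp] := fset_bounded s.
have AJ : A [fset q j | j in s].
  apply: Aspread As _ _ => [i j _ _|j _]; [exact: q_lt|exact: q_ge].
have wA : tsirelson A (fun m => 2^-1 * \sum_(j <- s) f j m).
  apply: (@tsirelson_half A s q f) => //.
  - by move=> i j _ _; exact: q_lt.
  - by move=> j _; case: (hst j).
  - by move=> j m _; case: (hst j) => _ _ h _ _ /h/andP[].
  - move=> j j' m _ _; case: (hst j) => _ _ h _ _ /h/andP[_ mq] jj'.
    by apply: (leq_trans mq); exact: q_le.
(* A functional has one test per coordinate. The intervals are disjoint, so coordinate [n] can use
   the test of the block whose interval contains it. *)
have tF n : F n (ts (qidx q n) n) by case: (hst (qidx q n)).
exists (Functional (q p) wA tF); rewrite /pnorm /=.
have phi_inj := increasing_inj phi1.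
have -> : \sum_(n < q p) 2^-1 * (\sum_(j <- s) f j n) / 2 ^+ n *
      seg (ts (qidx q n) n) (comb s c (u \o phi)) =
    2^-1 * \sum_(j <- s) \sum_(n < q p) f j n / 2 ^+ n *
      seg (ts (qidx q n) n) (comb s c (u \o phi)).
  rewrite exchange_big mulr_sumr; apply: eq_bigr => n _ /=.
  by rewrite -!mulr_suml !mulrA.
have -> : d / 4 * (\sum_(k <- s) `|c k|) = 2^-1 * \sum_(k <- s) (`|c k| * (d / 2)).
  by rewrite -mulr_suml; set X := \sum_(_ <- _) _; lra.
rewrite ler_pM2l ?invr_gt0// big_seq [leRHS]big_seq; apply: ler_sum => j js.
have f0 n : 0 <= f j n / 2 ^+ n.
  case: (hst j) => _ /(tsirelson_bound n)/andP[h _] _ _ _.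
  by rewrite divr_ge0 ?exprn_ge0.
apply: (@le_trans _ _ (\sum_(n < q j.+1) f j n / 2 ^+ n *
      seg (ts (qidx q n) n) (comb s c (u \o phi)))); last first.
  apply: (@sum_ord_le _ _ (fun n => f j n / 2 ^+ n *
      seg (ts (qidx q n) n) (comb s c (u \o phi)))).
    by move=> n; rewrite mulr_ge0 ?seg_ge0.
  by apply: q_le => //; exact: hp.
have [_ _ fsupp _ hd] := hst j.
apply: (le_trans (ler_wpM2l (normr_ge0 _) hd)); rewrite mulr_sumr.
apply: ler_sum => n _; rewrite mulrCA.
have [->|fn] := eqVneq (f j n) 0; first by rewrite !mul0r.
apply: ler_wpM2l => //; rewrite (qidxE qS (fsupp _ fn)) -seg_scale.
by apply: seg_mono => i _; exact: comb_ge.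
Qed.

End Spread.

Lemma disjoint_l1 d : 0 < d -> (forall k, exists l, d <= pnorm l (u k)) -> l1_lower.
Proof.
move=> d0 big; have [small|nsmall] := pselect (forall n (e : R), 0 < e ->
    exists N, forall k, (N <= k)%N -> forall t, F n t -> seg t (u k) <= e).
  exact: l1_from_blocks d0 big small.
have [n /existsNP[e /not_implyP[e0 /forallNP h]]] : exists n, ~ forall e : R, 0 < e ->
    exists N, forall k, (N <= k)%N -> forall t, F n t -> seg t (u k) <= e.
  exact/existsNP.
apply: (@l1_from_segments n e) => // N.
have /existsNP[k /not_implyP[Nk /existsNP[t /not_implyP[Ft /negP]]]] := h N.
by rewrite -ltNge => /ltW ht; exists k => //; exists t.
Qed.

End Disjoint.
End Functionals.
End TsirelsonNorm.

(** * Averages of small norm *)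

Section Flat.
Context {R : realType} (S : omega1 -> set {fset nat}) (kappa : choiceType).
Variables (F : nat -> set {fset kappa}) (a L : omega1).
Hypotheses (HS : is_schreier_sequence S) (a1 : (oone <= a)%O) (Llim : is_limit L).
Hypotheses (F0 : forall n, F n fset0) (Fcl : forall n, closed (in_cube (F n)))
  (Fcb : forall n, exists2 b, (b < L)%O & cantor_bendixson (in_cube (F n)) b = set0).
Variables (u : nat -> kappa -> R) (B : nat -> {fset kappa}) (M : R).
Hypotheses (Bd : forall k l i, i \in B k -> i \in B l -> k = l)
  (uB : forall k i, u k i != 0 -> i \in B k) (M0 : 0 < M)
  (uM : forall k (l : functional (R:=R) (S a) F), pnorm l (u k) <= M).

Lemma seg_le n t k : F n t -> seg t (u k) <= 2 ^+ n * M.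
Proof.
move=> Ft; have [l hl] := @pnorm_single R _ (S a) F F0 _ _ Ft.
by have := uM k l; rewrite hl ler_pdivrMr ?exprn_gt0// mulrC.
Qed.

Lemma seg_comb_le (v : nat -> kappa -> R) t s c : average s c ->
  seg t (comb s c v) <= \sum_(k <- s) c k * seg t (v k).
Proof.
move=> [c0 _]; rewrite /seg /comb; under [leRHS]eq_bigr do rewrite mulr_sumr.
rewrite exchange_big; apply: ler_sum => i _; apply: le_trans (ler_norm_sum _ _ _) _.
by apply: ler_sum => k _; rewrite normrM (ger0_norm (c0 k)).
Qed.

(** Finitely many families are merged into one compact set; its rank is their maximum, still below
    the limit [L], so one average serves all of them. *)
Lemma small_average (e : R) m q : 0 < e -> exists s c,
  [/\ S L s, tail_ge m s, average s c &
   forall n t, (n < q)%N -> F n t -> seg t (comb s c u) <= e].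
Proof.
move=> e0.
have [K [b [bL cK KE Kb finK]]] : exists (K : set (cube kappa)) b, [/\ (b < L)%O, closed K,
    forall n t, (n < q)%N -> F n t -> K (chi t),
    cantor_bendixson K b = set0 & forall x, K x -> exists n t, [/\ (n < q)%N, F n t & x = chi t]].
  elim: q => [|q [K [b [bL cK KE Kb finK]]]].
    exists set0, ozero; split => //; first exact: limit_gt0.
      exact: closed0.
    by apply/seteqP; split=> // x /cb_sub.
  have [b' b'L Fb'] := Fcb q.
  exists (K `|` in_cube (F q))%classic, (Order.max b b'); split.
  - by rewrite gt_max bL.
  - exact: closedU.
  - move=> n t; rewrite ltnS leq_eqVlt => /predU1P[->|nq] Ft.
      by right; exact/in_cube_chi.
    by left; exact: KE nq Ft.
  - apply/seteqP; split=> // x /(cb_union cK (@Fcl q))[xb|xb].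
      by rewrite -Kb; apply: cb_le xb; rewrite le_max lexx.
    by rewrite -Fb'; apply: cb_le xb; rewrite le_max lexx orbT.
  - move=> x [/finK[n [t [nq Ft xt]]]|/in_cubeP[t Ft xt]].
      by exists n, t; split => //; exact: leqW.
    by exists q, t; split => //; apply/funext.
(* The extension of [seg t (u k)] from finite sets [t] to all points of the cube. *)
pose phi k (x : cube kappa) : R := \sum_(i <- B k) `|u k i| * (x i)%:R.
have phi_chi k t : phi k (chi t) = seg t (u k).
  rewrite /phi /seg.
  have -> : \sum_(i <- B k) `|u k i| * (chi t i)%:R = \sum_(i <- B k `&` t) `|u k i|.
    rewrite -(big_fset_incl _ (fsubsetIl (B k) t)); last first.
      by move=> i iB; rewrite in_fsetI iB /= /chi => /negbTE ->; rewrite mulr0.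
    by apply: eq_big_seq => i; rewrite in_fsetI /chi => /andP[_ ->]; rewrite mulr1.
  rewrite -(big_fset_incl _ (fsubsetIr (B k) t))// => i it.
  rewrite in_fsetI it andbT => iB; apply/eqP; rewrite normr_eq0.
  by apply: contraNT iB; exact: uB.
have phiB k x : phi k x != 0 -> exists2 i, i \in B k & x i.
  move=> h; apply: contrapT => nx; move: h; rewrite /phi big_seq big1 ?eqxx// => i iB.
  by case xi : (x i); rewrite ?mulr0//; case: nx; exists i.
have phiD k x : K x -> 0 <= phi k x <= 2 ^+ q * M.
  move=> /finK[n [t [nq Ft ->]]]; rewrite phi_chi seg_ge0/=.
  apply: le_trans (seg_le k Ft) _; rewrite ler_pM2r// ler_weXn2l ?ler1n//; exact: ltnW.
have [k hk] := schreier_tail HS (ltW bL).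
have finK' x : K x -> exists s : {fset kappa}, x = chi s.
  by move=> /finK[n [t [_ _ ->]]]; exists t.
have [s [c [Ss ms sc sD]]] := cb_average HS Bd phiB (maxn m k) cK finK' phiD Kb e0.
exists s, c; split => //.
- by apply: hk => //; apply: tail_geW ms; exact: leq_maxr.
- by apply: tail_geW ms; exact: leq_maxl.
- move=> n t nq Ft; apply: le_trans (seg_comb_le _ t sc) _.
  have := sD _ (KE n t nq Ft); under eq_bigr do rewrite phi_chi.
  exact.
Qed.

Record block := Block {
  bl_s : {fset nat} ;
  bl_c : nat -> R ;
  bl_q : nat ;
  bl_z : nat -> R ;
  bl_e : nat -> R }.

(* Up to a summable error, the vector [n |-> sup_t seg t w / 2 ^ n] of the
   average [w] is a block [z] of the Tsirelson space past [q], of norm at most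
   [D]. *)
Definition flat_block (d : omega1) (D e : R) (m q : nat) (X : block) : Prop :=
  [/\ S d (bl_s X) /\ tail_ge m (bl_s X), average (bl_s X) (bl_c X),
      (forall n, 0 <= bl_z X n) /\ (forall n, bl_z X n != 0 -> (q <= n < bl_q X)%N),
      forall f N, tsirelson (S a) f -> \sum_(n < N) f n * bl_z X n <= D &
      [/\ forall n, 0 <= bl_e X n, forall N, \sum_(n < N) bl_e X n <= e &
      forall n t, F n t ->
        seg t (comb (bl_s X) (bl_c X) u) / 2 ^+ n <= bl_z X n + bl_e X n]].

Definition flat (d : omega1) (D : R) : Prop :=
  forall (e : R) m q, 0 < e -> exists X, flat_block d D e m q X.

Lemma geometric_tail (T : R) q N : 0 <= T ->
  \sum_(n < N) (if (n < q)%N then 0 else T / 2 ^+ n) <= 2 * T / 2 ^+ q.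
Proof.
move=> T0; have T2 n : 0 <= 2 * T / 2 ^+ n by rewrite divr_ge0 ?exprn_ge0// mulr_ge0.
suff : \sum_(n < N) (if (n < q)%N then 0 else T / 2 ^+ n) <=
    2 * T / 2 ^+ q - (if (N <= q)%N then 2 * T / 2 ^+ q else 2 * T / 2 ^+ N).
  move=> /le_trans; apply; case: ifP => _; first by rewrite subrr.
  by rewrite gerBl.
elim: N => [|N IH]; first by rewrite big_ord0 leq0n subrr.
rewrite big_ord_recr /=; apply: le_trans (lerD IH (lexx _)) _.
case: (ltngtP N q) => [Nq|qN|->]; first by rewrite addr0.
  rewrite exprS invfM; have -> : 2 * T * (2^-1 * (2 ^+ N)^-1) = T / 2 ^+ N.
    by rewrite mulrACA divff// mul1r.
  by rewrite -mulrA; set X := T / _; lra.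
rewrite exprS invfM; have -> : 2 * T * (2^-1 * (2 ^+ q)^-1) = T / 2 ^+ q.
  by rewrite mulrACA divff// mul1r.
by rewrite -mulrA; set X := T / _; lra.
Qed.

Lemma pow2_gt (T e : R) : 0 < e -> exists n : nat, T / 2 ^+ n <= e.
Proof.
move=> e0; exists (Num.bound `|T / e|).
rewrite ler_pdivrMr ?exprn_gt0// mulrC -ler_pdivrMr//.
apply: (le_trans (ler_norm _)); apply: ltW; apply: (lt_trans (archi_boundP (normr_ge0 _))).
by rewrite -natrX ltr_nat ltn_expl.
Qed.

(** [z] records nearly optimal tests for the average on [[q, q')]. A Tsirelson functional applied to
    [z] is dominated by the seminorm built from it and these tests, hence by [M]. *)
Lemma flat_base : flat L M.
Proof.
move=> e m q e0; have e8 : 0 < e / 8 by rewrite divr_gt0.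
have e4 : 0 < e / 4 by rewrite divr_gt0.
have [s [c [Ss ms sc small]]] := small_average m q e8.
pose w := comb s c u; pose T := seg (\bigcup_(k <- s) B k) w.
have wT t : seg t w <= T.
  have : seg t w = seg (t `&` \bigcup_(k <- s) B k) w.
    rewrite /seg -(big_fset_incl _ (fsubsetIl t (\bigcup_(k <- s) B k)))// => i it.
    rewrite in_fsetI it /= => iB; apply/eqP; rewrite normr_eq0 /w /comb big_seq big1// => k ks.
    have : i \notin B k by apply: contra iB => iB; apply/bigfcupP; exists k; rewrite ?ks.
    by move=> /(contraNN (@uB k i)); rewrite negbK => /eqP ->; rewrite mulr0.
  by move=> ->; apply: seg_subset; exact: fsubsetIr.
have T0 : 0 <= T := seg_ge0 _ _.
have /choice[t ht] : forall n, exists t, F n t /\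
    forall t', F n t' -> seg t' w <= seg t w + e / 8.
  move=> n; pose E : set R := [set x | exists2 t, F n t & x = seg t w].
  have supE : has_sup E.
    split; first by exists (seg fset0 w), fset0.
    by exists T => _ [t _ ->]; exact: wT.
  have [_ [t Ft ->] ht] := sup_adherent e8 supE; exists t; split => // t' Ft'.
  rewrite -lerBlDr; apply: ltW; apply: le_lt_trans ht; rewrite lerD2r.
  by apply: (ub_le_sup (proj2 supE)); exists t'.
have [q'0 hq'] := pow2_gt (2 * T) e4.
pose q' := maxn q q'0.
pose z n := if (q <= n < q')%N then seg (t n) w / 2 ^+ n else 0.
(* The first term pays for the coordinates below [q] and for the near optimality, at most [e / 4] in
   all; the second pays for those past [q'], again at most [e / 4]. *)
pose err n : R := (2 ^+ n)^-1 * (e / 8) + (if (n < q')%N then 0 else T / 2 ^+ n).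
exists (Block s c q' z err); split => //=.
- split=> n; rewrite /z; case: ifP => //; rewrite ?eqxx//.
  by rewrite divr_ge0 ?seg_ge0 ?exprn_ge0.
- move=> f N Af.
  have tF n : F n (t n) by case: (ht n).
  apply: le_trans (@pnorm_comb R _ _ _ (Functional N Af tF) _ _ _ _ sc (fun k => uM k _)).
  rewrite /pnorm /=; apply: ler_sum => n _; rewrite -/w.
  have /andP[f0 _] := tsirelson_bound n Af.
  have h : 0 <= f n / 2 ^+ n * seg (t n) w.
    by rewrite mulr_ge0 ?seg_ge0// divr_ge0 ?exprn_ge0.
  rewrite /z; case: ifP => _; last by rewrite mulr0.
  by rewrite mulrA mulrAC.
- have err0 n : 0 <= err n.
    rewrite addr_ge0//; first by rewrite mulr_ge0 ?invr_ge0 ?exprn_ge0// ltW.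
    by case: ifP => // _; rewrite divr_ge0 ?exprn_ge0.
  split=> //.
    move=> N; rewrite big_split /= -mulr_suml.
    have h1 := ler_wpM2r (ltW e8) (geometric_le (R := R) N).
    have h2 := geometric_tail q' N T0.
    have h3 : 2 * T / 2 ^+ q' <= e / 4.
      apply: le_trans hq'; apply: ler_wpM2l; first by rewrite mulr_ge0.
      by rewrite lef_pV2 ?posrE ?exprn_gt0// ler_weXn2l ?ler1n// leq_maxr.
    by apply: le_trans (lerD h1 (le_trans h2 h3)) _; lra.
  move=> n t' Ft'; rewrite -/w; have p0 : 0 <= (2 ^+ n : R)^-1 by rewrite invr_ge0 exprn_ge0.
  have [nq|qn] := ltnP n q.
    apply: (@le_trans _ _ ((2 ^+ n)^-1 * (e / 8))).
      by rewrite mulrC; apply: ler_wpM2l => //; exact: (small n t' nq Ft').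
    rewrite /err; have -> : z n = 0 by rewrite /z leqNgt nq.
    by rewrite add0r lerDl; case: ifP => // _; rewrite divr_ge0 ?exprn_ge0.
  rewrite /z /err qn /=; case: ifP => nq'.
    by rewrite addr0 mulrC [_ / 2 ^+ n]mulrC -mulrDr; apply: ler_wpM2l => //; case: (ht n) => _; exact.
  rewrite add0r; apply: (@le_trans _ _ (T / 2 ^+ n)); first exact: ler_wpM2r.
  by rewrite lerDr mulr_ge0// ltW.
Qed.

Lemma sum_sub (s t : {fset nat}) (G : nat -> R) : s `<=` t ->
  \sum_(k <- t) (k \in s)%:R * G k = \sum_(k <- s) G k.
Proof.
move=> st; rewrite -(big_fset_incl _ st); last by move=> k _ /negbTE ->; rewrite mul0r.
by apply: eq_big_seq => k ->; rewrite mul1r.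
Qed.

Lemma unit_sum n N (G : nat -> R) : (n < N)%N ->
  \sum_(i < N) (val i == n)%:R * G i = G n.
Proof.
move=> nN; rewrite (bigD1 (Ordinal nN))//= eqxx mul1r big1 ?addr0// => i ni.
by case: eqP => [e|_]; rewrite ?mul0r//; case/eqP: ni; exact/val_inj.
Qed.

Lemma unit_sum_le n N (G : nat -> R) : (forall k, 0 <= G k) ->
  \sum_(i < N) (val i == n)%:R * G i <= G n.
Proof.
move=> G0; have [nN|Nn] := ltnP n N; first by rewrite unit_sum.
rewrite big1// => i _; case: eqP => [e|_]; last by rewrite mul0r.
by have := ltn_ord i; rewrite e ltnNge Nn.
Qed.

(* A functional [1/2 sum f_i] splits few of the blocks, by the choice of the
   averages, and pays only half the norm of the other ones. *)
Lemma flat_step d D : 0 <= D -> flat d D -> flat (osucc (oadd d a)) (3 / 4 * D).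
Proof.
move=> D0 fl e m q e0.
have /choice[g hg] : forall mq : nat * nat, exists X, flat_block d D e mq.1 mq.2 X.
  by move=> mq; exact: fl.
have /choice[bd hbd] := fset_bounded.
(* The maxima make both the supports in [nat] and the intervals of coordinates successive, with
   starts at least [j] and strictly increasing respectively. *)
pose st := fix st j := if j is j'.+1 then
  (maxn (maxn (st j').1 j'.+1) (bd (bl_s (g (st j')))), maxn (bl_q (g (st j'))) (st j').2.+1)
  else (m, q).
pose X j := g (st j); pose ms j := (st j).1; pose qs j := (st j).2.
have hX j : flat_block d D e (ms j) (qs j) (X j) by exact: hg.
have qS j : (qs j < qs j.+1)%N by rewrite /qs /= leq_max leqnn orbT.
have mS j : (ms j <= ms j.+1)%N by rewrite /ms /= !leq_max leqnn.
have ms_le i j : (i <= j)%N -> (ms i <= ms j)%N.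
  by move=> /subnK <-; elim: (j - i)%N => // k IH; rewrite addSn; exact: leq_trans IH _.
have j_ms j : (j <= ms j)%N by case: j => // j; apply: leq_trans (leq_maxl _ _); exact: leq_maxr.
pose sj j := bl_s (X j).
have Ssj j : S d (sj j) by case: (hX j) => -[].
have sj_ge j : tail_ge j (sj j).
  by case: (hX j) => -[_ h] _ _ _ _; exact: tail_geW h.
have sj_before j l : (j < l)%N -> fbefore (sj j) (sj l).
  move=> jl i i' /hbd ij i'l; apply: (leq_trans ij).
  apply: (@leq_trans (ms j.+1)); first by rewrite /ms /= leq_max leqnn orbT.
  apply: (leq_trans (ms_le _ _ jl)); case: (hX l) => -[_ h] _ _ _ _; exact: h.
have zsupp j n : bl_z (X j) n != 0 -> (qs j <= n < qs j.+1)%N.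
  case: (hX j) => _ _ [_ h] _ _ /h/andP[-> nq]; apply: (leq_trans nq).
  by rewrite /qs /= leq_max leqnn.
have z0 j n : 0 <= bl_z (X j) n by case: (hX j) => _ _ [].
have zD j f N : tsirelson (S a) f -> \sum_(n < N) f n * bl_z (X j) n <= D.
  by case: (hX j) => _ _ _ h _; exact: h.
(* The end of the interval of block [j]: any point of the interval can be spread to it. *)
pose P j := qs j.+1.
have P_mono : {homo P : i j / (i < j)%N} by move=> i j ij; exact: (q_lt qS).
have P_ge j : (j <= P j)%N by apply: leq_trans (leqnSn j) _; exact: (q_ge qS).
have q4 : (0 : R) < 4^-1 by rewrite invr_gt0.
have [J [c [SJ mJ cJ PJ]]] := special_average HS Ssj sj_before sj_ge P_mono P_ge a m q4.
have [c0 c1] := cJ.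
pose s := block_union sj J.
have sjs j : j \in J -> sj j `<=` s.
  by move=> jJ; apply/fsubsetP => i ij; apply/mem_block_union; exists j.
pose co k := \sum_(j <- J) c j * ((k \in sj j)%:R * bl_c (X j) k).
have sumco (G : nat -> R) : \sum_(k <- s) co k * G k =
    \sum_(j <- J) c j * \sum_(k <- sj j) bl_c (X j) k * G k.
  rewrite /co; under eq_bigr do rewrite mulr_suml.
  rewrite exchange_big; apply: eq_big_seq => j jJ /=.
  rewrite -(sum_sub _ (sjs j jJ)) mulr_sumr; apply: eq_bigr => k _.
  by rewrite !mulrA.
have combE : comb s co u = comb J c (fun j => comb (sj j) (bl_c (X j)) u).
  by apply/funext => i; rewrite /comb sumco.
have [p hp] := fset_bounded J.
pose z n := \sum_(j <- J) c j * bl_z (X j) n.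
exists (Block s co (qs p) z (fun n => \sum_(j <- J) c j * bl_e (X j) n)).
split => /=.
- by split; [exact: SJ|exact: block_union_ge].
- split=> [k|].
    apply: sumr_ge0 => j _; rewrite mulr_ge0// mulr_ge0//.
    by case: (hX j) => _ [] h.
  have e1 (G : nat -> R) (r : seq nat) : \sum_(k <- r) G k * 1 = \sum_(k <- r) G k.
    by apply: eq_bigr => k _; rewrite mulr1.
  have /= := sumco (fun=> 1); rewrite e1 => ->; rewrite -[RHS]c1.
  apply: eq_bigr => j _; rewrite e1.
  by case: (hX j) => _ [_ ->] _ _ _; rewrite mulr1.
- split=> n; first by apply: sumr_ge0 => j _; rewrite mulr_ge0.
  move=> zn; have [j jJ zj] : exists2 j, j \in J & bl_z (X j) n != 0.
    apply: contrapT => nj; move: zn; rewrite /z big_seq big1 ?eqxx// => j jJ.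
    by have [->|zj] := eqVneq (bl_z (X j) n) 0; rewrite ?mulr0//; case: nj; exists j.
  have /andP[h1 h2] := zsupp _ _ zj; apply/andP; split.
    by apply: leq_trans h1; exact: (q_le qS (leq0n j)).
  by apply: (leq_trans h2); apply: (q_le qS); exact: hp.
- move=> f N Af.
  have zE (h : nat -> R) : \sum_(n < N) h n * z n =
      \sum_(j <- J) c j * \sum_(n < N) h n * bl_z (X j) n.
    rewrite /z; under eq_bigr do rewrite mulr_sumr.
    rewrite exchange_big; apply: eq_bigr => j _ /=; rewrite mulr_sumr.
    by apply: eq_bigr => n _; rewrite mulrCA.
  have small t : S a t -> \sum_(j <- J) c j * (P j \in t)%:R * D <= D / 4.
    by move=> /PJ h; rewrite -mulr_suml mulrC; exact: ler_wpM2l.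
  have [|n|J0 q0 f0 Aq0 q0m f0W f0q f0q'] := (Af).
  + rewrite big1 => [|n _]; last by rewrite mul0r.
    by apply: mulr_ge0 => //; exact: divr_ge0.
  + apply: le_trans (unit_sum_le n N _) _.
      by move=> k; apply: sumr_ge0 => j _; rewrite mulr_ge0.
    have [[j0 j0J zj0]|nj] := pselect (exists2 j, j \in J & bl_z (X j) n != 0); last first.
      rewrite /z big_seq big1; first by apply: mulr_ge0 => //; exact: divr_ge0.
      move=> j jJ; have [->|zj] := eqVneq (bl_z (X j) n) 0; rewrite ?mulr0//.
      by case: nj; exists j.
    (* A unit functional sees a single block, whose coefficient is at most 1/4 because singletons
       lie in [S a]. *)
    have St : S a [fset P j0] by apply: schreier1 => //; exact: leq_ltn_trans (qS j0).
    have := small _ St; set V := \sum_(j <- J) _ => hV.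
    apply: (@le_trans _ _ V); last by move: hV; lra.
    apply: ler_sum => j _; rewrite -mulrA; apply: ler_wpM2l => //.
    have [->|zj] := eqVneq (bl_z (X j) n) 0; first by rewrite mulr_ge0.
    have -> : j = j0 by rewrite -(qidxE qS (zsupp _ _ zj)) -(qidxE qS (zsupp _ _ zj0)).
    rewrite in_fset1 eqxx mul1r.
    by have := zD j0 _ n.+1 (tsirelson_unit (S a) n); rewrite unit_sum.
  + rewrite (zE (fun n => 2^-1 * \sum_(i <- J0) f0 i n)).
    (* A block met by two pieces [i < i'] is split: [q0 i'] lies after a point of the first piece
       and not after one of the second. *)
    pose split j i := i \in J0 /\ (qs j < q0 i < qs j.+1)%N.
    have /choice[ij hij] : forall j, exists i, (exists i, split j i) -> split j i.
      by move=> j; have [[i hi]|ni] := pselect (exists i, split j i);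
        [exists i|exists 0%N => h].
    pose t0 := [fset q0 (ij j) | j in [fset j in J | `[< exists i, split j i >]]].
    have t0P x : x \in t0 -> exists2 j, split j (ij j) & x = q0 (ij j).
      move=> /imfsetP[j /=]; rewrite !inE => /andP[_ /asboolP sj'] ->.
      by exists j => //; exact: hij.
    have St0 : S a t0.
      apply: (schreier_her HS Aq0); apply/fsubsetP => x /t0P[j [iJ _] ->].
      by apply/imfsetP; exists (ij j).
    (* One splitting point per block forms a subset of the admissible set; moved to the ends of
       their intervals these points stay in [S a] by spreading, so the split blocks have total
       coefficient at most 1/4. *)
    pose gg x := qs (qidx qs x).+1.
    have ggE j : split j (ij j) -> gg (q0 (ij j)) = P j.
      by move=> [_ /andP[h1 h2]]; rewrite /gg (@qidxE _ qS j)// h2 (ltnW h1).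
    pose t := [fset gg x | x in t0].
    have St : S a t.
      apply: (schreier_spread HS St0) => [x y /t0P[j sj1 ->] /t0P[j' sj2 ->] xy|x /t0P[j sj1 ->]].
        rewrite !ggE//; apply: P_mono; rewrite ltnNge leq_eqVlt; apply/negP => /orP[/eqP jj|j'j].
          by rewrite jj ltnn in xy.
        case: sj1 => _ /andP[h1 _]; case: sj2 => _ /andP[_ h2].
        have := leq_trans h2 (q_le qS j'j) => h3.
        by have := ltn_trans (ltn_trans xy h3) h1; rewrite ltnn.
      by rewrite ggE//; case: sj1 => _ /andP[_ /ltnW].
    have := small _ St; set V := \sum_(j <- J) _ => hV.
    (* Every block pays [D / 2], and the split ones pay [D] in addition: together at most
       [D / 2 + D / 4]. *)
    apply: (@le_trans _ _ (\sum_(j <- J) c j * (D / 2) + V)); last first.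
      by rewrite -mulr_suml c1; move: hV; lra.
    rewrite -big_split /= big_seq [leRHS]big_seq; apply: ler_sum => j jJ.
    rewrite -mulrA -mulrDr; apply: ler_wpM2l => //.
    have [spj|nspj] := pselect (exists i, split j i).
      have -> : P j \in t.
        apply/imfsetP; exists (q0 (ij j)); last by rewrite ggE//; exact: hij.
        apply/imfsetP; exists j => //=; rewrite !inE jJ /=.
        exact/asboolP.
      rewrite mul1r; apply: le_trans (zD j _ N (tsirelson_half Aq0 q0m f0W f0q f0q')) _.
      by rewrite lerDr divr_ge0.
    apply: (@le_trans _ _ (D / 2)); last by rewrite lerDl mulr_ge0.
    have -> : \sum_(n < N) (2^-1 * \sum_(i <- J0) f0 i n) * bl_z (X j) n =
        (\sum_(i <- J0) \sum_(n < N) f0 i n * bl_z (X j) n) / 2.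
      rewrite exchange_big mulr_suml; apply: eq_bigr => n _ /=.
      by rewrite -mulr_suml -mulrA mulrC.
    rewrite ler_pM2r ?invr_gt0//; apply: sum_unique_le => // [i iJ|i i' iJ iJ' ii' Fi Fi'].
      by apply: zD; exact: f0W.
    have nz k : \sum_(n < N) f0 k n * bl_z (X j) n != 0 ->
        exists2 n : nat, f0 k n != 0 & bl_z (X j) n != 0.
      move=> h; apply: contrapT => nn; move: h; rewrite big1 ?eqxx// => n _.
      have [->|fn] := eqVneq (f0 k n) 0; first by rewrite mul0r.
      have [->|zn] := eqVneq (bl_z (X j) n) 0; first by rewrite mulr0.
      by case: nn; exists n.
    have [n1 f1 z1] := nz _ Fi; have [n2 f2 z2] := nz _ Fi'.
    apply: nspj; exists i'; split => //.
    have /andP[h1 _] := zsupp _ _ z1; have /andP[_ h2] := zsupp _ _ z2.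
    rewrite (leq_ltn_trans h1 (f0q' i i' n1 iJ iJ' f1 ii')) /=.
    exact: leq_ltn_trans (f0q i' n2 iJ' f2) h2.
- split.
  + move=> n; apply: sumr_ge0 => j _; rewrite mulr_ge0//.
    by case: (hX j) => _ _ _ _ [h].
  + move=> N; rewrite exchange_big /=; under eq_bigr do rewrite -mulr_sumr.
    by apply: average_le => // j _; case: (hX j) => _ _ _ _ [_ h _]; exact: h.
  + move=> n t Ft; rewrite combE -big_split /=.
    apply: (@le_trans _ _ ((\sum_(j <- J) c j * seg t (comb (sj j) (bl_c (X j)) u)) / 2 ^+ n)).
      by apply: ler_wpM2r; [rewrite invr_ge0 exprn_ge0|exact: seg_comb_le].
    rewrite mulr_suml; apply: ler_sum => j _; rewrite -mulrDr -mulrA.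
    by apply: ler_wpM2l => //; case: (hX j) => _ _ _ _ [_ _ h]; exact: h.
Qed.

Lemma flat_le d D D' : D <= D' -> flat d D -> flat d D'.
Proof.
move=> DD fl e m q e0; have [X [h1 h2 h3 h4 h5]] := fl e m q e0.
by exists X; split => // f N Af; apply: le_trans (h4 f N Af) DD.
Qed.

(** Three rounds per halving, since [(3 / 4) ^ 3 = 27 / 64 < 1 / 2]; each round raises [n] by
    two. *)
Lemma flat_iter p : exists d n, (d <= oadd L (omul a (onat n)))%O /\ flat d (M / 2 ^+ p).
Proof.
elim: p => [|p [d [n [dn fl]]]].
  exists L, 0%N; split; first exact: le_oadd.
  by rewrite expr0 divr1; exact: flat_base.
have D0 : 0 <= M / 2 ^+ p by rewrite divr_ge0 ?exprn_ge0// ltW.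
have D1 : 0 <= 3 / 4 * (M / 2 ^+ p) by rewrite mulr_ge0// divr_ge0.
have D2 : 0 <= 3 / 4 * (3 / 4 * (M / 2 ^+ p)) by rewrite mulr_ge0// divr_ge0.
have fl3 := flat_step D2 (flat_step D1 (flat_step D0 fl)).
have d1 := threshold_step a1 dn.
have d2 := threshold_step a1 d1.
have d3 := threshold_step a1 d2.
exists (osucc (oadd (osucc (oadd (osucc (oadd d a)) a)) a)), n.+2.+2.+2.
split; first exact: d3.
apply: flat_le fl3; have -> : M / 2 ^+ p.+1 = M / 2 ^+ p / 2.
  by rewrite exprS invfM mulrCA mulrC.
by move: D0; set x := M / _; lra.
Qed.

Lemma small_combination (e : R) : 0 < e ->
  exists2 d, (d < oadd L (omul a oomega))%O & forall m, exists s c,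
    [/\ S d s, tail_ge m s, average s c &
     forall l : functional (R:=R) (S a) F, pnorm l (comb s c u) <= e].
Proof.
move=> e0; have e2 : 0 < e / 2 by rewrite divr_gt0.
have [p hp] := pow2_gt M e2; have [d [n [dn fl]]] := flat_iter p.
exists d; first exact: (threshold_lt a1 dn).
move=> m; have [X [[SX mX] avX [z0 _] zD [err0 errN zerr]]] := fl _ m 0%N e2.
exists (bl_s X), (bl_c X); split => // l.
apply: (@le_trans _ _ (\sum_(n < fun_n l) (fun_w l n * bl_z X n + bl_e X n))).
  apply: ler_sum => k _; have /andP[w0 w1] := tsirelson_bound k (fun_wA l).
  rewrite -mulrA [_^-1 * _]mulrC.
  apply: le_trans (ler_wpM2l w0 (zerr k _ (fun_tF l k))) _.
  by rewrite mulrDr lerD2l -[leRHS]mul1r; apply: ler_wpM2r.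
rewrite big_split /= [leRHS]splitr; apply: lerD; last exact: errN.
exact: le_trans (zD _ _ (fun_wA l)) hp.
Qed.

End Flat.

(** * Spaces defined by lattice seminorms *)

(* A family of monotone seminorms, each depending on finitely many
   coordinates; their supremum is the norm of the space built below. *)
Record lattice_norm (R : realType) (I : choiceType) := LatticeNorm {
  ln_idx : Type ;
  ln_idx0 : ln_idx ;
  lnorm : ln_idx -> (I -> R) -> R ;
  ln_ge0 : forall l x, 0 <= lnorm l x ;
  ln_triangle : forall l x y, lnorm l (fun i => x i + y i) <= lnorm l x + lnorm l y ;
  ln_scale : forall l c x, lnorm l (fun i => c * x i) = `|c| * lnorm l x ;
  ln_mono : forall l x y, (forall i, `|x i| <= `|y i|) -> lnorm l x <= lnorm l y ;
  ln_unit : forall l i, lnorm l (fun j => (j == i)%:R) <= 2 ;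
  ln_pos : forall i, exists l, 0 < lnorm l (fun j => (j == i)%:R) ;
  ln_local : forall l, exists B : {fset I}, forall x y,
    (forall i, i \in B -> x i = y i) -> lnorm l x = lnorm l y ;
  ln_linear : forall l x, exists (B : {fset I}) (g : I -> R),
    \sum_(i <- B) g i * x i = lnorm l x /\
    forall y, `|\sum_(i <- B) g i * y i| <= lnorm l y }.

Section Kothe.
Context {R : realType} {I : choiceType} (N : lattice_norm R I).
Implicit Types (x y : I -> R) (A B : {fset I}) (l : ln_idx N).

Definition on (A : {fset I}) x : I -> R := fun i => if i \in A then x i else 0.
Definition off (A : {fset I}) x : I -> R := fun i => if i \in A then 0 else x i.

Lemma on_le A x i : `|on A x i| <= `|x i|.
Proof. by rewrite /on; case: ifP; rewrite ?normr0. Qed.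

Lemma off_le A x i : `|off A x i| <= `|x i|.
Proof. by rewrite /off; case: ifP; rewrite ?normr0. Qed.

Lemma off_subset A B x i : A `<=` B -> `|off B x i| <= `|off A x i|.
Proof.
rewrite /off => /fsubsetP AB; case: ifP => iB; first by rewrite normr0.
by case: ifP => // /AB; rewrite iB.
Qed.

Lemma on_off A x : x = (fun i => on A x i + off A x i).
Proof. by apply/funext => i; rewrite /on /off; case: ifP; rewrite ?addr0 ?add0r. Qed.

Lemma ln0 l : lnorm l (fun=> 0) = 0.
Proof.
have -> : (fun=> 0) = (fun i : I => 0 * (0 : R)) by apply/funext => i; rewrite mul0r.
by rewrite ln_scale normr0 mul0r.
Qed.

Lemma ln_on l A x : lnorm l (on A x) <= \sum_(i <- A) 2 * `|x i|.
Proof.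
suff aux (s : seq I) : lnorm l (fun i => if i \in s then x i else 0) <=
    \sum_(i <- s) 2 * `|x i| by exact: (aux A).
elim: s => [|j A' IH].
  have -> : (fun i => if i \in [::] then x i else 0) = (fun=> 0) by apply/funext.
  by rewrite ln0 big_nil.
rewrite big_cons; apply: (@le_trans _ _ (lnorm l (fun i => x j * (i == j)%:R) +
    lnorm l (fun i => if i \in A' then x i else 0))); last first.
  apply: lerD => //; rewrite ln_scale mulrC.
  by apply: ler_wpM2r; [exact: normr_ge0|exact: ln_unit].
have [jA'|jA'] := boolP (j \in A').
  apply: le_trans (_ : lnorm l (fun i => if i \in A' then x i else 0) <= _).
    apply: ln_mono => i; rewrite in_cons; case: eqVneq => [->|_] //=.
    by rewrite jA'.
  by rewrite lerDr ln_ge0.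
apply: le_trans (ln_triangle _ _ _); apply: ln_mono => i; rewrite in_cons.
case: eqVneq => [->|_] /=; first by rewrite (negbTE jA') mulr1 addr0.
by rewrite mulr0 add0r.
Qed.

Definition kothe_pred : {pred (I -> R)} := fun x => `[< forall e : R, 0 < e ->
  exists A, forall l, lnorm l (off A x) <= e >].

Lemma kotheP x : reflect (forall e : R, 0 < e -> exists A, forall l, lnorm l (off A x) <= e)
  (x \in kothe_pred).
Proof. exact: asboolP. Qed.

Lemma kothe_submod : GRing.submod_closed kothe_pred.
Proof.
split=> [|c x y /kotheP hx /kotheP hy].
  apply/kotheP => e e0; exists fset0 => l.
  by rewrite [X in lnorm l X](_ : _ = (fun=> 0)) ?ln0 ?ltW//; apply/funext => i; rewrite /off; case: ifP.
apply/kotheP => e e0; have c1 : 0 < `|c| + 1 by rewrite ltr_wpDl.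
have ec : 0 < e / 2 / (`|c| + 1) by rewrite !divr_gt0.
have e2 : 0 < e / 2 by rewrite divr_gt0.
have [A hA] := hx _ ec; have [B hB] := hy _ e2; exists (A `|` B) => l.
apply: (@le_trans _ _ (lnorm l (fun i => c * off A x i) + lnorm l (off B y))).
  apply: le_trans (ln_triangle _ _ _).
  apply: ln_mono => i; rewrite {1}/off; case: ifPn => iAB; first by rewrite normr0.
  move: iAB; rewrite in_fsetU negb_or /off => /andP[/negbTE -> /negbTE ->].
  exact: lexx.
rewrite ln_scale [leRHS]splitr; apply: lerD (hB l).
apply: le_trans (ler_wpM2l (normr_ge0 c) (hA l)) _.
rewrite mulrCA -[leRHS]mulr1 ler_pM2l// ler_pdivrMr// mul1r.
by rewrite lerDl.
Qed.

HB.instance Definition _ := GRing.isSubmodClosed.Build R (I -> R) kothe_pred kothe_submod.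

Record kothe := Kothe { kval :> I -> R ; kvalP : kval \in kothe_pred }.

HB.instance Definition _ := [isSub for kval].
HB.instance Definition _ := [Choice of kothe by <:].
HB.instance Definition _ := [SubChoice_isSubLmodule of kothe by <:].

Implicit Types (u v : kothe).

Lemma kvalD u v i : kval (u + v) i = kval u i + kval v i. Proof. by []. Qed.
Lemma kvalB u v i : kval (u - v) i = kval u i - kval v i. Proof. by []. Qed.
Lemma kvalZ (c : R) u i : kval (c *: u) i = c * kval u i. Proof. by []. Qed.

Lemma kval_sum (J : Type) (r : seq J) (f : J -> kothe) i :
  kval (\sum_(j <- r) f j) i = \sum_(j <- r) kval (f j) i.
Proof. by elim: r => [|j r IH]; rewrite ?big_nil// !big_cons kvalD IH. Qed.

Lemma kothe_bounded u : exists M, forall l, lnorm l u <= M.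
Proof.
have [A hA] := kotheP _ (kvalP u) 1 ltr01.
exists (\sum_(i <- A) 2 * `|u i| + 1) => l.
rewrite [X in lnorm l X](on_off A); apply: le_trans (ln_triangle _ _ _) _.
by apply: lerD (hA l); exact: ln_on.
Qed.

Definition knorm u : R := sup [set lnorm l (kval u) | l in [set: ln_idx N]].

Lemma knorm_has_sup u : has_sup [set lnorm l (kval u) | l in [set: ln_idx N]].
Proof.
split; first by exists (lnorm (ln_idx0 N) u), (ln_idx0 N).
by have [M hM] := kothe_bounded u; exists M => _ [l _ <-].
Qed.

Lemma ln_le_knorm l u : lnorm l u <= knorm u.
Proof. by apply: ub_le_sup; [case: (knorm_has_sup u)|exists l]. Qed.

Lemma knorm_le u (M : R) : (forall l, lnorm l u <= M) -> knorm u <= M.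
Proof.
move=> h; apply: ge_sup => [|_ [l _ <-]//]; by case: (knorm_has_sup u).
Qed.

Lemma knorm_triangle u v : knorm (u + v) <= knorm u + knorm v.
Proof.
apply: knorm_le => l; apply: le_trans (ln_triangle l u v) _.
by apply: lerD; exact: ln_le_knorm.
Qed.

Lemma knormZ (c : R) u : knorm (c *: u) = `|c| * knorm u.
Proof.
apply/le_anti/andP; split.
  by apply: knorm_le => l; rewrite ln_scale ler_wpM2l// ln_le_knorm.
have [->|c0] := eqVneq c 0.
  by rewrite normr0 mul0r; apply: le_trans (ln_le_knorm (ln_idx0 N) _); exact: ln_ge0.
rewrite mulrC -ler_pdivlMr ?normr_gt0//; apply: knorm_le => l.
rewrite ler_pdivlMr ?normr_gt0// mulrC -ln_scale; exact: (ln_le_knorm l (c *: u)).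
Qed.

Lemma coord_bound i : exists2 C : R, 0 < C & forall u, `|u i| <= C * knorm u.
Proof.
have [l hl] := ln_pos N i; exists (lnorm l (fun j => (j == i)%:R))^-1.
  by rewrite invr_gt0.
move=> u; rewrite mulrC ler_pdivlMr//; apply: le_trans (ln_le_knorm l u).
rewrite -ln_scale; apply: ln_mono => j; case: eqVneq => [->|_]; first by rewrite mulr1.
by rewrite mulr0 normr0.
Qed.

Lemma knorm_eq0 u : knorm u = 0 -> u = 0.
Proof.
move=> u0; apply: val_inj; apply/funext => i; have [C _ /(_ u)] := coord_bound i.
by rewrite u0 mulr0 normr_le0 => /eqP.
Qed.

HB.instance Definition _ := Lmodule_isNormed.Build R kothe knorm_triangle knormZ knorm_eq0.

Lemma knormE u : `|u| = knorm u. Proof. by []. Qed.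

Lemma sum_le_card (A : {fset I}) (f : I -> R) (c : R) : (forall i, i \in A -> f i <= c) ->
  \sum_(i <- A) f i <= c *+ #|` A|.
Proof.
move=> fc; apply: (@le_trans _ _ (\sum_(i <- A) c)).
  by rewrite big_seq [leRHS]big_seq; exact: ler_sum.
by rewrite big_const_seq count_predT iter_addr_0.
Qed.

(** The limit is formed coordinatewise. A seminorm sees finitely many coordinates, so its bound on a
    ball passes to the limit; this also shows that the limit belongs to the space. *)
Lemma kothe_complete (F : set_system kothe) : ProperFilter F -> cauchy F -> cvg F.
Proof.
move=> FF /cauchyP Fc.
have Fball (z : kothe) (e : R) : F (ball z e) -> F [set y | `|z - y| < e].
  by rewrite -ball_normE.
have /choice[x hx] : forall i, exists r : R, forall e : R, 0 < e -> F [set y : kothe | `|r - y i| < e].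
  move=> i; have [C C0 hC] := coord_bound i.
  have : cvg ((fun y : kothe => y i : R^o) @ F).
    apply/cauchy_cvgP/cauchyP => e e0; have [z /Fball hz] := Fc _ (divr_gt0 e0 C0).
    exists (z i); rewrite -ball_normE.
    change (F [set y : kothe | `|z i - y i| < e]); apply: filterS hz => y /= zy.
    change (`|(z - y) i| < e); apply: le_lt_trans (hC _) _.
    by rewrite mulrC -ltr_pdivlMr.
  move=> /cvg_ex[r hr]; exists r => e e0.
  by move/cvgrPdist_lt : hr => /(_ e e0).
have key l (z : kothe) (e : R) : F (ball z e) -> lnorm l (fun i => x i - z i) <= e.
  move=> /Fball Fz; have [B hB] := ln_local l.
  (* The 2 is the bound on the seminorms of unit vectors; the successor avoids division by zero when
     [B] is empty. *)
  apply/ler_addgt0Pr => n n0; pose n' := n / (2 * #|` B|.+1%:R).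
  have n'0 : 0 < n' by rewrite divr_gt0// mulr_gt0.
  have FB : F (\bigcap_(i in [set` B]) [set y : kothe | `|x i - y i| < n']).
    by apply: filter_bigI => i _; exact: hx.
  have [y [/= yz yB]] := filter_ex (filterI Fz FB).
  apply: (@le_trans _ _ (lnorm l (fun i => (y - z) i + on B (fun i => x i - y i) i))).
    rewrite le_eqVlt; apply/orP; left; apply/eqP; apply: hB => i iB.
    by rewrite /on iB kvalB; lra.
  apply: le_trans (ln_triangle _ _ _) _; apply: lerD.
    by apply: le_trans (ln_le_knorm _ _) _; rewrite -knormE distrC; exact: ltW.
  apply: le_trans (ln_on _ _ _) _.
  apply: (@le_trans _ _ ((2 * n') *+ #|` B|)).
    by apply: sum_le_card => i iB; rewrite ler_pM2l//; apply: ltW; exact: yB.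
  have -> : 2 * n' = n / #|` B|.+1%:R by rewrite /n' invfM mulrCA [2 * _]mulrA divff// mul1r.
  rewrite -mulr_natr mulrAC ler_pdivrMr// ler_pM2l// ler_nat; exact: leqnSn.
have xk : x \in kothe_pred.
  apply/kotheP => e e0; have e2 : 0 < e / 2 by rewrite divr_gt0.
  have [z Fz] := Fc _ e2; have [A hA] := kotheP _ (kvalP z) _ e2.
  exists A => l; rewrite [leRHS]splitr.
  apply: le_trans (lerD (key l z _ Fz) (hA l)); apply: le_trans (ln_triangle _ _ _).
  apply: ln_mono => i; rewrite /off; case: ifP => _; first by rewrite normr0.
  by rewrite subrK.
apply/cvg_ex; exists (Kothe xk); apply/cvgrPdist_lt => e e0.
have e4 : 0 < e / 4 by rewrite divr_gt0.
have [z Fz] := Fc _ e4; apply: filterS (Fball _ _ Fz) => y /= zy.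
have h : `|Kothe xk - z| <= e / 4 by apply: knorm_le => l; exact: key.
have -> : Kothe xk - y = (Kothe xk - z) + (z - y) by rewrite addrA subrK.
apply: le_lt_trans (ler_normD _ _) _.
by apply: le_lt_trans (lerD h (ltW zy)) _; lra.
Qed.

HB.instance Definition _ := Uniform_isComplete.Build kothe kothe_complete.

Lemma ln_close l (e : R) : 0 < e -> exists (B : {fset I}) (d : R), 0 < d /\
  forall x y, (forall i, i \in B -> `|x i - y i| <= d) -> lnorm l x <= lnorm l y + e.
Proof.
move=> e0; have [B hB] := ln_local l; exists B, (e / (2 * #|` B|.+1%:R)).
split=> [|x y xy]; first by rewrite divr_gt0// mulr_gt0.
apply: (@le_trans _ _ (lnorm l (fun i => y i + on B (fun i => x i - y i) i))).
  rewrite le_eqVlt; apply/orP; left; apply/eqP; apply: hB => i iB.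
  by rewrite /on iB addrCA subrr addr0.
apply: le_trans (ln_triangle _ _ _) _; rewrite lerD2l.
apply: le_trans (ln_on _ _ _) _.
apply: (@le_trans _ _ ((e / #|` B|.+1%:R) *+ #|` B|)).
  apply: sum_le_card => i iB; apply: le_trans (ler_wpM2l _ (xy i iB)) _ => //.
  by rewrite invfM mulrCA [2 * _]mulrA divff// mul1r.
by rewrite -mulr_natr mulrAC ler_pdivrMr// ler_pM2l// ler_nat; exact: leqnSn.
Qed.

Lemma on_kothe A x : on A x \in kothe_pred.
Proof.
apply/kotheP => e e0; exists A => l.
rewrite [X in lnorm l X](_ : _ = (fun=> 0)) ?ln0 ?ltW//; apply/funext => i.
by rewrite /off; case: ifPn => // iA; rewrite /on (negbTE iA).
Qed.

Definition kon A x : kothe := Kothe (on_kothe A x).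

Lemma konE A x i : kon A x i = on A x i. Proof. by []. Qed.

Lemma off_kothe A u : off A u = u - kon A u :> (I -> R).
Proof.
apply/funext => i; rewrite kvalB konE /off /on; case: ifP => _; first by rewrite subrr.
by rewrite subr0.
Qed.

Lemma ln_comb_le l (s : {fset nat}) c (v : nat -> I -> R) :
  lnorm l (comb s c v) <= \sum_(k <- s) `|c k| * lnorm l (v k).
Proof.
rewrite /comb; elim: (s : seq nat) => [|k s' IH].
  by rewrite big_nil; under eq_fun do rewrite big_nil; rewrite ln0.
rewrite big_cons; under eq_fun do rewrite big_cons.
by apply: le_trans (ln_triangle _ _ _) _; apply: lerD IH; rewrite ln_scale.
Qed.

End Kothe.

Definition kothe_space (R : realType) (I : choiceType) (N : lattice_norm R I) :
  completeNormedModType R := kothe N.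

(** * Disjoint sequences and subsequences *)

Lemma disjoint_sequence (I : choiceType) (P : {fset I} -> Prop) :
  (forall A : {fset I}, exists2 C, P C & forall i, i \in C -> i \notin A) ->
  exists2 B : nat -> {fset I}, forall k, P (B k) &
    forall k l i, i \in B k -> i \in B l -> k = l.
Proof.
move=> h; have /choice[g hg] : forall A : {fset I}, exists C, P C /\ forall i, i \in C -> i \notin A.
  by move=> A; have [C ? ?] := h A; exists C.
pose st := fix st k := if k is k'.+1 then st k' `|` g (st k') else fset0.
have st_le k l : (k <= l)%N -> st k `<=` st l.
  move=> /subnK <-; elim: (l - k)%N => // j IH; rewrite addSn.
  by apply: fsubset_trans IH _; exact: fsubsetUl.
have lt (k l : nat) (i : I) : (k < l)%N -> i \in g (st k) -> i \in g (st l) -> False.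
  move=> kl ik /(proj2 (hg (st l))); apply/negP/negPn.
  by apply: (fsubsetP (st_le _ _ kl)); rewrite /= in_fsetU ik orbT.
exists (fun k => g (st k)) => [k|k l i ik il]; first by case: (hg (st k)).
by case: (ltngtP k l) => // kl; [case: (lt _ _ _ kl ik il)|case: (lt _ _ _ kl il ik)].
Qed.

Lemma increasing_subsequence2 (P : nat -> nat -> Prop) :
  (forall k N, exists2 n, (N <= n)%N & P k n) ->
  exists2 phi : nat -> nat, increasing_seq phi & forall k, P k (phi k).
Proof.
move=> h; have /choice[g hg] : forall kN : nat * nat, exists n, (kN.2 <= n)%N /\ P kN.1 n.
  by move=> [k N]; have [n ? ?] := h k N; exists n.
pose phi := fix phi k := if k is k'.+1 then g (k, (phi k').+1) else g (0%N, 0%N).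
exists phi; last by case=> [|k] /=; [case: (hg (0%N, 0%N))|case: (hg (k.+1, (phi k).+1))].
by apply/increasing_seqP => k /=; case: (hg (k.+1, (phi k).+1)).
Qed.

Lemma bounded_seqP (R : realType) (X : completeNormedModType R) (x : nat -> X) :
  bounded_fun x <-> exists M : R, forall n, `|x n| <= M.
Proof.
split=> [[M [_ h]]|[M h]].
  by exists (M + 1) => n; apply: h => //; rewrite ltrDl.
exists M; split; first exact: num_real.
by move=> M' /ltW MM n _; exact: le_trans (h n) MM.
Qed.

Lemma sum_imfset (V : zmodType) (h : nat -> nat) (s : {fset nat}) (F : nat -> V) :
  injective h -> \sum_(j <- [fset h k | k in s]) F j = \sum_(k <- s) F (h k).
Proof. by move=> hi; rewrite big_imfset//= => i j _ _ /hi. Qed.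

Lemma l1_lower_subsequence (R : realType) (X : completeNormedModType R)
    (S : omega1 -> set {fset nat}) (b : omega1) (x : nat -> X) (phi : nat -> nat) (C : R) :
  is_schreier_sequence S -> increasing_seq phi ->
  (forall s, S b s -> forall c : nat -> R,
    C * (\sum_(n <- s) `|c n|) <= `|\sum_(n <- s) c n *: x n|) ->
  forall s, S b s -> forall c : nat -> R,
    C * (\sum_(n <- s) `|c n|) <= `|\sum_(n <- s) c n *: x (phi n)|.
Proof.
move=> HS phi1 hC s Ss c; have phi_inj := increasing_inj phi1.
pose inv n := xget 0%N [set k | phi k = n].
have invE k : inv (phi k) = k.
  by apply: phi_inj; apply: (@xgetI _ 0%N [set j | phi j = phi k] k).
have ST : S b [fset phi k | k in s].
  apply: (schreier_spread HS) Ss _ _ => [i j _ _|i _]; first exact: increasing_lt.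
  exact: increasing_ge.
have := hC _ ST (c \o inv); rewrite !sum_imfset//=.
rewrite (eq_bigr (fun k => `|c k|)); last by move=> k _; rewrite invE.
by rewrite [in leRHS](eq_bigr (fun k => c k *: x (phi k)))// => k _; rewrite invE.
Qed.

(** * Spreading models *)

Section SpreadingModels.
Context {R : realType} {I : choiceType} (N : lattice_norm R I).
Variables (S : omega1 -> set {fset nat}) (a beta : omega1).
Hypotheses (HS : is_schreier_sequence S) (a1 : (oone <= a)%O).
Hypothesis blim : is_limit beta.

(** This and [flat_blocks] are the only facts about the mixed norm used below. They speak of
    functions and single seminorms because a block need not be given as an element of the space. *)
Definition lower_blocks : Prop := forall (u : nat -> I -> R) (B : nat -> {fset I}) (d : R),
  (forall k l i, i \in B k -> i \in B l -> k = l) ->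
  (forall k i, u k i != 0 -> i \in B k) -> 0 < d ->
  (forall k, exists l : ln_idx N, d <= lnorm l (u k)) ->
  exists2 phi : nat -> nat, increasing_seq phi &
  exists2 C : R, 0 < C & forall s c, S a s ->
    exists l : ln_idx N, C * (\sum_(k <- s) `|c k|) <= lnorm l (comb s c (u \o phi)).

Definition flat_blocks : Prop := forall (u : nat -> I -> R) (B : nat -> {fset I}) (M : R),
  (forall k l i, i \in B k -> i \in B l -> k = l) ->
  (forall k i, u k i != 0 -> i \in B k) -> 0 < M ->
  (forall k (l : ln_idx N), lnorm l (u k) <= M) ->
  forall e : R, 0 < e -> exists2 d, (d < beta)%O & forall m, exists s c,
    [/\ S d s, tail_ge m s, average s c &
     forall l : ln_idx N, lnorm l (comb s c u) <= e].

Hypotheses (Ha : lower_blocks) (Hb : flat_blocks).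

Lemma on_supp A (x : I -> R) i : on A x i != 0 -> i \in A.
Proof. by rewrite /on; case: ifP => //; rewrite eqxx. Qed.

(** Otherwise [x] has disjoint finite restrictions of norm at least [e]. The sum of suitable [n] of
    them has norm at least [C n], although it is dominated by [x] coordinatewise. *)
Lemma boundedly_complete (x : I -> R) (M : R) :
  (forall l : ln_idx N, lnorm l x <= M) -> x \in kothe_pred N.
Proof.
move=> xM; apply/kotheP => e e0; apply: contrapT => nA.
have [|B hB Bd] := @disjoint_sequence I (fun C => exists l : ln_idx N, e <= lnorm l (on C x)).
  move=> A; have [l hl] : exists l : ln_idx N, ~ lnorm l (off A x) <= e.
    by apply/existsNP => h; apply: nA; exists A.
  have [C hC] := ln_local l; exists (C `\` A); last by move=> i /fsetDP[].
  exists l; move/negP: hl; rewrite -ltNge => /ltW /le_trans; apply.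
  rewrite le_eqVlt; apply/orP; left; apply/eqP; apply: hC => i iC.
  by rewrite /off /on in_fsetD iC andbT; case: (i \in A).
have uB k i : on (B k) x i != 0 -> i \in B k by exact: on_supp.
have [phi phi1 [C C0 hC]] := Ha Bd uB e0 hB.
have [k hk] := schreier_large HS a1.
have [n hn] : exists n : nat, M < C * n%:R.
  exists (Num.bound `|M / C|); rewrite mulrC -ltr_pdivrMr//.
  apply: le_lt_trans (ler_norm _) _; exact: archi_boundP.
(* [n] elements, all at least [n] and [k], so that the set lies in [S a]. *)
pose s := [fset (j + maxn k n)%N | j in below n].
have cs : #|` s| = n.
  rewrite card_imfset /=; last exact: addIn.
  rewrite /below card_imfset /=; last exact: val_inj.
  by rewrite size_enum_ord.
have sS : S a s.
  apply: hk => [i /imfsetP[j _ ->]|i /imfsetP[j _ ->]].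
    by apply: leq_trans (leq_maxl k n) (leq_addl _ _).
  by rewrite cs; apply: leq_trans (leq_maxr k n) (leq_addl _ _).
have [l] := hC s (fun=> 1) sS.
rewrite big_const_seq count_predT iter_addr_0 normr1 cs; apply/negP; rewrite -ltNge.
apply: le_lt_trans hn; apply: le_trans (xM l); apply: ln_mono => i.
have phi_inj := increasing_inj phi1.
have [[j js ij]|nj] := pselect (exists2 j, j \in s & i \in B (phi j)).
  by rewrite (comb_at Bd uB (fun=> 1) phi_inj js ij) mul1r; exact: on_le.
rewrite /comb big_seq big1 ?normr0// => j js; rewrite mul1r /=.
by apply/eqP; apply: contraT => /on_supp ij; case: nj; exists j.
Qed.

(** A substitute for a weak limit before reflexivity is known: a cluster point in a product of
    intervals. Its seminorms are at most [M] because each is local, and bounded completeness puts it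
    in the space. *)
Lemma cluster_point (x : nat -> kothe N) (M : R) : (forall n, `|x n| <= M) ->
  exists y : kothe N, forall m (B : {fset I}) (e : R), 0 < e ->
    exists2 n, (m <= n)%N & forall i, i \in B -> `|x n i - y i| <= e.
Proof.
move=> xM.
have /choice[C hC] : forall i, exists C : R, forall n, `|x n i| <= C.
  move=> i; have [C C0 hC] := coord_bound N i; exists (C * M) => n.
  by apply: le_trans (hC _) _; rewrite ler_pM2l// xM.
have cpt := @tychonoff I (fun=> R) (fun i => `[- C i, C i]%classic)
   (fun i => @segment_compact R _ _).
pose F : set_system (prod_topology (fun _ : I => R)) :=
  (fun n => (x n : I -> R)) @ \oo.
have FF : ProperFilter F by exact: fmap_proper_filter.
have [|y [_ yF]] := cpt F FF.
  exists 0%N => // n _ i /=; rewrite in_itv /=; have := hC i n.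
  by rewrite ler_norml.
have hy m (B : {fset I}) (e : R) : 0 < e ->
    exists2 n, (m <= n)%N & forall i, i \in B -> `|x n i - y i| <= e.
  move=> e0; pose V : set (prod_topology (fun _ : I => R)) :=
    \bigcap_(i in [set` B]) [set z | `|z i - y i| <= e].
  have Vy : nbhs y V.
    apply: filter_bigI => i _.
    have := @proj_continuous I (fun=> R) i y [set r | `|r - y i| <= e]; apply.
    apply/nbhs_ballP; exists e => //= r; rewrite /ball /= distrC; exact: ltW.
  have Fm : F [set z : prod_topology (fun _ : I => R) | exists2 n, (m <= n)%N & z = (x n : I -> R)].
    by exists m => // n /= mn; exists n.
  have [z [[n mn ->] Vz]] := yF _ _ Fm Vy; exists n => // i iB; exact: Vz.
have yk : (y : I -> R) \in kothe_pred N.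
  apply: (@boundedly_complete y M) => l; apply/ler_addgt0Pr => e e0.
  have [B [d [d0 hd]]] := ln_close l e0.
  have [n _ hn] := hy 0%N B d d0.
  apply: le_trans (hd y (x n) _) _; first by move=> i iB; rewrite distrC; exact: hn.
  by rewrite lerD2r; apply: le_trans (ln_le_knorm _ _) (xM n).
by exists (Kothe yk).
Qed.

Lemma gliding_hump (x : nat -> kothe N) (y : kothe N) (n0 : nat) (eta : nat -> R) :
  (forall m (B : {fset I}) (e : R), 0 < e ->
    exists2 n, (m <= n)%N & forall i, i \in B -> `|x n i - y i| <= e) ->
  (forall k, 0 < eta k) ->
  exists (phi : nat -> nat) (B : nat -> {fset I}),
    [/\ increasing_seq phi, forall k, (n0 <= phi k)%N,
        forall k l i, i \in B k -> i \in B l -> k = l &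
        forall k (l : ln_idx N), lnorm l (off (B k) (x (phi k) - y)) <= eta k].
Proof.
move=> xy eta0.
have step : forall AN : {fset I} * nat * nat, exists nC : nat * {fset I},
    [/\ (AN.1.2 <= nC.1)%N, forall i, i \in nC.2 -> i \notin AN.1.1 &
    forall l : ln_idx N, lnorm l (off nC.2 (x nC.1 - y)) <= eta AN.2].
  move=> [[A m] k] /=; have e0 := eta0 k.
  have e2 : 0 < eta k / 2 by rewrite divr_gt0.
  (* Half of [eta k] pays for the coordinates already used, where [x n] is close to [y]; the other
     half for those outside a finite set [C]. *)
  have [n mn hn] := xy m A _ (divr_gt0 e2 (ltr0Sn R (2 * #|` A|))).
  have [C hC] := kotheP _ _ (kvalP (x n - y)) _ e2.
  exists (n, C `\` A); split => //=; first by move=> i /fsetDP[].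
  move=> l; rewrite [leRHS]splitr.
  apply: (@le_trans _ _ (lnorm l (fun i => on A (x n - y) i + off C (x n - y) i))).
    apply: ln_mono => i; rewrite /off /on in_fsetD.
    case: (i \in A) => /=; last by rewrite add0r.
    by case: (i \in C); rewrite ?addr0// -mulr2n normrMn mulr2n lerDl.
  apply: le_trans (ln_triangle _ _ _) _; apply: lerD (hC l).
  apply: le_trans (ln_on _ _ _) _.
  apply: (@le_trans _ _ ((2 * (eta k / 2 / (2 * #|` A|).+1%:R)) *+ #|` A|)).
    by apply: sum_le_card => i iA; rewrite ler_pM2l//; exact: hn.
  rewrite -mulr_natr mulrAC -natrM mulrCA -[leRHS]mulr1 ler_pM2l//.
  by rewrite ler_pdivrMr// mul1r ler_nat leqnSn.
have /choice[g hg] := step.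
pose st := fix st k := if k is k'.+1 then
  ((st k').1.1 `|` (g (st k')).2, (g (st k')).1.+1, k) else (fset0, n0, 0%N).
have st2 k : (st k).2 = k by case: k.
pose phi k := (g (st k)).1; pose B k := (g (st k)).2.
have phi_ge k : ((st k).1.2 <= phi k)%N by case: (hg (st k)).
have phi1 : increasing_seq phi.
  by apply/increasing_seqP => k; exact: (phi_ge k.+1).
have A_le k l : (k <= l)%N -> (st k).1.1 `<=` (st l).1.1.
  move=> /subnK <-; elim: (l - k)%N => // j IH; rewrite addSn.
  by apply: fsubset_trans IH _; exact: fsubsetUl.
have lt (k l : nat) (i : I) : (k < l)%N -> i \in B k -> i \in B l -> False.
  have [_ h _] := hg (st l).
  move=> kl ik /h; apply/negP/negPn.
  by apply: (fsubsetP (A_le _ _ kl)); rewrite /= in_fsetU ik orbT.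
exists phi, B; split => //.
- move=> k; apply: (@leq_trans (phi 0%N)); first exact: (phi_ge 0%N).
  by have := phi1 0%N k; rewrite /Order.le /= leq0n.
- move=> k l i ik il.
  by case: (ltngtP k l) => // kl; [case: (lt _ _ _ kl ik il)|case: (lt _ _ _ kl il ik)].
- by move=> k l; have [_ _ h] := hg (st k); rewrite -[in leRHS](st2 k); exact: h.
Qed.

(** The limit [y] need not vanish. Far blocks avoid a finite set [G] outside which [y] is small, so
    on their coordinates [y] is an error of size [C / 4], like the tail of the hump. *)
Lemma half_lower (x : nat -> kothe N) (y : kothe N) (phi : nat -> nat)
    (B : nat -> {fset I}) (C e : R) :
  (forall k (l : ln_idx N), lnorm l (off (B k) (x (phi k) - y)) <= e / 2 ^+ k) ->
  (forall k l i, i \in B k -> i \in B l -> k = l) -> 0 < C -> 0 <= e ->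
  (forall s c, S a s -> exists l : ln_idx N, C * (\sum_(k <- s) `|c k|) <=
     lnorm l (comb s c (fun k => on (B k) (x (phi k) - y)))) ->
  exists m, forall s c, S a s -> tail_ge m s ->
    C / 2 * (\sum_(k <- s) `|c k|) <= `|\sum_(k <- s) c k *: x (phi k)|.
Proof.
move=> hB Bd C0 e0 hC; have C4 : 0 < C / 4 by rewrite divr_gt0.
have [G hG] := kotheP _ _ (kvalP y) _ C4.
have [m1 hm1] := disjoint_avoid G Bd; have [p hp] := pow2_gt e C4.
exists (maxn m1 p) => s c Ss sm; have [l hl] := hC s c Ss.
pose z := \sum_(k <- s) c k *: x (phi k).
pose w k i := -1 * off (B k) (x (phi k) - y) i + -1 * off G y i.
have wl k : k \in s -> lnorm l (w k) <= C / 2.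
  move=> ks; apply: le_trans (ln_triangle _ _ _) _; rewrite !ln_scale normrN1 !mul1r.
  have -> : C / 2 = C / 4 + C / 4 by lra.
  apply: lerD (hG l); apply: le_trans (hB k l) _; apply: le_trans hp.
  apply: ler_wpM2l => //; rewrite lef_pV2 ?posrE ?exprn_gt0// ler_weXn2l ?ler1n//.
  by apply: leq_trans (sm k ks); exact: leq_maxr.
have : lnorm l (comb s c (fun k => on (B k) (x (phi k) - y))) <=
    `|z| + C / 2 * \sum_(k <- s) `|c k|.
  apply: (@le_trans _ _ (lnorm l (fun i => z i + comb s c w i))).
    apply: ln_mono => i; have [iG|iG] := boolP (i \in G).
      rewrite {1}/comb big_seq big1 ?normr0// => k ks.
      have iB : i \notin B k.
        apply/negP => ik; have := hm1 k i _ ik; rewrite iG => h.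
        by have : (m1 <= k)%N := leq_trans (leq_maxl _ _) (sm k ks); move/h.
      by rewrite /on (negbTE iB) mulr0.
    rewrite kval_sum /comb -big_split /= le_eqVlt; apply/orP; left; apply/eqP.
    congr `|_|; apply: eq_bigr => k _; rewrite -mulrDr; congr (_ * _).
    rewrite /w /on /off (negbTE iG) kvalB !mulN1r; case: ifP => _.
      by rewrite oppr0 add0r.
    by rewrite opprB addrA; lra.
  apply: le_trans (ln_triangle _ _ _) _; apply: lerD; first exact: ln_le_knorm.
  apply: le_trans (ln_comb_le _ _ _ _) _; rewrite mulr_sumr.
  rewrite big_seq [leRHS]big_seq; apply: ler_sum => k ks.
  by rewrite mulrC; apply: ler_wpM2r => //; exact: wl.
move=> h; have := le_trans hl h; rewrite -/z; set V := \sum_(_ <- _) _.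
by lra.
Qed.

Lemma lower_subsequence (x : nat -> kothe N) : bounded_fun x ->
  (forall phi : nat -> nat, increasing_seq phi -> ~ cvgn (x \o phi)) ->
  exists2 phi : nat -> nat, increasing_seq phi & l1_spreading_model S a (x \o phi).
Proof.
move=> /bounded_seqP[M xM] ncv; have [y hy] := cluster_point xM.
(* Otherwise some subsequence would converge to [y] in norm. *)
have [d [n0 [d0 hd]]] : exists (d : R) n0, 0 < d /\ forall n, (n0 <= n)%N -> d <= `|x n - y|.
  apply: contrapT => nd.
  have [k m|phi phi1 hphi] := @increasing_subsequence2 (fun k n => `|x n - y| < k.+1%:R^-1).
    apply: contrapT => nn; apply: nd; exists k.+1%:R^-1, m; rewrite invr_gt0 ltr0Sn.
    split=> // n mn; rewrite leNgt; apply/negP => h; apply: nn; exists n => //.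
  apply: (ncv _ phi1); apply/cvg_ex; exists y; apply/cvgrPdist_lt => e e0.
  have [p hp] : exists p : nat, e^-1 < p.+1%:R.
    exists (Num.bound e^-1); apply: lt_trans (archi_boundP _) _; first by rewrite invr_ge0 ltW.
    by rewrite ltr_nat.
  exists p => // k /= pk; rewrite distrC; apply: lt_trans (hphi k) _.
  rewrite -[ltRHS]invrK ltf_pV2 ?posrE ?invr_gt0 ?ltr0Sn//.
  by apply: (lt_le_trans hp); rewrite ler_nat ltnS.
have d4 : 0 < d / 4 by rewrite divr_gt0.
have eta0 k : 0 < d / 4 / 2 ^+ k by rewrite divr_gt0// exprn_gt0.
have [phi [B [phi1 phin0 Bd hB]]] := gliding_hump n0 hy eta0.
pose u k := on (B k) (x (phi k) - y).
have uB k i : u k i != 0 -> i \in B k by exact: on_supp.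
have d2 : 0 < d / 2 by rewrite divr_gt0.
(* Removing a tail of norm at most [d / 4] from a vector of norm at least [d] leaves more than
   [d / 2]. *)
have [|psi psi1 [C C0 hC]] := Ha Bd uB d2.
  move=> k; apply: contrapT => nl.
  have : `|x (phi k) - y| <= d / 2 + d / 4.
    apply: knorm_le => l; rewrite [X in lnorm l X](on_off (B k)).
    apply: le_trans (ln_triangle _ _ _) _; apply: lerD.
      by rewrite leNgt; apply/negP => /ltW h; apply: nl; exists l.
    apply: le_trans (hB k l) _; rewrite ler_pdivrMr ?exprn_gt0//.
    rewrite -[leLHS]mulr1; apply: ler_wpM2l; first exact: ltW.
    by apply: exprn_ege1; rewrite ler1n.
  by move: (hd _ (phin0 k)) d0; lra.
have [|||||m hm] := @half_lower x y (phi \o psi) (B \o psi) C (d / 4).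
- move=> k l; apply: le_trans (hB (psi k) l) _.
  rewrite ler_pM2l// lef_pV2 ?posrE ?exprn_gt0// ler_weXn2l ?ler1n//.
  exact: increasing_ge.
- by move=> k l i ik il; apply: (increasing_inj psi1); exact: Bd ik il.
- exact: C0.
- exact: ltW.
- exact: hC.
have th : increasing_seq (fun j => phi (psi (j + m)%N)).
  apply/increasing_seqP => j; apply: increasing_lt => //.
  exact: increasing_lt.
exists (fun j => phi (psi (j + m)%N)) => //; split.
  by apply/bounded_seqP; exists M => n; exact: xM.
exists (C / 2); first by rewrite divr_gt0.
move=> s Ss c.
have Ss' : S a [fset (j + m)%N | j in s].
  apply: (schreier_spread HS) Ss _ _ => [i j _ _|i _]; last exact: leq_addr.
  by rewrite ltn_add2r.
have := hm _ (fun k => c (k - m)%N) Ss'.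
rewrite !sum_imfset /=; [|exact: addIn|exact: addIn].
rewrite (eq_bigr (fun k => `|c k|)); last by move=> k _; rewrite addnK.
rewrite [in leRHS](eq_bigr (fun k => c k *: x (phi (psi (k + m)%N)))); last first.
  by move=> k _; rewrite addnK.
by apply => i /imfsetP[j _ ->]; exact: leq_addl.
Qed.

(** The difference of two successive flat averages cancels the limit [y]. Its support lies in
    [S (d + 1)], hence in [S beta] far out; its coefficients have absolute sum 2, while its norm is
    at most four errors [C / 8]. *)
Lemma no_upper (x : nat -> kothe N) : ~ l1_spreading_model S beta x.
Proof.
move=> xl1; have [/bounded_seqP[M xM] _] := xl1.
have [y hy] := cluster_point xM.
have [_ [C C0 hC0]] := xl1.
have C8 : 0 < C / 8 by rewrite divr_gt0.
have [phi [B [phi1 _ Bd hB]]] := gliding_hump 0 hy (fun=> C8).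
have hC := l1_lower_subsequence HS phi1 hC0; pose u k := on (B k) (x (phi k) - y).
have uB k i : u k i != 0 -> i \in B k by exact: on_supp.
have M0 : 0 < M + `|y| + 1.
  apply: ltr_wpDl => //; apply: addr_ge0 => //.
  exact: le_trans (normr_ge0 (x 0%N)) (xM 0%N).
have uM k (l : ln_idx N) : lnorm l (u k) <= M + `|y| + 1.
  apply: (@le_trans _ _ (lnorm l (x (phi k) - y))); first by apply: ln_mono => i; exact: on_le.
  apply: le_trans (ln_le_knorm l (x (phi k) - y)) _; rewrite -knormE.
  apply: le_trans (ler_normB _ _) _.
  by rewrite -addrA; apply: lerD => //; rewrite lerDl.
have [d db hd] := Hb Bd uB M0 uM C8.
have [|k0 hk0] := @schreier_tail S HS (osucc d) beta; first exact/ltW/limit_succ.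
have [s1 [c1 [S1 t1 [p1 a1'] n1]]] := hd (maxn k0 2).
have [p hp] := fset_bounded s1.
have [s2 [c2 [S2 t2 [p2 a2'] n2]]] := hd (maxn p (maxn k0 2)).
have s12 : fbefore s1 s2.
  move=> i j /hp ip /t2; apply: leq_trans; apply: (leq_trans ip); exact: leq_maxl.
have t2' : tail_ge (maxn k0 2) s2 by apply: tail_geW t2; exact: leq_maxr.
have disj i : i \in s1 -> i \in s2 -> False by move=> i1 /(s12 _ _ i1); rewrite ltnn.
have t12 : tail_ge (maxn k0 2) (s1 `|` s2) by move=> i /fsetUP[/t1|/t2'].
have St : S beta (s1 `|` s2).
  apply: hk0; last by apply: tail_geW t12; exact: leq_maxl.
  apply/(schreier_succP HS); exists 2%N; last by apply: tail_geW t12; exact: leq_maxr.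
  by apply: blocks_cat => //; exact: blocks1.
pose f k := if k \in s1 then c1 k else - c2 k.
have f1 k : k \in s1 -> f k = c1 k by rewrite /f => ->.
have f2 k : k \in s2 -> f k = - c2 k.
  by move=> k2; rewrite /f; case: ifP => // /disj /(_ k2).
have := hC _ St f.
have -> : \sum_(n <- s1 `|` s2) `|f n| = 2.
  have -> : (2 : R) = \sum_(k <- s1) c1 k + \sum_(k <- s2) c2 k by rewrite a1' a2'; lra.
  rewrite sum_fsetU//; congr (_ + _); apply: eq_big_seq => k ks.
    by rewrite f1// ger0_norm.
  by rewrite f2// normrN ger0_norm.
set z := \sum_(n <- _) _; apply/negP; rewrite -ltNge.
pose o k := off (B k) (x (phi k) - y).
have zE i : z i = (comb s1 c1 u i + comb s1 c1 o i) + -1 * (comb s2 c2 u i + comb s2 c2 o i).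
  have e (s : {fset nat}) c : \sum_(k <- s) c k = 1 ->
      comb s c u i + comb s c o i = \sum_(k <- s) c k * x (phi k) i - y i.
    move=> c1s; rewrite -[y i]mul1r -c1s mulr_suml -sumrB -big_split /=.
    apply: eq_bigr => k _; rewrite -mulrBr -mulrDr; congr (_ * _).
    by rewrite -kvalB [RHS](congr1 (fun h => h i) (on_off (B k) (x (phi k) - y))).
  rewrite !e// /z kval_sum sum_fsetU//.
  rewrite (eq_big_seq (fun k => c1 k * x (phi k) i)); last by move=> k k1; rewrite f1.
  rewrite [X in _ + X](eq_big_seq (fun k => - (c2 k * x (phi k) i))); last first.
    by move=> k k2; rewrite f2// kvalZ mulNr.
  by rewrite sumrN; lra.
have ln_o (s : {fset nat}) (c : nat -> R) (l : ln_idx N) : (forall k, 0 <= c k) -> \sum_(k <- s) c k = 1 -> lnorm l (comb s c o) <= C / 8.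
  move=> c0 c1s; apply: le_trans (ln_comb_le _ _ _ _) _.
  apply: (@le_trans _ _ (\sum_(k <- s) c k * (C / 8))); last by rewrite -mulr_suml c1s mul1r.
  by apply: ler_sum => k _; rewrite ger0_norm//; apply: ler_wpM2l => //; exact: hB.
apply: (@le_lt_trans _ _ (C / 2)); last by move: C0; lra.
apply: knorm_le => l; have -> : kval z = fun i => (comb s1 c1 u i + comb s1 c1 o i) +
    -1 * (comb s2 c2 u i + comb s2 c2 o i) by apply/funext => i; exact: zE.
apply: le_trans (ln_triangle _ _ _) _; rewrite ln_scale normrN1 mul1r.
have -> : C / 2 = (C / 8 + C / 8) + (C / 8 + C / 8) by lra.
by apply: lerD; apply: le_trans (ln_triangle _ _ _) _; apply: lerD; rewrite ?ln_o ?n1 ?n2.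
Qed.

End SpreadingModels.

(** * Reflexivity *)

Section Duality.
Context {R : realType} {I : choiceType} (N : lattice_norm R I).
Let X : completeNormedModType R := kothe_space N.

Lemma scalarP (Y : completeNormedModType R) (f : Y -> R) : scalar f ->
  [/\ f 0 = 0, forall x y, f (x + y) = f x + f y, forall c x, f (c *: x) = c * f x &
      forall x, f (- x) = - f x].
Proof.
move=> lf; have f0 : f 0 = 0.
  by have := lf 1 0 0; rewrite scale1r addr0 /= mul1r => /eqP; rewrite -subr_eq subrr => /eqP.
have fD x y : f (x + y) = f x + f y by have := lf 1 x y; rewrite scale1r /= mul1r.
have fZ c x : f (c *: x) = c * f x by have := lf c x 0; rewrite !addr0 f0 addr0.
by split => // x; rewrite -scaleN1r fZ mulN1r.
Qed.

Lemma dual_bounded (Y : completeNormedModType R) (f : Y -> R) : dual f ->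
  exists2 K : R, 0 < K & forall x, `|f x| <= K * `|x|.
Proof.
move=> [/scalarP[f0 fD fZ fN] fc].
have /cvgrPdist_lt /(_ 1 ltr01) : f z @[z --> (0 : Y)] --> f 0 by exact: fc.
move=> /nbhs_ballP[d /= d0 hd]; exists (2 / d); first by rewrite divr_gt0.
move=> x; have [->|x0] := eqVneq x 0; first by rewrite f0 !normr0 mulr0.
have nx : 0 < `|x| by rewrite normr_gt0.
have dx : 0 < d / 2 / `|x| by rewrite !divr_gt0.
have : ball (0 : Y) d ((d / 2 / `|x|) *: x).
  rewrite -ball_normE /= sub0r normrN normrZ (ger0_norm (ltW dx)).
  by rewrite (divfK (lt0r_neq0 nx)) ltr_pdivrMr// ltr_pMr// ltr1n.
move=> /hd; rewrite f0 sub0r normrN fZ normrM (ger0_norm (ltW dx)).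
move=> h; have := ltW h; rewrite -ler_pdivlMl//.
by rewrite mulr1 invfM invrK invf_div mulrC.
Qed.

Lemma bounded_dual (Y : completeNormedModType R) (f : Y -> R) (K : R) : scalar f ->
  (forall x, `|f x| <= K * `|x|) -> dual f.
Proof.
move=> lf hK; split => //; have [f0 fD fZ fN] := scalarP lf.
move=> x; apply/cvgrPdist_lt => e e0.
have K1 : 0 < `|K| + 1 by rewrite ltr_wpDl.
apply/nbhs_ballP; exists (e / (`|K| + 1)); first by rewrite /= divr_gt0.
move=> y; rewrite -ball_normE /= => xy.
have -> : f x - f y = f (x - y) by rewrite fD fN.
apply: le_lt_trans (hK _) _; rewrite ltr_pdivlMr// mulrC in xy.
apply: le_lt_trans xy; apply: ler_wpM2r => //.
by apply: le_trans (ler_norm _) _; rewrite lerDl.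
Qed.

Lemma dual_norm_le (Y : completeNormedModType R) (f : Y -> R) (K : R) : 0 <= K ->
  (forall x, `|f x| <= K * `|x|) -> dual_norm f <= K.
Proof.
move=> K0 hK; apply: ge_sup; first by exists `|f 0|, 0; rewrite //= normr0.
move=> _ [x /= x1 <-]; apply: le_trans (hK x) _.
by rewrite -[leRHS]mulr1; exact: ler_wpM2l.
Qed.

Variables (S : omega1 -> set {fset nat}) (a beta : omega1).
Hypotheses (HS : is_schreier_sequence S) (a1 : (oone <= a)%O).
Hypotheses (Ha : lower_blocks N S a) (Hb : flat_blocks N S beta).

(* Otherwise blocks [u_k] with [f u_k >= e / 2] have averages of small norm. *)
Lemma shrinking (f : X -> R) (e : R) : dual f -> 0 < e ->
  exists A : {fset I}, forall z : X, (forall i, i \in A -> z i = 0) -> `|f z| <= e * `|z|.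
Proof.
move=> df e0; have [K K0 hK] := dual_bounded df; have [lf _] := df.
have [f0 fD fZ fN] := scalarP lf; apply: contrapT => /forallNP nA.
have e2 : 0 < e / 2 by rewrite divr_gt0.
have eK : 0 < e / 2 / K by rewrite !divr_gt0.
have [|B hB Bd] := @disjoint_sequence I (fun C => exists v : X,
    [/\ forall i, v i != 0 -> i \in C, `|v| <= 1 & e / 2 <= f v]).
  move=> A; have /existsNP[z /not_implyP[zA /negP]] := nA A.
  rewrite -ltNge => fz; have z0 : z != 0.
    by apply: contraTneq fz => ->; rewrite f0 !normr0 mulr0 ltxx.
  have nz : 0 < `|z| by rewrite normr_gt0.
  (* Normalised and signed so that [f w > e]; cutting [w] to a finite set then loses at most [e / 2]
     of this value. *)
  pose w : X := (Num.sg (f z) / `|z|) *: z.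
  have w1 : `|w| <= 1.
    rewrite normrZ normrM normfV normr_id (divfK (lt0r_neq0 nz)).
    by rewrite normr_sg lern1; case: (_ == _).
  have fw : e < f w.
    by rewrite fZ mulrAC -normrEsg ltr_pdivlMr.
  have [C hC] := kotheP _ _ (kvalP w) _ eK.
  exists (C `\` A); last by move=> i /fsetDP[].
  have wA i : i \in A -> w i = 0 by move=> /zA zi; rewrite kvalZ zi mulr0.
  have onE : on (C `\` A) w = on C w.
    apply/funext => i; rewrite /on in_fsetD; case: (boolP (i \in A)) => //= iA.
    by case: ifP => // _; exact/esym/wA.
  exists (kon N (C `\` A) w); split.
  - by move=> i; exact: on_supp.
  - apply: knorm_le => l; apply: le_trans (_ : lnorm l w <= _).
      by apply: ln_mono => i; exact: on_le.
    by apply: le_trans w1; exact: ln_le_knorm.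
  - have -> : kon N (C `\` A) w = w - (w - kon N C w) :> X.
      rewrite opprB addrC subrK; apply: val_inj => /=; exact: onE.
    have -> : f (w - (w - kon N C w)) = f w - f (w - kon N C w).
      by rewrite fD fN.
    have : `|f (w - kon N C w)| <= e / 2.
      apply: le_trans (hK _) _; rewrite mulrC -ler_pdivlMr//.
      by apply: knorm_le => l; rewrite -[X in lnorm l X]off_kothe.
    by move=> /(le_trans (ler_norm _)) h; move: fw h; lra.
have /choice[v hv] := hB.
have vB k i : v k i != 0 -> i \in B k by case: (hv k) => h _ _; exact: h.
have e4 : 0 < e / 4 / K by rewrite !divr_gt0.
have [|d _ /(_ 0%N)[s [c [_ _ [c0 c1] small]]]] := Hb Bd vB ltr01 _ e4.
  by move=> k l; case: (hv k) => _ h _; apply: le_trans h; exact: ln_le_knorm.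
pose z : X := \sum_(k <- s) c k *: v k.
have fz : f z = \sum_(k <- s) c k * f (v k).
  rewrite /z; elim: (s : seq nat) => [|k s' IH]; first by rewrite !big_nil.
  by rewrite !big_cons fD fZ IH.
have : e / 2 <= f z.
  have -> : e / 2 = \sum_(k <- s) c k * (e / 2) by rewrite -mulr_suml c1 mul1r.
  rewrite fz; apply: ler_sum => k _.
  by apply: ler_wpM2l; [exact: c0|case: (hv k) => _ _; exact].
have : `|f z| <= e / 4.
  apply: le_trans (hK _) _; rewrite mulrC -ler_pdivlMr//.
  apply: knorm_le => l; apply: le_trans (small l).
  by apply: ln_mono => i; rewrite kval_sum; exact: lexx.
by move=> /(le_trans (ler_norm _)); move: e0; lra.
Qed.

Lemma coord_dual i : dual (fun y : X => y i).
Proof.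
have [C C0 hC] := coord_bound N i.
by apply: (@bounded_dual _ _ C) => // c x y.
Qed.

(** The values of [phi] at the coordinate functionals form a function with bounded seminorms, since
    each seminorm is attained by a finite functional; bounded completeness makes it a vector. It
    represents [phi] on finite combinations of coordinates, which approximate every functional
    because the basis is shrinking. *)
Lemma kothe_reflexive : reflexive_space X.
Proof.
move=> phi phi_lin [C0 hC0].
have [C [C1 hC]] : exists C : R, 0 <= C /\ forall f : X -> R, dual f ->
    `|phi f| <= C * dual_norm f.
  exists `|C0|; split => // f df; apply: le_trans (hC0 f df) _.
  apply: ler_wpM2r; last exact: ler_norm.
  have [K K0 hK] := dual_bounded df.
  apply: le_trans (normr_ge0 (f 0)) _; apply: ub_le_sup; last first.
    by exists 0 => //=; rewrite normr0.
  exists K => _ [x /= x1 <-]; apply: le_trans (hK x) _.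
  by rewrite -[leRHS]mulr1; apply: ler_wpM2l => //; exact: ltW.
have phi0 : phi (fun=> 0) = 0.
  have d0 : dual (fun _ : X => 0 : R).
    by apply: (@bounded_dual _ _ 0) => // [c x y|x]; rewrite ?mul0r ?normr0//= mulr0 addr0.
  have := phi_lin (-1) _ _ d0 d0.
  have -> : (fun x : X => -1 * 0 + 0) = (fun=> 0 : R).
    by apply/funext => x; rewrite mulr0 addr0.
  by rewrite mulN1r addNr.
have phi_sum (B : {fset I}) (g : I -> R) : dual (fun y : X => \sum_(i <- B) g i * y i) /\
    phi (fun y : X => \sum_(i <- B) g i * y i) =
    \sum_(i <- B) g i * phi (fun y : X => y i).
  elim: (B : seq I) => [|j r [dr IH]].
    rewrite big_nil; have -> : (fun y : X => \sum_(i <- [::]) g i * y i) = (fun=> 0 : R).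
      by apply/funext => y; rewrite big_nil.
    split=> //; apply: (@bounded_dual _ _ 0) => // [c x y|x]; rewrite ?mul0r ?normr0//=.
    by rewrite mulr0 addr0.
  have e : (fun y : X => \sum_(i <- j :: r) g i * y i) =
      (fun y : X => g j * y j + \sum_(i <- r) g i * y i).
    by apply/funext => y; rewrite big_cons.
  rewrite e big_cons -IH; split; last exact: phi_lin (coord_dual j) dr.
  have [K1 K10 hK1] := dual_bounded (coord_dual j).
  have [K2 K20 hK2] := dual_bounded dr; have [ldr _] := dr.
  apply: (@bounded_dual _ _ (`|g j| * K1 + K2)) => [c x y|x].
    rewrite ldr /= [X in X + _ = _](_ : _ = g j * (c * x j + y j))//.
    by lra.
  apply: le_trans (ler_normD _ _) _; rewrite mulrDl normrM -mulrA.
  by apply: lerD => //; apply: ler_wpM2l.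
pose x0 i := phi (fun y : X => y i).
have x0N (l : ln_idx N) : lnorm l x0 <= C.
  have [B [g [<- hg]]] := ln_linear l x0.
  have [dg <-] := phi_sum B g.
  apply: le_trans (ler_norm _) _; apply: le_trans (hC _ dg) _.
  rewrite -[leRHS]mulr1; apply: ler_wpM2l => //.
  apply: dual_norm_le => // y; rewrite mul1r; apply: le_trans (hg y) _.
  exact: ln_le_knorm.
have x0k : x0 \in kothe_pred N := boundedly_complete HS a1 Ha x0N.
pose x : X := Kothe x0k; exists x => f df.
have [lf _] := df; have [f0 fD fZ fN] := scalarP lf.
apply/eqP; rewrite -subr_eq0 -normr_le0; apply/ler_addgt0Pr => e e0; rewrite add0r.
(* The remainder [g] of [f] enters twice, at cost [C] through [phi] and at cost the norm of [x]
   through evaluation; the 1 keeps the divisor positive. *)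
have Cx : 0 < C + `|x| + 1 by rewrite ltr_wpDl// addr_ge0.
have [A hA] := shrinking df (divr_gt0 e0 Cx); set d := e / _ in hA.
have d0 : 0 <= d by rewrite ltW// divr_gt0.
pose un i : X := kon N [fset i] (fun=> 1).
have unE i j : un i j = (j == i)%:R by rewrite /un konE /on in_fset1; case: eqP.
have fon (y : X) : f (kon N A y) = \sum_(i <- A) f (un i) * y i.
  have -> : kon N A y = \sum_(i <- A) y i *: un i :> X.
    apply: val_inj; apply/funext => j; rewrite /= kval_sum.
    have e2 : \sum_(i <- A) kval (y i *: un i) j = \sum_(i <- A) y i * (j == i)%:R.
      by apply: eq_bigr => i _; rewrite kvalZ unE.
    rewrite e2 /on; case: ifPn => jA.
      rewrite (big_fsetD1 j)//= eqxx mulr1 big_seq big1 ?addr0// => i /fsetD1P[ij _].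
      by rewrite eq_sym (negbTE ij) mulr0.
    rewrite big_seq big1// => i iA; case: eqVneq => [ji|]; rewrite ?mulr0//.
    by rewrite ji iA in jA.
  elim: (A : seq I) => [|i r IH]; first by rewrite !big_nil.
  by rewrite !big_cons fD fZ IH mulrC.
pose g y := f y - f (kon N A y).
have gE (y : X) : g y = f (y - kon N A y) by rewrite /g fD fN.
have gd (y : X) : `|g y| <= d * `|y|.
  rewrite gE; apply: le_trans (hA _ _) _.
    by move=> i iA; rewrite kvalB konE /on iA subrr.
  apply: ler_wpM2l => //; apply: knorm_le => l; rewrite -[X in lnorm l X]off_kothe.
  apply: le_trans (_ : lnorm l y <= _); last exact: ln_le_knorm.
  by apply: ln_mono => i; exact: off_le.
have [dA phiA] := phi_sum A (fun i => f (un i)).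
have dg : dual g.
  apply: (@bounded_dual _ _ d) => // c y z; rewrite !gE.
  rewrite -fZ -fD; congr f; apply: val_inj; apply/funext => i.
  change ((c * y i + z i) - on A (fun k => c * y k + z k) i =
    c * (y i - on A y i) + (z i - on A z i)).
  by rewrite /on; case: ifP => _; rewrite ?subrr ?subr0 ?mulr0 ?addr0.
have -> : phi f = phi (fun y : X => \sum_(i <- A) f (un i) * y i) + phi g.
  have := phi_lin 1 _ _ dA dg; rewrite mul1r => <-; congr phi; apply/funext => y.
  by rewrite mul1r /g fon addrC subrK.
rewrite phiA -(fon x).
have -> : f (kon N A x) + phi g - f x = phi g - g x by rewrite /g; lra.
apply: le_trans (ler_normB _ _) _.
apply: le_trans (lerD (hC g dg) (gd x)) _.
have dng := dual_norm_le d0 gd.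
apply: (@le_trans _ _ (C * d + d * `|x|)).
  by rewrite lerD2r; exact: ler_wpM2l.
have : d * (C + `|x| + 1) = e by rewrite /d divfK// lt0r_neq0.
by move: d0; rewrite mulrDr mulr1 mulrDr; lra.
Qed.

Lemma kothe_basis : has_long_unconditional_basis X.
Proof.
(* Any well-ordering will do, since the convergence is along finite subsets. *)
have [le wle] := well_ordering_principle I; have ft := @totally_filter I.
pose un i : X := kon N [fset i] (fun=> 1).
have unE i j : un i j = (j == i)%:R by rewrite /un konE /on in_fset1; case: eqP.
exists I, le, un; split => // x.
have psE (c : I -> R) (A : {fset I}) j :
    kval (partial_sum (fun i => c i *: un i) A) j = on A c j.
  have -> : partial_sum (fun i => c i *: un i) A = \sum_(i <- A) c i *: un i.
    by rewrite big_seq_fsetE.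
  rewrite kval_sum.
  have -> : \sum_(i <- A) kval (c i *: un i) j = \sum_(i <- A) c i * (j == i)%:R.
    by apply: eq_bigr => i _; rewrite -unE.
  rewrite /on.
  case: ifPn => jA.
    rewrite (big_fsetD1 j)//= eqxx mulr1 big_seq big1 ?addr0// => i /fsetD1P[ij _].
    by rewrite eq_sym (negbTE ij) mulr0.
  rewrite big_seq big1// => i iA; case: eqVneq => [ji|]; rewrite ?mulr0//.
  by rewrite ji iA in jA.
exists (x : I -> R); split.
  apply/cvgrPdist_le => e e0; have [A hA] := kotheP _ _ (kvalP x) _ e0.
  exists A => // B /= AB; apply: knorm_le => l; apply: le_trans (hA l).
  apply: ln_mono => i; apply: le_trans (off_subset x i AB).
  by rewrite kvalB psE /on /off; case: ifP; rewrite ?subrr ?subr0.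
move=> c /cvgrPdist_le hc; apply/funext => j.
have [C C0 hC] := coord_bound N j.
apply/eqP; rewrite -subr_eq0 -normr_le0; apply/ler_addgt0Pr => e e0; rewrite add0r.
have [A _ hA] := hc _ (divr_gt0 e0 C0).
have := hA (j |` A)%fset (fsubsetUr _ _) => h.
have := hC (x - partial_sum (fun i => c i *: un i) (j |` A)).
rewrite kvalB psE /on in_fset1U eqxx /= => /le_trans; apply.
by rewrite mulrC -ler_pdivlMr.
Qed.

End Duality.

Local Close Scope fset_scope.

Lemma injective_card_le (T U : Type) (f : T -> U) : injective f -> [set: T] #<= [set: U].
Proof.
move=> fi; rewrite -(card_le_eql (@inj_card_eq _ _ setT f _)).
  exact: subset_card_le.
by move=> x y _ _; exact: fi.
Qed.

(** * Density *)

Section Density.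
Context {R : realType} {I : choiceType} (N : lattice_norm R I).
Let X : completeNormedModType R := kothe_space N.

Let unit i : kothe N := kon N [fset i]%fset (fun=> 1).

Let unitE i j : unit i j = (j == i)%:R.
Proof. by rewrite konE /on in_fset1; case: eqP. Qed.

(** The difference of two unit vectors has norm at least that of each, so the balls around them of
    half their norms are disjoint, and each contains a point of [D]. *)
Lemma kothe_density_le (D : set X) : dense D -> [set: I] #<= D.
Proof.
move=> dD.
have unit_gt0 i : 0 < `|unit i : X|.
  rewrite normr_gt0; apply/eqP => /(congr1 (fun u : kothe N => u i)).
  by rewrite unitE eqxx => /eqP; rewrite oner_eq0.
have /choice[d hd] : forall i, exists d : X, D d /\ `|(unit i : X) - d| < `|unit i : X| / 2.
  move=> i; have /= [||d] := dD (ball (unit i : X) (`|unit i : X| / 2)).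
  - by exists (unit i); apply: ballxx; rewrite divr_gt0.
  - exact: ball_open.
  - by rewrite -ball_normE /= => -[? ?]; exists d.
have di : injective d.
  move=> i j dij; apply: contrapT => /eqP ij.
  have sep (k l : I) : k != l -> `|unit k : X| <= `|(unit k - unit l : X)|.
    move=> kl; apply: knorm_le => m; apply: le_trans (ln_le_knorm m _).
    apply: ln_mono => o; rewrite kvalB !unitE; case: eqVneq => [->|_].
      by rewrite (negbTE kl) subr0.
    by rewrite normr0.
  have h : `|(unit i - unit j : X)| < `|unit i : X| / 2 + `|unit j : X| / 2.
    have -> : unit i - unit j = (unit i - d i : X) + (d j - unit j : X).
      by rewrite dij addrA subrK.
    apply: le_lt_trans (ler_normD _ _) _; apply: ltrD; first by case: (hd i).
    by rewrite distrC; case: (hd j).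
  have := sep _ _ ij; have := sep j i; rewrite eq_sym distrC => /(_ ij); move: h.
  by rewrite /X; lra.
have -> : ([set: I] #<= D) = (range d #<= D).
  by apply/esym/card_le_eql/inj_card_eq => x y _ _; exact: di.
by apply: subset_card_le => _ [i _ <-]; case: (hd i).
Qed.

Lemma kothe_density : infinite_set [set: I] -> has_density X I.
Proof.
move=> /[dup] infI /seq_injection[h hinj].
split; last exact: kothe_density_le.
pose F (r : seq (I * rat)) : X := \sum_(p <- r) ratr p.2 *: (unit p.1 : X).
have dF : dense (range F).
  move=> O [x Ox] Oo; have := Oo; rewrite openE => /(_ _ Ox)/nbhs_ballP[e /= e0 he].
  have e4 : 0 < e / 4 by rewrite divr_gt0.
  have [A hA] := kotheP _ _ (kvalP x) _ e4.
  have d0 : 0 < e / 4 / (2 * #|` A|.+1%:R) by rewrite divr_gt0// mulr_gt0.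
  set d := _ / _ in d0.
  have /choice[q hq] : forall i, exists q : rat, `|x i - ratr q| <= d.
    move=> i; have [|q] := @rat_in_itvoo R (x i - d) (x i); first by rewrite ltrBlDr ltrDl.
    rewrite in_itv /= => /andP[q1 q2]; exists q; rewrite ler_norml; lra.
  pose y := F [seq (i, q i) | i <- A].
  have yE i : (y : kothe N) i = on A (fun i => ratr (q i)) i.
    rewrite /y /F kval_sum big_map.
    under eq_bigr => j _ do rewrite kvalZ unitE.
    rewrite /on; case: ifPn => iA.
      rewrite (big_fsetD1 i)//= eqxx mulr1 big_seq big1 ?addr0// => j.
      by rewrite !inE eq_sym => /andP[/negbTE -> _]; rewrite mulr0.
    rewrite big_seq big1// => j jA; case: eqVneq => [ij|]; last by rewrite mulr0.
    by rewrite ij jA in iA.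
  exists y; split; last by exists [seq (i, q i) | i <- A].
  apply: he; rewrite -ball_normE /=; apply: le_lt_trans (_ : e / 2 < e); last lra.
  apply: knorm_le => l.
  apply: (@le_trans _ _ (lnorm l (fun i => on A (fun i => x i - ratr (q i)) i + off A x i))).
    apply: ln_mono => i; rewrite kvalB yE /on /off.
    by case: ifP => _; rewrite ?addr0 ?subr0 ?add0r.
  apply: le_trans (ln_triangle _ _ _) _.
  have -> : e / 2 = e / 4 + e / 4 by lra.
  apply: lerD (hA l); apply: le_trans (ln_on _ _ _) _.
  apply: le_trans (sum_le_card (c := 2 * d) _) _.
    by move=> i _; rewrite ler_pM2l.
  have -> : 2 * d = e / 4 / #|` A|.+1%:R.
    by rewrite /d invfM mulrCA [2 * _]mulrA divff// mul1r.
  rewrite -[leLHS]mulr_natr mulrAC ler_pdivrMr// ler_pM2l// ler_nat; exact: leqnSn.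
exists (range F) => //; rewrite card_eq_le (kothe_density_le dF) andbT.
apply: card_le_trans (card_image_le _ _) _.
(* The rational is coded by the length of a constant sequence, so that a second use of [h] codes a
   whole combination by one index. *)
pose code (p : I * rat) := h (p.1 :: nseq (choice.pickle p.2) p.1).
apply: (@injective_card_le _ _ (fun r => h (map code r))) => r s /hinj.
apply: inj_map => -[i p] [j q] /hinj[-> /(congr1 size)].
by rewrite !size_nseq => /(pcan_inj choice.pickleK) ->.
Qed.

End Density.

(** * Subsymmetric sequences *)

Lemma big_fset_sorted (V : zmodType) (s : {fset nat}) (F : nat -> V) :
  \sum_(j <- s) F j = \sum_(i < #|` s|) F (nth 0%N (sort leq s) i).
Proof.
have -> : \sum_(j <- s) F j = \sum_(j <- sort leq s) F j.
  by apply: perm_big; rewrite perm_sym perm_sort.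
by rewrite (big_nth 0%N) size_sort big_mkord.
Qed.

Lemma big_fset_iota (V : zmodType) (p n : nat) (F : nat -> V) :
  \sum_(j <- [fset j in iota p n]%fset) F j = \sum_(i < n) F (p + i)%N.
Proof.
have -> : \sum_(j <- [fset j in iota p n]%fset) F j = \sum_(j <- iota p n) F j.
  apply: perm_big; apply: uniq_perm; rewrite ?fset_uniq ?iota_uniq// => j.
  by rewrite !inE.
elim: n p => [|n IH] p; first by rewrite big_nil big_ord0.
rewrite big_cons big_ord_recl addn0 IH; congr (_ + _).
by apply: eq_bigr => i _; rewrite addSnnS.
Qed.

Lemma card_fset_iota (p n : nat) : #|` [fset j in iota p n]%fset| = n.
Proof. by rewrite card_fseq undup_id ?iota_uniq// size_iota. Qed.

Lemma sort_leq_lt (s : {fset nat}) (i j : nat) : (i < j < #|` s|)%N ->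
  (nth 0 (sort leq s) i < nth 0 (sort leq s) j)%N.
Proof.
move=> /andP[ij js].
have st : sorted ltn (sort leq s).
  rewrite ltn_sorted_uniq_leq sort_uniq fset_uniq.
  exact: (sort_sorted leq_total).
apply: (sorted_ltn_nth ltn_trans) => //; rewrite inE size_sort//.
exact: ltn_trans ij js.
Qed.

Section SubsymmetricSequences.
Context {R : realType} (X : completeNormedModType R).
Variables (S : omega1 -> set {fset nat}) (a beta : omega1).
Hypotheses (HS : is_schreier_sequence S) (a1 : (oone <= a)%O).
Hypothesis lower : forall x : nat -> X, bounded_fun x ->
  (forall phi : nat -> nat, increasing_seq phi -> ~ cvgn (x \o phi)) ->
  exists2 phi : nat -> nat, increasing_seq phi & l1_spreading_model S a (x \o phi).
Hypothesis upper : forall x : nat -> X, ~ l1_spreading_model S beta x.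

Lemma separated_no_cvg (x : nat -> X) (d : R) (phi : nat -> nat) : 0 < d ->
  (forall m n, (m < n)%N -> d <= `|x m - x n|) -> increasing_seq phi -> ~ cvgn (x \o phi).
Proof.
move=> d0 sep phi1 /cvg_ex[z /cvgrPdist_lt/(_ (d / 2))].
rewrite divr_gt0// => /(_ isT)[p _ hp].
have := sep _ _ (increasing_lt phi1 (ltnSn p)); apply/negP; rewrite -ltNge.
have -> : x (phi p) - x (phi p.+1) = - (z - x (phi p)) + (z - x (phi p.+1)).
  by rewrite opprB addrA subrK.
apply: le_lt_trans (ler_normD _ _) _; rewrite normrN [ltRHS]splitr.
by apply: ltrD; apply: hp => /=; rewrite ?leqnn ?leqnSn.
Qed.

(* A subsequence with the lower estimate on the sets of S a that consist of
   large elements transfers it, by subsymmetry, to every finite set. *)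
Lemma no_subsymmetric (x : nat -> X) : ~ subsymmetric x.
Proof.
move=> [[m [n xmn]] [C C1 hC]]; have C0 : 0 < C := lt_le_trans ltr01 C1.
wlog mn : m n xmn / (m < n)%N.
  move=> th; case: (ltngtP m n) => mn; first exact: (th m n).
    by apply: (th n m) => //; rewrite eq_sym.
  by rewrite mn eqxx in xmn.
have bx : bounded_fun x.
  apply/bounded_seqP; exists (C * `|x 0%N|) => k.
  have h1 (l : 'I_1 -> nat) : {homo l : i j / (i < j)%N} by move=> i j; rewrite !ord1.
  by have := hC 1%N (fun=> 1) (fun=> k) (fun=> 0%N) (h1 _) (h1 _); rewrite !big_ord1 !scale1r.
pose sgn (i : 'I_2) : R := if i == ord0 then 1 else -1.
pose pr k l (i : 'I_2) : nat := if i == ord0 then k else l.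
have prl k l : (k < l)%N -> {homo pr k l : i j / (i < j)%N}.
  move=> kl i j ij; rewrite /pr; have -> : (j == ord0) = false.
    by apply/negbTE; rewrite -val_eqE -lt0n (leq_trans _ ij).
  suff -> : i == ord0 by [].
  by rewrite -val_eqE /=; have := leq_trans ij (ltn_ord j : (j < 2)%N); case: (i : nat).
have prE k l : \sum_(i < 2) sgn i *: x (pr k l i) = x k - x l.
  by rewrite 2!big_ord_recl big_ord0 addr0 /sgn /pr /= scale1r scaleN1r.
(* Subsymmetry compares the given pair with every other pair, so the sequence is separated and no
   subsequence converges. *)
pose d := `|x m - x n| / C.
have d0 : 0 < d by rewrite divr_gt0// normr_gt0 subr_eq0.
have sep k l : (k < l)%N -> d <= `|x k - x l|.
  move=> kl; have := hC 2 sgn _ _ (prl _ _ mn) (prl _ _ kl); rewrite !prE => h.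
  by rewrite ler_pdivrMr// mulrC.
have [|phi phi1 [_ [c c0 hc]]] := lower bx.
  by move=> phi; exact: separated_no_cvg d0 sep.
have [k hk] := schreier_large HS a1.
apply: (@upper x); split => //; exists (c / C) => [|s _ f]; first exact: divr_gt0.
pose N := #|` s|; pose p := maxn k N; pose t := sort leq s.
(* An interval of the same cardinality as [s] that starts beyond this cardinality; its terms along
   [phi] are compared with those of [s] in order. *)
have Sp : S a [fset j in iota p N]%fset.
  apply: hk => [j|j]; rewrite !inE mem_iota => /andP[pj _].
    by apply: leq_trans pj; exact: leq_maxl.
  by rewrite card_fset_iota; apply: leq_trans pj; exact: leq_maxr.
have := hc _ Sp (fun j => f (nth 0%N t (j - p)%N)).
rewrite !big_fset_iota => hsp.
have := hC N (fun i => f (nth 0%N t i)) (fun i => phi (p + i)%N) (fun i => nth 0%N t i).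
have h1 : {homo (fun i : 'I_N => phi (p + i)%N) : i j / (i < j)%N}.
  by move=> i j ij; apply: (increasing_lt phi1); rewrite ltn_add2l.
have h2 : {homo (fun i : 'I_N => nth 0%N t i) : i j / (i < j)%N}.
  by move=> i j ij; apply: sort_leq_lt; rewrite ij ltn_ord.
move=> /(_ h1 h2); rewrite !big_fset_sorted -/N -/t mulrAC ler_pdivrMr// [leRHS]mulrC.
apply: le_trans; move: hsp.
under eq_bigr do rewrite addKn.
by under [in X in _ <= X]eq_bigr do rewrite addKn.
Qed.

End SubsymmetricSequences.

(** * Total incomparability *)

Section Incomparability.
Context {R : realType} {I : choiceType} (N : lattice_norm R I) (Y : completeNormedModType R).
Let X : completeNormedModType R := kothe_space N.
Variables (S : omega1 -> set {fset nat}) (b beta : omega1).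
Hypotheses (HS : is_schreier_sequence S) (beta_b : (beta <= b)%O).
Hypothesis upper : forall x : nat -> X, ~ l1_spreading_model S beta x.
Hypothesis lower : forall x : nat -> Y, bounded_fun x ->
  (forall phi : nat -> nat, increasing_seq phi -> ~ cvgn (x \o phi)) ->
  exists2 phi : nat -> nat, increasing_seq phi & l1_spreading_model S b (x \o phi).

Let linear_subspace (U : set X) := U 0 /\ forall (c : R) u v, U u -> U v -> U (c *: u + v).

(** Each further vanishing coordinate lowers the dimension by at most one: a vector nonzero at this
    coordinate, if there is one, completes a spanning family. *)
Lemma infinite_dimensional_vanish (U : set X) (s : seq I) :
  linear_subspace U -> infinite_dimensional U ->
  infinite_dimensional [set u | U u /\ forall i, i \in s -> (u : kothe N) i = 0].
Proof.
move=> lU; elim: s => [|j s IH] dU.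
  suff -> : [set u | U u /\ forall i, i \in [::] -> (u : kothe N) i = 0] = U by [].
  by apply/seteqP; split=> u // [].
have := IH dU; set W := [set u | _]; move=> dW [n [v [hv span]]]; apply: dW.
have [W0|/existsNP[w /not_implyP[Ww /eqP wj]]] :=
    pselect (forall u, W u -> (u : kothe N) j = 0).
  exists n, v; split=> [i|u Wu]; first by have [Uv hvi] := hv i; split=> // k ks; apply: hvi; rewrite in_cons ks orbT.
  apply: span; have [Uu hu] := Wu; split=> // i; rewrite in_cons => /orP[/eqP ->|]; [exact: W0|exact: hu].
exists n.+1, (fun i => if unlift ord0 i is Some k then v k else w); split=> [i|u Wu].
  case: unliftP => [k _|_] //; have [Uv hvi] := hv k.
  by split=> // l ls; apply: hvi; rewrite in_cons ls orbT.
pose r := (u : kothe N) j / (w : kothe N) j.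
have [|c hc] := span (- r *: w + u).
  have [[Uu hu] [Uw hw]] := (Wu, Ww); split; first exact: lU.2.
  move=> i; rewrite in_cons kvalD kvalZ => /orP[/eqP ->|iS].
    by rewrite mulNr /r divfK// addNr.
  by rewrite hu// hw// mulr0 addr0.
exists (fun i => if unlift ord0 i is Some k then c k else r).
rewrite big_ord_recl unlift_none.
under eq_bigr do rewrite liftK.
by rewrite -hc addrA scaleNr subrr add0r.
Qed.

(** Each vector vanishes on finite sets outside which its predecessors have norm at most 1/2;
    subtracting it leaves their restrictions to these sets intact. *)
Lemma separated_unit_sequence (U : set X) : linear_subspace U -> infinite_dimensional U ->
  exists u : nat -> X, [/\ forall k, U (u k), forall k, `|u k| = 1 &
    forall m n, (m < n)%N -> 1 / 2 <= `|u m - u n|].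
Proof.
move=> lU dU.
have unit_vector (A : {fset I}) : exists uB : X * {fset I}, [/\ U uB.1, `|uB.1| = 1,
    forall i, i \in A -> (uB.1 : kothe N) i = 0 & forall l : ln_idx N, lnorm l (off uB.2 (uB.1 : kothe N)) <= 1 / 2].
  have [u [Uu hu] u0] : exists2 u : X, U u /\ (forall i, i \in A -> (u : kothe N) i = 0) & u != 0.
    apply: contrapT => nu; apply: (infinite_dimensional_vanish (s := A) lU dU).
    exists 0%N, (fun=> 0); split=> [[]//|u hu]; exists (fun=> 0); rewrite big_ord0.
    by apply: contrapT => /eqP u0; apply: nu; exists u.
  pose w := `|u|^-1 *: u.
  have [B hB] := kotheP _ _ (kvalP (w : kothe N)) (1 / 2) (divr_gt0 ltr01 (ltr0Sn R 1)).
  exists (w, B); split=> //=.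
  - by have := lU.2 `|u|^-1 _ _ Uu lU.1; rewrite addr0.
  - by rewrite normrZ ger0_norm ?invr_ge0// mulVf// normr_eq0.
  - move=> i iA; change (`|u|^-1 * (u : kothe N) i = 0); by rewrite hu// mulr0.
have /choice[g hg] := unit_vector.
pose st := fix st k := if k is k'.+1 then (st k' `|` (g (st k')).2)%fset else fset0.
have st_le k l : (k <= l)%N -> (st k `<=` st l)%fset.
  move=> /subnK <-; elim: (l - k)%N => // j IH; rewrite addSn.
  by apply: fsubset_trans IH _; exact: fsubsetUl.
exists (fun k => (g (st k)).1); split=> [k|k|m n mn]; [by case: (hg (st k))|by case: (hg (st k))|].
have [_ nm _ hm] := hg (st m); have [_ _ hn _] := hg (st n).
suff : `|(g (st m)).1| <= `|(g (st m)).1 - (g (st n)).1| + 1 / 2 by rewrite nm; lra.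
apply: knorm_le => l; rewrite [X in lnorm l X](on_off (g (st m)).2).
apply: le_trans (ln_triangle _ _ _) _; apply: lerD (hm l).
apply: le_trans (ln_le_knorm l _); apply: ln_mono => i.
rewrite /on kvalB; case: ifPn => iB; last by rewrite normr0.
rewrite hn ?subr0//; apply: (fsubsetP (st_le _ _ mn)) => /=.
by rewrite in_fsetU iB orbT.
Qed.

(** A separated sequence of [U] has an image without convergent subsequences, because the inverse is
    continuous on the closed set [V]. The lower estimate of [Y] for the image comes back through the
    bound on [T], against the upper estimate of [X]. *)
Lemma kothe_incomparable : totally_incomparable X Y.
Proof.
move=> U V [cU U0 Ul] dU [cV V0 Vl] [T [T' [[TV T'U T'T TT'] Tl Tc T'c]]].
have [u [Uu u1 usep]] := separated_unit_sequence (conj U0 Ul) dU.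
have T0 : T 0 = 0.
  have := Tl 1 0 0 U0 U0; rewrite scaler0 addr0 scale1r => /eqP.
  by rewrite -subr_eq subrr => /eqP.
have Usum (s : seq nat) (c : nat -> R) (w : nat -> X) : (forall k, U (w k)) ->
    U (\sum_(k <- s) c k *: w k) /\
    T (\sum_(k <- s) c k *: w k) = \sum_(k <- s) c k *: T (w k).
  move=> Uw; elim: s => [|k s [IH1 IH2]]; first by rewrite !big_nil.
  by rewrite !big_cons; split; [exact: Ul|rewrite Tl// IH2].
have [K K0 hK] : exists2 K : R, 0 < K & forall w, U w -> `|T w| <= K * `|w|.
  have hc : T x @[x --> within U (nbhs (0 : X))] --> (0 : Y).
    by rewrite -T0; move/subspace_continuousP : Tc; apply.
  move/cvgrPdist_lt : hc => /(_ 1 ltr01).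
  rewrite /within => /nbhs_ballP[d /= d0 hd]; exists (2 / d); first by rewrite divr_gt0.
  move=> w Uw; have [->|w0] := eqVneq w 0; first by rewrite T0 !normr0 mulr0.
  have nw : 0 < `|w| by rewrite normr_gt0.
  have dw : 0 < d / 2 / `|w| by rewrite !divr_gt0.
  have UZ c : U (c *: w) by have := Ul c _ _ Uw U0; rewrite addr0.
  have TZ c : T (c *: w) = c *: T w.
    by have := Tl c _ _ Uw U0; rewrite T0 !addr0.
  have : ball (0 : X) d ((d / 2 / `|w|) *: w).
    rewrite -ball_normE /= sub0r normrN normrZ (ger0_norm (ltW dw)).
    by rewrite (divfK (lt0r_neq0 nw)) ltr_pdivrMr// ltr_pMr// ltr1n.
  move=> /hd/(_ (UZ _)); rewrite sub0r normrN TZ normrZ (ger0_norm (ltW dw)).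
  rewrite mulrC -ltr_pdivlMr// => /ltW; rewrite mul1r.
  by rewrite !invf_div mulrC.
have [|phi phi1 cv|phi phi1 [bd [C C0 hC]]] := lower (x := T \o u).
- by apply/bounded_seqP; exists (K * 1) => n; rewrite -(u1 n); exact: hK.
- apply: (@separated_no_cvg _ X u (1 / 2) phi) => //.
  move: cv => /cvg_ex[z hz].
  have Vz : V z.
    by apply: (closed_cvg _ cV _ _ hz); apply: nearW => n; exact: TV.
  have /subspace_continuousP/(_ _ Vz) T'z := T'c.
  apply/cvg_ex; exists (T' z).
  have -> : u \o phi = T' \o (T \o u \o phi) by apply/funext => n /=; rewrite T'T.
  apply: cvg_comp T'z => A; rewrite /within /nbhs /= => /hz hA.
  by apply: (@filterS nat \oo _ _ _ _ hA) => n; apply; exact: TV.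
(* [S beta] is contained in [S b] only for sets beyond some [k]; the sequence is shifted
   accordingly. *)
have [k hk] := schreier_tail HS beta_b.
have shift1 : increasing_seq (addn k) by move=> i j; rewrite leEnat leq_add2l.
apply: (@upper (fun n => u (phi (k + n)%N))); split.
  by apply/bounded_seqP; exists 1 => n; rewrite u1.
exists (C / K) => [|s Ss c]; first by rewrite divr_gt0.
have kinj := increasing_inj shift1.
have Sk : S b [fset (k + n)%N | n in s]%fset.
  apply: hk => [|i /imfsetP[j _ ->]]; last exact: leq_addr.
  by apply: (schreier_spread HS) Ss _ _ => [i j _ _|i _]; rewrite ?ltn_add2l// leq_addl.
have := hC _ Sk (fun n => c (n - k)%N); rewrite !sum_imfset//= => h.
rewrite mulrAC ler_pdivrMr// [leRHS]mulrC.
have [Us Ts] := Usum s c (fun n => u (phi (k + n)%N)) (fun n => Uu _).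
apply: le_trans (hK _ Us); rewrite Ts; move: h.
under eq_bigr do rewrite addKn.
by under [in X in _ <= X]eq_bigr do rewrite addKn.
Qed.

End Incomparability.

(** * The mixed norm as a lattice norm, and the theorem *)

Section MixedNorm.
Context {R : realType} {kappa : choiceType} (A : set {fset nat}) (F : nat -> set {fset kappa}).
Hypotheses (F0 : forall n, F n fset0) (Fsing : forall i, F 0%N [fset i]%fset).

Let trivial_functional : functional (R := R) A F :=
  Functional (fun_t := fun=> fset0) 0 (tsirelson_zero A) F0.

(** The signs of [x], weighted like the tests, give a functional that attains the seminorm at [x]
    and is dominated by it elsewhere. *)
Lemma pnorm_linear (l : functional (R := R) A F) x : exists (B : {fset kappa}) (g : kappa -> R),
  \sum_(i <- B) g i * x i = pnorm l x /\
  forall y, `|\sum_(i <- B) g i * y i| <= pnorm l y.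
Proof.
pose B := (\bigcup_(n <- iota 0 (fun_n l)) fun_t l n)%fset.
pose g i := \sum_(n < fun_n l) (fun_w l n / 2 ^+ n) * ((i \in fun_t l n)%:R * Num.sg (x i)).
have tB (n : 'I_(fun_n l)) : (fun_t l n `<=` B)%fset.
  apply/fsubsetP => i it; apply/bigfcupP; exists (n : nat) => //.
  by rewrite andbT mem_iota add0n ltn_ord.
have gE y : \sum_(i <- B) g i * y i =
    \sum_(n < fun_n l) (fun_w l n / 2 ^+ n) * \sum_(i <- fun_t l n) Num.sg (x i) * y i.
  under eq_bigr => i _ do rewrite mulr_suml.
  rewrite exchange_big /=; apply: eq_bigr => n _.
  rewrite -(big_fset_incl _ (tB n)) => [|i _ /negbTE ->]; last by rewrite !(mul0r, mulr0).
  by rewrite mulr_sumr big_seq [RHS]big_seq; apply: eq_bigr => i ->; rewrite mul1r mulrA.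
exists B, g; split=> [|y].
  rewrite gE; apply: eq_bigr => n _; congr (_ * _); apply: eq_bigr => i _.
  by rewrite normrEsg.
rewrite gE; apply: le_trans (ler_norm_sum _ _ _) _; apply: ler_sum => n _.
rewrite normrM (ger0_norm (weight_ge0 l n)); apply: ler_wpM2l; first exact: weight_ge0.
apply: le_trans (ler_norm_sum _ _ _) _; apply: ler_sum => i _.
rewrite normrM; apply: ler_piMl => //.
by rewrite normr_sg; case: (x i != 0).
Qed.

Definition mixed_norm : lattice_norm R kappa :=
  @LatticeNorm R kappa (functional A F) trivial_functional (@pnorm R kappa A F)
    (@pnorm_ge0 _ _ _ _) (@pnorm_triangle _ _ _ _) (@pnorm_scale _ _ _ _) (@pnorm_mono _ _ _ _)
    (@pnorm_unit _ _ _ _) (pnorm_pos A F0 Fsing) (@pnorm_local _ _ _ _) pnorm_linear.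

End MixedNorm.

Local Close Scope ring_scope.
Local Close Scope card_scope.

Lemma mixed_space_exists (R : realType) (S : omega1 -> set {fset nat}) (kappa : choiceType)
    (B : set (set {fset kappa})) times (a : omega1) :
  is_schreier_sequence S -> infinite_set [set: kappa] -> is_basis B times -> (oone <= a)%O ->
  exists N : lattice_norm R kappa, lower_blocks N S a /\
    flat_blocks N S (oadd (oiota (oexp oomega a)) (omul a oomega)).
Proof.
move=> HS ik HB a1.
have [F [Fn Fsing CL]] := consecutively_large_families HS ik HB a1.
have F0 n : F n fset0 by case: (Fn n).
exists (mixed_norm (S a) F0 Fsing); split.
  move=> u C d Cd uC d0 hd; apply: (disjoint_l1 _ F0 Cd uC _ CL d0 hd).
    by move=> n; case: (Fn n).
  by move=> s f; exact: (schreier_spread HS).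
move=> u C M Cd uC M0 uM e e0.
apply: (small_combination HS a1 _ F0 _ _ Cd uC M0 uM e0).
- by apply: indec_limit; case: (oiotaP (oexp oomega a)).
- by move=> n; case: (Fn n).
- by move=> n; case: (Fn n).
Qed.

Theorem theorem5p12 (R : realType) (S : omega1 -> set {fset nat})
  (kappa : choiceType) :
  is_schreier_sequence S ->
  infinite_set [set: kappa] ->
  (exists (B : set (set {fset kappa}))
          (times : set {fset kappa} -> set {fset nat} -> set {fset kappa}),
      is_basis B times) ->
  exists X : omega1 -> completeNormedModType R,
    forall a : omega1, (oone <= a)%O ->
      [/\ reflexive_space (X a), has_density (X a) kappa &
          has_long_unconditional_basis (X a)] /\
      [/\ forall x : nat -> X a, bounded_fun x ->
            (forall phi : nat -> nat, increasing_seq phi -> ~ cvgn (x \o phi)) ->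
            exists2 phi : nat -> nat, increasing_seq phi &
              l1_spreading_model S a (x \o phi),
          forall x : nat -> X a,
            ~ l1_spreading_model S
                (oadd (oiota (oexp oomega a)) (omul a oomega)) x,
          forall x : nat -> X a, ~ subsymmetric x &
          forall b : omega1,
            (oadd (oiota (oexp oomega a)) (omul a oomega) <= b)%O ->
            totally_incomparable (X a) (X b)].
Proof.
move=> HS ik [B [times HB]].
have /choice[N hN] : forall a, exists N : lattice_norm R kappa, (oone <= a)%O ->
    lower_blocks N S a /\ flat_blocks N S (oadd (oiota (oexp oomega a)) (omul a oomega)).
  move=> a; have [a1|a1] := boolP (oone <= a)%O.
    by have [N hN] := mixed_space_exists R HS ik HB a1; exists N.
  (* At ordinal zero any space serves as a default value; the one for ordinal one is taken. *)
  by have [N _] := mixed_space_exists R HS ik HB (lexx oone); exists N.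
have lower a : (oone <= a)%O -> forall x : nat -> kothe_space (N a), bounded_fun x ->
    (forall phi : nat -> nat, increasing_seq phi -> ~ cvgn (x \o phi)) ->
    exists2 phi : nat -> nat, increasing_seq phi & l1_spreading_model S a (x \o phi).
  by move=> a1 x; apply: (lower_subsequence HS a1); case: (hN a a1).
exists (fun a => kothe_space (N a)) => a a1; have [low flat] := hN a a1.
have upper x := no_upper HS a1 (threshold_limit _ a1) low flat (x := x).
split; split.
- exact: (kothe_reflexive HS a1 low flat).
- exact: kothe_density.
- exact: kothe_basis.
- exact: lower.
- exact: upper.
- exact: (no_subsymmetric HS a1 (lower a a1) upper).
- move=> b ab; apply: (kothe_incomparable HS ab upper); apply: lower.
  (* The lower estimate in the space of [b] needs [1 <= b], which holds since [b] is at least an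
     exp-indecomposable ordinal. *)
  apply: le_trans ab; apply: le_trans oone_le_oomega _; apply: le_trans (le_oadd _ _).
  by case: (oiotaP (oexp oomega a)) => -[].
Qed.
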